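(* In the Bradley–Terry model, if $b_n^{11}/c_n^6=o\big(n^{1/2}/(\log n)^{5/2}\big)$, then under the homogeneous null $H_0:\beta_2=\cdots=\beta_r$ with a fixed integer $r>2$, the statistic $2\{\ell_{bt}(\widehat{\boldsymbol\beta})-\ell_{bt}(\widehat{\boldsymbol\beta}^0)\}$ converges in distribution, as $n\to\infty$, to the chi-square distribution with $r-2$ degrees of freedom, where $\widehat{\boldsymbol\beta}$ maximizes $\ell_{bt}$ over $\mathbb R^{n-1}$ and $\widehat{\boldsymbol\beta}^0$ maximizes $\ell_{bt}$ over $\Theta_0=\{\boldsymbol\beta\in\mathbb R^{n-1}:\beta_2=\cdots=\beta_r\}$.
   Context: Bradley–Terry model: subjects $1,\dots,n$; $K\ge1$ a fixed integer. For $1\le i<j\le n$, $a_{ij}\sim\mathrm{Binomial}(K,p_{ij})$ are mutually independent with $p_{ij}=e^{\beta_i-\beta_j}/(1+e^{\beta_i-\beta_j})$, and $a_{ji}=K-a_{ij}$. $\beta_1=0$, parameter $\boldsymbol\beta=(\beta_2,\dots,\beta_n)^\top$ (true value depending on $n$, satisfying the null). $d_i=\sum_{j\ne i}a_{ij}$. $\ell_{bt}(\boldsymbol\beta)=\sum_{i=1}^n\beta_id_i-K\sum_{1\le i<j\le n}\log(e^{\beta_i}+e^{\beta_j})$. $b_n=\max_{i\ne j}(1+e^{\beta_i-\beta_j})^2/e^{\beta_i-\beta_j}$, $c_n=\min_{i\ne j}(1+e^{\beta_i-\beta_j})^2/e^{\beta_i-\beta_j}$ at the true parameter. *)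

(* Defs.v *)
From HB Require Import structures.
From mathcomp Require Import all_boot all_order all_algebra.
From mathcomp Require Import all_classical all_reals all_analysis.
Set Implicit Arguments. Unset Strict Implicit. Unset Printing Implicit Defensive.
Import Order.TTheory GRing.Theory Num.Theory.
Import numFieldNormedType.Exports.
Local Open Scope classical_set_scope.
Local Open Scope ring_scope.

(* Subjects are indexed 0-based by 'I_n: ordinal i is the paper's subject i+1.
   A data outcome is  w : {ffun 'I_n * 'I_n -> 'I_K.+1};  for i < j,
   w (i,j) is a_ij; coordinates (i,j) with i >= j are unused (degenerate at 0). *)
Definition outcome (n K : nat) := {ffun 'I_n * 'I_n -> 'I_K.+1}.

Section BT.
Variable R : realType.

Definition bt_a (n K : nat) (w : outcome n K) (i j : 'I_n) : R :=
  if (i < j)%N then (w (i, j) : nat)%:R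
  else if (j < i)%N then K%:R - (w (j, i) : nat)%:R else 0.

Definition bt_d (n K : nat) (w : outcome n K) (i : 'I_n) : R :=
  \sum_(j < n | j != i) bt_a w i j.

Definition ell_bt (n K : nat) (w : outcome n K) (beta : 'I_n -> R) : R :=
  \sum_(i < n) beta i * bt_d w i
  - K%:R * \sum_(i < n) \sum_(j < n | (i < j)%N) ln (expR (beta i) + expR (beta j)).

(* Parameter space R^{n-1}: beta_1 = 0 (paper's subject 1 is ordinal 0). *)
Definition Theta (n : nat) : set ('I_n -> R) :=
  [set beta | forall i : 'I_n, val i = 0%N -> beta i = 0].

Definition Theta0 (n r : nat) : set ('I_n -> R) :=
  @Theta n `&` [set beta | forall i j : 'I_n,
     (1 <= i < r)%N -> (1 <= j < r)%N -> beta i = beta j].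

(* Likelihood-ratio statistic 2{ l(hat beta) - l(hat beta^0) }, written with
   suprema (which are the maxima whenever the MLEs exist). *)
Definition LR_stat (n K r : nat) (w : outcome n K) : R :=
  2 * (sup [set ell_bt w beta | beta in @Theta n]
       - sup [set ell_bt w beta | beta in @Theta0 n r]).

Definition bt_p (n : nat) (beta : 'I_n -> R) (i j : 'I_n) : R :=
  expR (beta i - beta j) / (1 + expR (beta i - beta j)).

Definition bt_pmf (n K : nat) (beta : 'I_n -> R) (w : outcome n K) : R :=
  \prod_(ij : 'I_n * 'I_n)
     if (ij.1 < ij.2)%N then
       let a := (w ij : nat) in
       'C(K, a)%:R * bt_p beta ij.1 ij.2 ^+ a
                   * (1 - bt_p beta ij.1 ij.2) ^+ (K - a)
     else (if (w ij : nat) == 0%N then 1 else 0).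

Definition bt_prob (n K : nat) (beta : 'I_n -> R) (E : pred (outcome n K)) : R :=
  \sum_(w | E w) bt_pmf beta w.

Definition bt_g (n : nat) (beta : 'I_n -> R) (i j : 'I_n) : R :=
  (1 + expR (beta i - beta j)) ^+ 2 / expR (beta i - beta j).

Definition bt_b (n : nat) (beta : 'I_n -> R) : R :=
  \big[Num.max/0]_(i < n) \big[Num.max/0]_(j < n | i != j) bt_g beta i j.

(* min over i <> j; the seed bt_b beta is >= every term, so for n >= 2 this is
   exactly the minimum. *)
Definition bt_c (n : nat) (beta : 'I_n -> R) : R :=
  \big[Num.min/bt_b beta]_(i < n) \big[Num.min/bt_b beta]_(j < n | i != j) bt_g beta i j.

(* Chi-square distribution function with k degrees of freedom:
   F_k(x) = int_0^x t^{k/2-1} e^{-t/2} dt / int_0^oo t^{k/2-1} e^{-t/2} dt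
   (the denominator is 2^{k/2} Gamma(k/2)). *)
Definition chi2_dens_unnorm (k : nat) (t : R) : R :=
  powR t (k%:R / 2 - 1) * expR (- t / 2).

Definition chi2_cdf (k : nat) (x : R) : R :=
  fine ((\int[@lebesgue_measure R]_(t in (`[0%R, x]%classic : set R)) (chi2_dens_unnorm k t)%:E)
        / (\int[@lebesgue_measure R]_(t in (`[0%R, +oo[%classic : set R)) (chi2_dens_unnorm k t)%:E))%E.

End BT.

Arguments Theta {R} n.
Arguments Theta0 {R} n r.
Arguments LR_stat {R} n K r w.
Arguments chi2_cdf {R} k x.

(* Main.v *)
(** Idea.  [l(c) - l(beta)] is a linear term in the scores at the truth [beta] minus a Bregman
    divergence of softplus.  On the event that all scores are at most [e n], with [e] of order
    [sqrt (log n / n)], lower bounds on that divergence show that every near-maximizer [c] satisfies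
    [\sum_j |v - (c_j - beta_j)| = O(b e n)] for some [v], and optimality in the coordinates of the
    block [G = {2, ..., r}] improves this to [|c_i - beta_i - v| = O(b^2 e)] for [i] in [G].
    As [beta] is constant on [G], around a point constant on [G] the likelihood depends on
    perturbations of the block that sum to zero through [\sum_i (dev_i D_i - A D_i^2 / 2)], up to
    factors [1 + O(b^3 e)], where [dev_i] is the score of [i] centered over the block and [A] is the
    common information of the block members.  Moving a maximizer over [Theta0] by [dev / A], and
    averaging a maximizer over [Theta] on the block, sandwiches the statistic between
    [(1 +- O(b^3 e)) Q] with [Q = \sum_(i in G) dev_i^2 / A].

    For integers [j], replacing the games of the block against one outside subject after the other
    by Gaussians of the same variance, by means of the heat semigroup, gives
    [E exp (- j Q) -> (1 + 2 j)^(-(r - 2) / 2)], the Laplace transform of the chi-square law.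
    Since [exp (- Q)] lies in [[0, 1]], Bernstein polynomials in [exp (- Q)] approximate the
    indicator of [Q <= x] and turn this into convergence of distribution functions. *)
Require Import Defs.
From HB Require Import structures.
From mathcomp Require Import all_boot all_order all_algebra.
From mathcomp Require Import all_classical all_reals all_analysis.
From mathcomp Require Import ring lra measurable_realfun.
Set Implicit Arguments. Unset Strict Implicit. Unset Printing Implicit Defensive.
Import Order.TTheory GRing.Theory Num.Theory.
Import numFieldNormedType.Exports.
Local Open Scope classical_set_scope.
Local Open Scope ring_scope.

(** For some outcomes no maximizer exists: a subject that wins all its games drives its parameter to
    infinity. The argument therefore runs with points within [xi] of the supremum. No a priori bound
    on [c - beta] is at hand either, so a Taylor expansion at the truth is of no use; it is replaced
    by an exact identity and by divergence bounds valid for increments of every size. The likelihood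
    is invariant under a common shift of all parameters, which is why closeness to the truth is
    measured up to a free [v]. Under the null, two subjects of the block have equal parameters,
    which forces [c_n <= 4]; the rate hypothesis then yields [b_n ^ 3 * sqrt (log n / n) -> 0], the
    smallness in which every error is expressed. The Gaussian expectations have a closed form
    depending on one scalar, so the central limit argument is a scalar estimate, repeated once per
    outside subject. *)

(** * The logistic function and the divergence of softplus *)

Section ScalarInequalities.
Variable R : realType.
Implicit Types x h z : R.

Lemma ge0_of_derive_ge0 (f f' : R -> R) : (forall z, is_derive z 1 f (f' z)) ->
  f 0 = 0 -> (forall z, 0 <= z -> 0 <= f' z) -> forall h, 0 <= h -> 0 <= f h.
Proof.
move=> df f0 f'0 h h0; rewrite -f0.
apply: (@ger0_derive1_ndecry R f 0) => //.
- move=> x; rewrite in_itv/= andbT => /ltW x0.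
  by rewrite derive1E (@derive_val _ _ _ _ _ _ _ (df x)) f'0.
- by apply: derivable_within_continuous => x _; case: (df x).
Qed.

Definition sigm x := expR x / (1 + expR x).
Definition softplus x := ln (1 + expR x).
Definition dsigm x := sigm x * (1 - sigm x).

Lemma sigm_den_gt0 x : 0 < 1 + expR x.
Proof. by rewrite ltr_wpDl// expR_gt0. Qed.

Lemma sigm_gt0 x : 0 < sigm x.
Proof. by rewrite divr_gt0 ?expR_gt0 ?sigm_den_gt0. Qed.

Lemma onem_sigm x : 1 - sigm x = (1 + expR x)^-1.
Proof.
have := sigm_den_gt0 x; rewrite /sigm; set e := expR x => h.
by field; rewrite gt_eqF.
Qed.

Lemma sigm_lt1 x : sigm x < 1.
Proof. by rewrite -subr_gt0 onem_sigm invr_gt0 sigm_den_gt0. Qed.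

Lemma sigmN x : sigm (- x) = 1 - sigm x.
Proof.
rewrite onem_sigm /sigm expRN; have := expR_gt0 x; set e := expR x => h.
by field; rewrite !gt_eqF// ltr_wpDl.
Qed.

Lemma dsigmN x : dsigm (- x) = dsigm x.
Proof. by rewrite /dsigm sigmN; ring. Qed.

Lemma dsigm_gt0 x : 0 < dsigm x.
Proof. by rewrite mulr_gt0 ?sigm_gt0// subr_gt0 sigm_lt1. Qed.

Lemma dsigm_le x : dsigm x <= 4^-1.
Proof. by rewrite /dsigm; have := sqr_ge0 (sigm x - 2^-1); rewrite expr2; lra. Qed.

Lemma dsigmE x : dsigm x = expR x / (1 + expR x) ^+ 2.
Proof. by rewrite /dsigm onem_sigm /sigm expr2 invfM mulrA. Qed.

Lemma softplusN x : softplus (- x) = softplus x - x.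
Proof.
rewrite /softplus -{3}(expRK x) -ln_div ?posrE ?expR_gt0 ?sigm_den_gt0//.
by rewrite mulrDl divff ?gt_eqF ?expR_gt0// mul1r expRN addrC.
Qed.

Lemma ln_expRD x y : ln (expR x + expR y) = y + softplus (x - y).
Proof.
rewrite /softplus -{2}(expRK y) -lnM ?posrE ?expR_gt0 ?sigm_den_gt0//.
by rewrite mulrDr mulr1 -expRD addrCA subrr addr0 addrC.
Qed.

Global Instance is_derive_softplus x h :
  is_derive h 1 (fun z => softplus (x + z)) (sigm (x + h)).
Proof.
rewrite (_ : (fun z => _) = @ln R \o (cst 1 + expR x \*: @expR R)); last first.
  by apply/funext => z; rewrite /softplus expRD.
have p0 : 0 < 1 + expR x * expR h by rewrite -expRD sigm_den_gt0.
have d1 : is_derive ((cst 1 + expR x \*: @expR R) h) 1 (@ln R)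
  (1 + expR x * expR h)^-1 := is_derive1_ln p0.
have d2 : is_derive h 1 (cst 1 + expR x \*: @expR R) (0 + expR x *: expR h).
  by apply: is_deriveD.
have d3 := is_derive1_comp d1 d2.
apply: (is_derive_eq d3).
by rewrite /sigm expRD add0r /=; exact: mulrC.
Qed.

Lemma sigm_sub x h :
  sigm (x + h) - sigm x = expR x * (expR h - 1) / ((1 + expR x * expR h) * (1 + expR x)).
Proof.
rewrite /sigm expRD; have h1 := expR_gt0 x; have h2 := expR_gt0 h.
set e := expR x in h1 *; set f := expR h in h2 *.
by field; rewrite !gt_eqF// ltr_wpDl// mulr_gt0.
Qed.

Lemma sigm_mono x h : 0 <= h -> sigm x <= sigm (x + h).
Proof.
move=> h0; rewrite -subr_ge0 sigm_sub; have := expR_ge1Dx h; have := expR_gt0 x.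
set e := expR x; set f := expR h => e0 f1.
by apply: divr_ge0; apply: mulr_ge0; nra.
Qed.

(** Self-concordance: the logarithmic derivative [1 - 2 * sigm] of [dsigm] lies in [-1, 1], so
    [dsigm] shrinks at most by [expR (- h)] over a distance [h]. This is that bound integrated
    once. *)
Lemma sigm_sub_ge x h : 0 <= h -> dsigm x * (1 - expR (- h)) <= sigm (x + h) - sigm x.
Proof.
move=> h0; rewrite sigm_sub dsigmE expRN.
have h1 := expR_gt0 x; have h2 : 1 <= expR h by rewrite leNgt expR_lt1 -leNgt.
set e := expR x in h1 *; set f := expR h in h2 *.
have f0 : 0 < f by lra.
have ef0 : 0 < 1 + e * f by nra.
rewrite -subr_ge0.
have -> : e * (f - 1) / ((1 + e * f) * (1 + e)) - e / (1 + e) ^+ 2 * (1 - f^-1)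
   = e * (f - 1)^+2 / (f * (1 + e * f) * (1 + e)^+2).
  by field; rewrite !gt_eqF//; lra.
apply: divr_ge0; first by rewrite mulr_ge0 ?sqr_ge0// ltW.
by apply: mulr_ge0; [nra|exact: sqr_ge0].
Qed.

Lemma sigm_sub_le x h : 0 <= h -> sigm (x + h) - sigm x <= dsigm x * (expR h - 1).
Proof.
move=> h0; rewrite sigm_sub dsigmE.
have h1 := expR_gt0 x; have h2 : 1 <= expR h by rewrite leNgt expR_lt1 -leNgt.
set e := expR x in h1 *; set f := expR h in h2 *.
have ef0 : 0 < 1 + e * f by nra.
rewrite -subr_ge0.
have -> : e / (1 + e) ^+ 2 * (f - 1) - e * (f - 1) / ((1 + e * f) * (1 + e))
   = (e * (f - 1))^+2 / ((1 + e * f) * (1 + e)^+2).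
  by field; rewrite !gt_eqF//; lra.
apply: divr_ge0; first by rewrite sqr_ge0.
by apply: mulr_ge0; [nra|exact: sqr_ge0].
Qed.

(** The even function with second derivative exp(-|h|) that vanishes to second order at 0. It is
    quadratic near 0 and linear at infinity, so it serves small and large deviations alike. *)
Definition smoothabs h := expR (- `|h|) - 1 + `|h|.

Definition bregman x h := softplus (x + h) - softplus x - sigm x * h.

Lemma bregmanN x h : bregman (- x) (- h) = bregman x h.
Proof. by rewrite /bregman -opprD !softplusN sigmN; ring. Qed.

Lemma bregman0 x : bregman x 0 = 0.
Proof. by rewrite /bregman addr0 subrr mulr0 subrr. Qed.

Lemma even_wlog (P : R -> R -> Prop) :
  (forall x h, P (- x) (- h) -> P x h) -> (forall x h, 0 <= h -> P x h) ->
  forall x h, P x h.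
Proof.
move=> PN P0 x h; have [/P0//|/ltW h0] := leP 0 h.
by apply/PN/P0; rewrite oppr_ge0.
Qed.

Instance is_derive_bregman x z : is_derive z 1 (bregman x) (sigm (x + z) - sigm x).
Proof.
rewrite (_ : bregman x =
  (fun z => softplus (x + z)) - cst (softplus x) - sigm x \*: (@id R)); last exact/funext.
have d1 := is_deriveB (is_derive_softplus x z) (is_derive_cst (softplus x) z (1:R)).
apply: (is_derive_eq (is_deriveB d1 (is_deriveZ (sigm x) (is_derive_id z 1)))).
by rewrite subr0; congr (_ - _); exact: mulr1.
Qed.

Lemma is_derive_expRN z : is_derive z 1 (fun z => expR (- z)) (- expR (- z)).
Proof.
have d := is_derive1_comp (is_derive_expR (- z)) (is_deriveNid z 1).
by apply: (is_derive_eq d); rewrite mulrN1.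
Qed.

Lemma bregman_ge x h : dsigm x * smoothabs h <= bregman x h.
Proof.
move: x h; apply: even_wlog => [x h|x h h0].
  by rewrite bregmanN dsigmN /smoothabs normrN.
rewrite /smoothabs ger0_norm// -subr_ge0.
pose f z := bregman x z - dsigm x * (expR (- z) - 1 + z).
have D z : is_derive z 1 f (sigm (x + z) - sigm x - dsigm x * (1 - expR (- z))).
  have d1 := is_deriveB (is_derive_expRN z) (is_derive_cst (1:R) z (1:R)).
  have d2 := is_deriveZ (dsigm x) (is_deriveD d1 (is_derive_id z (1:R))).
  apply: (is_derive_eq (is_deriveB (is_derive_bregman x z) d2)).
  by congr (_ - _); rewrite subr0 addrC.
apply: (ge0_of_derive_ge0 D _ _ h0).
- by rewrite /f bregman0 oppr0 expR0 subrr addr0 mulr0 subrr.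
- by move=> z z0; rewrite subr_ge0 sigm_sub_ge.
Qed.

Lemma smoothabs_ge0 h : 0 <= smoothabs h.
Proof. by rewrite /smoothabs; have := expR_ge1Dx (- `|h|); lra. Qed.

Lemma bregman_ge0 x h : 0 <= bregman x h.
Proof.
apply: le_trans (bregman_ge x h); apply: mulr_ge0; first exact/ltW/dsigm_gt0.
exact: smoothabs_ge0.
Qed.

Lemma bregman_le x h : bregman x h <= dsigm x * (expR `|h| - 1 - `|h|).
Proof.
move: x h; apply: even_wlog => [x h|x h h0].
  by rewrite bregmanN dsigmN normrN.
rewrite ger0_norm// -subr_ge0.
pose f z := dsigm x * (expR z - 1 - z) - bregman x z.
have D z : is_derive z 1 f (dsigm x * (expR z - 1) - (sigm (x + z) - sigm x)).
  have d1 := is_deriveB (is_derive_expR z) (is_derive_cst (1:R) z (1:R)).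
  have d2 := is_deriveZ (dsigm x) (is_deriveB d1 (is_derive_id z (1:R))).
  apply: (is_derive_eq (is_deriveB d2 (is_derive_bregman x z))).
  by rewrite subr0.
apply: (ge0_of_derive_ge0 D _ _ h0).
- by rewrite /f bregman0 expR0 !subr0 subrr mulr0.
- by move=> z z0; rewrite subr_ge0 sigm_sub_le.
Qed.

Lemma is_derive_sigm x z : is_derive z 1 (fun z => sigm (x + z)) (dsigm (x + z)).
Proof.
rewrite (_ : (fun z => _) = cst 1 - (fun z => ((cst 1 + expR x \*: @expR R) z)^-1)); last first.
  apply/funext => y; have := onem_sigm (x + y); rewrite expRD => /(congr1 (fun t => 1 - t)).
  by rewrite opprB addrC subrK.
have d2 : is_derive z 1 (cst 1 + expR x \*: @expR R) (0 + expR x *: expR z).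
  by apply: is_deriveD.
have p0 : (cst 1 + expR x \*: @expR R) z != 0.
  by rewrite gt_eqF// -[ltRHS]/(1 + expR x * expR z) -expRD sigm_den_gt0.
apply: (is_derive_eq (is_deriveB (is_derive_cst (1:R) z (1:R)) (is_deriveV p0 d2))).
rewrite sub0r add0r dsigmE expRD exprnN scaleNr opprK -[_ *: _]/(_ * _).
by rewrite -[_ *: expR z]/(expR x * expR z) mulrC.
Qed.

Lemma sigm_lip x h : `|sigm (x + h) - sigm x| <= `|h| / 4.
Proof.
move: x h; apply: even_wlog => [x h|x h h0].
  by rewrite -opprD !sigmN opprB addrC addrA subrK distrC normrN.
rewrite !ger0_norm ?subr_ge0 ?sigm_mono// -subr_ge0.
pose f z := 4^-1 * z - (sigm (x + z) - sigm x).
have D z : is_derive z 1 f (4^-1 - dsigm (x + z)).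
  have d1 := is_deriveB (is_derive_sigm x z) (is_derive_cst (sigm x) z (1:R)).
  have d2 := is_deriveZ (4^-1 : R) (is_derive_id z (1:R)).
  apply: (is_derive_eq (is_deriveB d2 d1)).
  by rewrite subr0; congr (_ - _); exact: mulr1.
rewrite mulrC; apply: (ge0_of_derive_ge0 D _ _ h0).
- by rewrite /f addr0 mulr0 !subrr.
- by move=> z z0; rewrite subr_ge0 dsigm_le.
Qed.

Lemma bregman_le_sqr x h : bregman x h <= h ^+ 2 / 8.
Proof.
move: x h; apply: even_wlog => [x h|x h h0].
  by rewrite bregmanN sqrrN.
rewrite -subr_ge0.
pose f z := 8^-1 * z ^+ 2 - bregman x z.
have D z : is_derive z 1 f (z / 4 - (sigm (x + z) - sigm x)).
  have d2 := is_deriveZ (8^-1 : R) (is_deriveX 2 (is_derive_id z (1:R))).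
  apply: (is_derive_eq (is_deriveB d2 (is_derive_bregman x z))).
  congr (_ - _); rewrite -[_ *: _]/(8^-1 * (2 * z ^+ 1 * 1)); lra.
rewrite mulrC; apply: (ge0_of_derive_ge0 D _ _ h0).
- by rewrite /f bregman0 expr0n mulr0 subrr.
- move=> z z0; rewrite subr_ge0; have := sigm_lip x z.
  by rewrite !ger0_norm ?subr_ge0 ?sigm_mono.
Qed.

Lemma sigm_sub_abs_ge x h : dsigm x * (1 - expR (- `|h|)) <= `|sigm (x + h) - sigm x|.
Proof.
move: x h; apply: even_wlog => [x h|x h h0].
  rewrite (_ : sigm (- x - h) - _ = - (sigm (x + h) - sigm x)) ?normrN ?dsigmN//.
  by rewrite -opprD !sigmN; ring.
by rewrite !ger0_norm ?subr_ge0 ?sigm_mono// sigm_sub_ge.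
Qed.

Lemma dsigm_lip x y : `|dsigm x - dsigm y| <= `|x - y| / 4.
Proof.
rewrite (le_trans _ (_ : `|sigm x - sigm y| <= _))//; last first.
  by have := sigm_lip y (x - y); rewrite (addrC y) subrK.
rewrite (_ : dsigm x - dsigm y = (sigm x - sigm y) * (1 - sigm x - sigm y)); last first.
  by rewrite /dsigm; ring.
rewrite normrM ler_piMr// ler_norml.
have := sigm_gt0 x; have := sigm_gt0 y; have := sigm_lt1 x; have := sigm_lt1 y; lra.
Qed.

(** By convexity: the supporting line of slope [e] has intercept at least [- e ^+ 2]. It turns
    divergences into absolute deviations, which can beat a linear term. *)
Lemma smoothabs_ge_lin e h : 0 <= e < 1 -> e * `|h| - e ^+ 2 <= smoothabs h.
Proof.
move=> /andP[e0 e1]; rewrite /smoothabs; set a := `|h|.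
have h1 := expR_ge1Dx (- e); have h2 := expR_ge1Dx (e - a).
have := expRD (e - a) (- e); rewrite addrAC subrr add0r => ->.
have := expR_gt0 (e - a); have := expR_gt0 (- e).
have [h3|h3] := leP 0 (1 + (e - a)) => h4 h5.
  have : (1 + (e - a)) * (1 - e) <= expR (e - a) * expR (- e) by apply: ler_pM => //; lra.
  nra.
have : 0 <= expR (e - a) * expR (- e) by rewrite mulr_ge0// expR_ge0.
nra.
Qed.

(** Amounts to the Padé bound [expR (- z) >= (2 - z) / (2 + z)] at z = |h|. *)
Lemma smoothabs_ge_sqr h : h ^+ 2 <= (2 + `|h|) * smoothabs h.
Proof.
rewrite /smoothabs -real_normK ?num_real//; have := normr_ge0 h; move: `|h| => {}h h0.
rewrite -subr_ge0.
pose f z := (2 + z) * expR (- z) - (2 - z).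
rewrite (_ : _ - _ = f h); last by rewrite /f; ring.
have D z : is_derive z 1 f (1 - (1 + z) * expR (- z)).
  have d1 := is_deriveM (is_deriveD (is_derive_cst (2:R) z (1:R)) (is_derive_id z (1:R))) (is_derive_expRN z).
  have d2 := is_deriveB (is_derive_cst (2:R) z (1:R)) (is_derive_id z (1:R)).
  apply: (is_derive_eq (is_deriveB d1 d2)).
  rewrite -[X in X + _ - _ = _]/((2 + z) * (- expR (- z))) -[X in _ + X - _ = _]/(expR (- z) * (0 + 1)); ring.
apply: (ge0_of_derive_ge0 D _ _ h0).
- by rewrite /f oppr0 expR0 !addr0 mulr1 subrr.
- move=> z z0; rewrite subr_ge0; have := expR_ge1Dx z; rewrite expRN => hz.
  by rewrite ler_pdivrMr ?mul1r// expR_gt0.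
Qed.

(** A bound for the convex conjugate of [A * smoothabs] at [y]: the Gaussian value
    [y ^+ 2 / (2 * A)], up to a factor near 1 when [y] is small against [A]. *)
Lemma lin_sub_smoothabs_le (A y h : R) : 0 < A -> `|y| <= A / 2 ->
  y * h - A * smoothabs h <= y ^+ 2 / (2 * A * (1 - `|y| / A)).
Proof.
move=> A0 yA; have := smoothabs_ge_sqr h; have := smoothabs_ge0 h.
rewrite -real_normK ?num_real// -(@real_normK _ y) ?num_real//.
have : y * h <= `|y| * `|h| by rewrite -normrM ler_norm.
have := normr_ge0 y; have := normr_ge0 h; move: `|h| (smoothabs h) (y * h) `|y| yA => a s yh {h}y.
move=> yA a0 y0 yah s0 sa.
have Ay0 : 0 < A - y by lra.
rewrite (_ : 2 * A * (1 - y / A) = 2 * (A - y)); last by field; rewrite gt_eqF.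
rewrite ler_pdivlMr; last by lra.
rewrite -(@ler_pM2r _ (2 + a)); last by lra.
have h1 : (yh - A * s) * (2 * (A - y)) * (2 + a) <= (y * a * (2 + a) - A * a ^+ 2) * (2 * (A - y)).
  rewrite mulrAC ler_pM2r; last by lra.
  nra.
apply: (le_trans h1).
rewrite -subr_ge0.
rewrite (_ : _ - _ = 2 * (a * (A - y) - y) ^+ 2 + a * y ^+ 2); last first.
  ring.
by rewrite addr_ge0// mulr_ge0 ?sqr_ge0.
Qed.

Let dX2 z : is_derive z 1 (fun z : R => z ^+ 2) (2 * z ^+ 1).
Proof.
by apply: (is_derive_eq (is_deriveX 2 (is_derive_id z (1:R)))); exact: mulr1.
Qed.

Let dX3 z : is_derive z 1 (fun z : R => z ^+ 3) (3 * z ^+ 2).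
Proof.
by apply: (is_derive_eq (is_deriveX 3 (is_derive_id z (1:R)))); exact: mulr1.
Qed.

Lemma expR_taylor2 z : 0 <= z ->
  [/\ z ^+ 2 / 2 <= expR z - 1 - z, expR z - 1 - z <= z ^+ 2 / 2 * expR z,
      0 <= expR (- z) - 1 + z & expR (- z) - 1 + z <= z ^+ 2 / 2].
Proof.
move=> h0.
have d0 z0 := is_derive_cst (1:R) z0 (1:R); have d1 z0 := is_derive_id z0 (1:R).
have dE := @is_derive_expR R; have dN := is_derive_expRN.
have B2 : 0 <= expR (- z) - 1 + z by have := expR_ge1Dx (- z); lra.
split=> //; rewrite -subr_ge0.
- pose f z := expR z - 1 - z - 2^-1 * z ^+ 2.
  rewrite (_ : _ - _ = f z); last by rewrite /f; ring.
  have D z0 : is_derive z0 1 f (expR z0 - 1 - z0).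
    apply: (is_derive_eq (is_deriveB (is_deriveB (is_deriveB (dE z0) (d0 z0)) (d1 z0)) (is_deriveZ (2^-1:R) (dX2 z0)))).
    rewrite -[_ *: _]/(2^-1 * (2 * z0 ^+ 1)) expr1; lra.
  apply: (ge0_of_derive_ge0 D _ _ h0); first by rewrite /f expR0; ring.
  by move=> y y0; have := expR_ge1Dx y; lra.
- pose f z := 2^-1 * z ^+ 2 * expR z - (expR z - 1 - z).
  rewrite (_ : _ - _ = f z); last by rewrite /f; ring.
  have D z0 : is_derive z0 1 f (z0 ^+ 2 / 2 * expR z0 + (z0 * expR z0 - expR z0 + 1)).
    apply: (is_derive_eq (is_deriveB (is_deriveM (is_deriveZ (2^-1:R) (dX2 z0)) (dE z0)) (is_deriveB (is_deriveB (dE z0) (d0 z0)) (d1 z0)))).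
    rewrite -[X in X - _ = _]/((2^-1 * z0 ^+ 2) * expR z0 + expR z0 * (2^-1 * (2 * z0 ^+ 1))); lra.
  apply: (ge0_of_derive_ge0 D _ _ h0); first by rewrite /f expR0; ring.
  move=> y y0; rewrite addr_ge0 ?mulr_ge0 ?sqr_ge0 ?expR_ge0//.
  have := expR_ge1Dx (- y); have := expR_gt0 y; have := expRxMexpNx_1 y; nra.
- pose f z := 2^-1 * z ^+ 2 - (expR (- z) - 1 + z).
  rewrite (_ : _ - _ = f z); last by rewrite /f; ring.
  have D z0 : is_derive z0 1 f (z0 - 1 + expR (- z0)).
    apply: (is_derive_eq (is_deriveB (is_deriveZ (2^-1:R) (dX2 z0)) (is_deriveD (is_deriveB (dN z0) (d0 z0)) (d1 z0)))).
    rewrite -[_ *: _]/(2^-1 * (2 * z0 ^+ 1)) expr1; lra.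
  apply: (ge0_of_derive_ge0 D _ _ h0); first by rewrite /f oppr0 expR0; ring.
  by move=> y y0; have := expR_ge1Dx (- y); lra.
Qed.

Lemma expR_taylor3 z : 0 <= z ->
  [/\ 0 <= expR z - 1 - z - z ^+ 2 / 2,
      expR z - 1 - z - z ^+ 2 / 2 <= z ^+ 3 / 6 * expR z,
      - (z ^+ 3 / 6) <= expR (- z) - 1 + z - z ^+ 2 / 2 &
      expR (- z) - 1 + z - z ^+ 2 / 2 <= 0].
Proof.
move=> h0; have [B1 B2 B3 B4] := expR_taylor2 h0.
have d0 z0 := is_derive_cst (1:R) z0 (1:R); have d1 z0 := is_derive_id z0 (1:R).
have dE := @is_derive_expR R; have dN := is_derive_expRN.
have d2 z0 := is_deriveZ (2^-1:R) (dX2 z0).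
have d3 z0 := is_deriveZ (6^-1:R) (dX3 z0).
split; rewrite ?subr_ge0// ?subr_le0// -subr_ge0.
- pose f z := 6^-1 * z ^+ 3 * expR z - (expR z - 1 - z - 2^-1 * z ^+ 2).
  rewrite (_ : _ - _ = f z); last by rewrite /f; ring.
  have D z0 : is_derive z0 1 f (z0 ^+ 3 / 6 * expR z0 + (z0 ^+ 2 / 2 * expR z0 - (expR z0 - 1 - z0))).
    apply: (is_derive_eq (is_deriveB (is_deriveM (d3 z0) (dE z0)) (is_deriveB (is_deriveB (is_deriveB (dE z0) (d0 z0)) (d1 z0)) (d2 z0)))).
    rewrite -[X in X - _ = _]/((6^-1 * z0 ^+ 3) * expR z0 + expR z0 * (6^-1 * (3 * z0 ^+ 2))).
    rewrite -[_ *: _]/(2^-1 * (2 * z0 ^+ 1)) expr1; lra.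
  apply: (ge0_of_derive_ge0 D _ _ h0); first by rewrite /f expR0; ring.
  move=> y y0; have [_ H _ _] := expR_taylor2 y0.
  by rewrite addr_ge0 ?subr_ge0// ?mulr_ge0 ?exprn_ge0 ?expR_ge0.
- pose f z := expR (- z) - 1 + z - 2^-1 * z ^+ 2 + 6^-1 * z ^+ 3.
  rewrite (_ : _ - _ = f z); last by rewrite /f; ring.
  have D z0 : is_derive z0 1 f (z0 ^+ 2 / 2 - (expR (- z0) - 1 + z0)).
    apply: (is_derive_eq (is_deriveD (is_deriveB (is_deriveD (is_deriveB (dN z0) (d0 z0)) (d1 z0)) (d2 z0)) (d3 z0))).
    rewrite -[X in _ - X + _ = _]/(2^-1 * (2 * z0 ^+ 1)) -[X in _ + X = _]/(6^-1 * (3 * z0 ^+ 2)) expr1; lra.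
  apply: (ge0_of_derive_ge0 D _ _ h0); first by rewrite /f oppr0 expR0; ring.
  by move=> y y0; have [_ _ _ H] := expR_taylor2 y0; rewrite subr_ge0.
Qed.

Lemma expR_sub2_le z : `|expR z - 1 - z| <= z ^+ 2 / 2 * expR `|z|.
Proof.
have [z0|/ltW z0] := leP 0 z.
  have [h1 h2 _ _] := expR_taylor2 z0.
  by rewrite (ger0_norm z0) ger0_norm// (le_trans _ h1)// divr_ge0 ?sqr_ge0.
have nz0 : 0 <= - z by rewrite oppr_ge0.
have [_ _ h1 h2] := expR_taylor2 nz0; move: h1 h2; rewrite opprK sqrrN => h1 h2.
rewrite ger0_norm// (le_trans h2)// ler_peMr ?divr_ge0 ?sqr_ge0//.
by rewrite (le_trans _ (expR_ge1Dx _))// lerDl.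
Qed.

Lemma expR_sub3_le z : `|expR z - 1 - z - z ^+ 2 / 2| <= `|z| ^+ 3 / 6 * expR `|z|.
Proof.
have [z0|/ltW z0] := leP 0 z.
  have [h1 h2 _ _] := expR_taylor3 z0.
  by rewrite (ger0_norm z0) ger0_norm.
have nz0 : 0 <= - z by rewrite oppr_ge0.
have [_ _ h1 h2] := expR_taylor3 nz0; move: h1 h2; rewrite opprK sqrrN => h1 h2.
rewrite ler0_norm// lerNl (le_trans _ h1)// lerN2 (ler0_norm z0).
rewrite ler_peMr ?divr_ge0 ?exprn_ge0//.
by rewrite (le_trans _ (expR_ge1Dx _))// lerDl.
Qed.

End ScalarInequalities.

(** * Expectation under a finite product law *)

Section ProductExpectation.
Variables (R : realType) (E T : finType) (mu : E -> T -> R).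
Hypothesis mu_ge0 : forall e a, 0 <= mu e a.
Hypothesis mu_sum1 : forall e, \sum_a mu e a = 1.
Local Notation W := {ffun E -> T}.
Implicit Types (f g : W -> R) (w : W).

Definition prodw w : R := \prod_e mu e (w e).
Definition expect f : R := \sum_w prodw w * f w.

Lemma prodw_ge0 w : 0 <= prodw w.
Proof. by rewrite prodr_ge0. Qed.

Lemma expect_prod (h : E -> T -> R) :
  expect (fun w => \prod_e h e (w e)) = \prod_e \sum_a mu e a * h e a.
Proof.
by rewrite bigA_distr_bigA; apply: eq_bigr => w _; rewrite big_split.
Qed.

Lemma eq_expect f g : f =1 g -> expect f = expect g.
Proof. by move=> fg; apply: eq_bigr => w _; rewrite fg. Qed.

Lemma expect_le f g : (forall w, f w <= g w) -> expect f <= expect g.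
Proof. by move=> fg; apply: ler_sum => w _; rewrite ler_wpM2l ?prodw_ge0. Qed.

Lemma expectZ c f : expect (fun w => c * f w) = c * expect f.
Proof. by rewrite /expect mulr_sumr; apply: eq_bigr => w _; rewrite mulrCA. Qed.

Lemma expectD f g : expect (fun w => f w + g w) = expect f + expect g.
Proof. by rewrite -big_split; apply: eq_bigr => w _; rewrite mulrDr. Qed.

Lemma expectN f : expect (fun w => - f w) = - expect f.
Proof. by rewrite -mulN1r -expectZ; apply: eq_expect => w; rewrite mulN1r. Qed.

Lemma expectB f g : expect (fun w => f w - g w) = expect f - expect g.
Proof. by rewrite expectD expectN. Qed.

Lemma expect_sum (I : Type) (s : seq I) (P : pred I) (F : I -> W -> R) :
  expect (fun w => \sum_(i <- s | P i) F i w) = \sum_(i <- s | P i) expect (F i).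
Proof.
rewrite /expect exchange_big; apply: eq_bigr => w _; exact: mulr_sumr.
Qed.

Lemma expect_cst c : expect (fun=> c) = c.
Proof.
have h : expect (fun=> 1) = 1.
  rewrite (@eq_expect _ (fun w => \prod_(e : E) (fun _ _ => 1) e (w e))); last by move=> w; rewrite big1.
  rewrite (expect_prod (fun _ _ => 1)) big1// => e _.
  by under eq_bigr do rewrite mulr1.
rewrite -[RHS]mulr1 -h -expectZ.
by apply: eq_expect => w; rewrite mulr1.
Qed.

Lemma expect_abs_le f : `|expect f| <= expect (fun w => `|f w|).
Proof.
by rewrite ler_norml -expectN !expect_le// => w; [exact: ler_norm|exact: lerNnormlW].
Qed.

Lemma expect1 e (h : T -> R) : expect (fun w => h (w e)) = \sum_a mu e a * h a.
Proof.
rewrite (eq_expect (g := fun w => \prod_e' (if e' == e then h (w e') else 1))).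
  rewrite (expect_prod (fun e' a => if e' == e then h a else 1)).
  rewrite (bigD1 e)//= eqxx [X in _ * X]big1 ?mulr1// => e' /negbTE ->.
  by under eq_bigr do rewrite mulr1.
by move=> w; rewrite -big_mkcond/= big_pred1_eq.
Qed.

Definition mix (S : {set E}) (w w' : W) : W := [ffun e => if e \in S then w' e else w e].

(* Swapping the coordinates in [S] between two independent copies preserves their joint law. *)
Lemma expect_mix (S : {set E}) f :
  expect f = expect (fun w => expect (fun w' => f (mix S w w'))).
Proof.
rewrite /expect; under [RHS]eq_bigr do rewrite mulr_sumr.
rewrite pair_bigA /=.
pose sw (p : W * W) := (mix S p.1 p.2, mix S p.2 p.1).
have swK : involutive sw.
  by case=> w w'; congr pair; apply/ffunP => e; rewrite !ffunE /=; case: (e \in S).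
rewrite (reindex_inj (inv_inj swK))/=.
have pE (p : W * W) : prodw (sw p).1 * prodw (sw p).2 = prodw p.1 * prodw p.2.
  rewrite -!big_split; apply: eq_bigr => e _; rewrite !ffunE.
  by case: (e \in S) => //; exact: mulrC.
under [RHS]eq_bigr => p _.
  rewrite mulrA pE (_ : mix S _ _ = p.1); last first.
    by apply/ffunP => e; rewrite !ffunE; case: (e \in S).
  over.
rewrite -(pair_bigA _ (fun w w' => prodw w * prodw w' * f w))/=.
apply: eq_bigr => w _; rewrite -mulr_suml -mulr_sumr.
have := expect_cst 1; rewrite /expect.
by under eq_bigr do rewrite mulr1; move=> ->; rewrite mulr1.
Qed.

(** Resampling the coordinates in [S] makes [f] a function of the independent copy alone and leaves
    [g] on the original, so the expectations separate. *)
Lemma expect_indep (S : {set E}) f g :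
  (forall w w', (forall e, e \in S -> w e = w' e) -> f w = f w') ->
  (forall w w', (forall e, e \notin S -> w e = w' e) -> g w = g w') ->
  expect (fun w => f w * g w) = expect f * expect g.
Proof.
move=> fS gS; rewrite (expect_mix S) -expectZ; apply: eq_expect => w.
rewrite [RHS]mulrC -expectZ; apply: eq_expect => w'.
rewrite mulrC; congr (_ * _); [apply: gS|apply: fS] => e; rewrite ffunE.
  by move/negbTE->.
by move->.
Qed.

End ProductExpectation.

(** * Moments of the binomial law *)

Section BinomialMoments.
Variable R : realType.
Implicit Types (p : R) (K : nat).

(** Also the Bernstein basis polynomial in [p]: its variance gives both the information of a game
    and the Chebyshev bound in the polynomial approximation of indicators. *)
Definition binw K p (a : nat) : R := 'C(K, a)%:R * p ^+ a * (1 - p) ^+ (K - a).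

Lemma binw_ge0 K p a : 0 <= p <= 1 -> 0 <= binw K p a.
Proof. by move=> /andP[p0 p1]; rewrite !mulr_ge0 ?exprn_ge0 ?subr_ge0. Qed.

Lemma sum_binw K p : \sum_(a < K.+1) binw K p a = 1.
Proof.
rewrite -[RHS](expr1n _ K) -[X in X ^+ _](subrK p 1) exprDn.
by apply: eq_bigr => a _; rewrite -mulr_natl /binw mulrAC mulrA.
Qed.

Lemma sum_binw_absorb K p (h : nat -> R) :
  \sum_(a < K.+2) binw K.+1 p a * (a%:R * h a) =
  K.+1%:R * p * \sum_(a < K.+1) binw K p a * h a.+1.
Proof.
rewrite big_ord_recl mul0r mulr0 add0r mulr_sumr; apply: eq_bigr => a _.
rewrite lift0 /binw subSS exprS.
have : a.+1%:R * 'C(K.+1, a.+1)%:R = K.+1%:R * 'C(K, a)%:R :> R.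
  by rewrite -!natrM mul_bin_diag.
move=> E; transitivity (a.+1%:R * 'C(K.+1, a.+1)%:R * p * (p ^+ a * (1 - p) ^+ (K - a) * h a.+1)).
  ring.
rewrite E; ring.
Qed.

Lemma binw_mean K p : \sum_(a < K.+1) binw K p a * a%:R = K%:R * p.
Proof.
case: K => [|K]; first by rewrite big_ord1 mul0r mulr0.
have := sum_binw_absorb K p (fun=> 1).
under eq_bigr do rewrite mulr1; move=> ->.
by under eq_bigr do rewrite mulr1; rewrite sum_binw mulr1.
Qed.

Lemma binw_centered_mean K p : \sum_(a < K.+1) binw K p a * (a%:R - K%:R * p) = 0.
Proof.
under eq_bigr do rewrite mulrBr.
by rewrite sumrB binw_mean -mulr_suml sum_binw mul1r subrr.
Qed.

Lemma binw_var K p :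
  \sum_(a < K.+1) binw K p a * (a%:R - K%:R * p) ^+ 2 = K%:R * (p * (1 - p)).
Proof.
transitivity (\sum_(a < K.+1) binw K p a * (a%:R * (a%:R : R)) - (K%:R * p) ^+ 2).
  transitivity (\sum_(a < K.+1) (binw K p a * (a%:R * a%:R) -
     2 * (K%:R * p) * (binw K p a * a%:R) + (K%:R * p) ^+ 2 * binw K p a)).
    by apply: eq_bigr => a _; ring.
  by rewrite big_split /= sumrB -!mulr_sumr binw_mean sum_binw; ring.
case: K => [|K]; first by rewrite big_ord1 !mul0r mulr0 expr0n subrr.
rewrite (sum_binw_absorb K p (fun a => a%:R)).
have -> : \sum_(a < K.+1) binw K p a * a.+1%:R = K%:R * p + 1.
  under eq_bigr do rewrite -natr1 mulrDr mulr1.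
  by rewrite big_split /= binw_mean sum_binw.
by rewrite -natr1; ring.
Qed.

End BinomialMoments.

(** * Scores under the Bradley-Terry law: moments and tails *)

Section BradleyTerryLaw.
Variables (R : realType) (n K : nat) (beta : 'I_n -> R).
Implicit Types (i j : 'I_n) (w : outcome n K) (l t : R).

(** Coordinates that carry no game are point masses at 0, so that [bt_pmf] is a product law over all
    ordered pairs. *)
Definition bt_coord (e : 'I_n * 'I_n) (a : 'I_K.+1) : R :=
  if (e.1 < e.2)%N then binw K (bt_p beta e.1 e.2) a
  else if (a : nat) == 0%N then 1 else 0.

Lemma bt_pE i j : bt_p beta i j = sigm (beta i - beta j).
Proof. by []. Qed.

Lemma bt_p_itv i j : 0 <= bt_p beta i j <= 1.
Proof. by rewrite bt_pE !ltW ?sigm_gt0 ?sigm_lt1. Qed.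

Lemma bt_coord_ge0 e a : 0 <= bt_coord e a.
Proof. by rewrite /bt_coord; case: ifP => _; [exact/binw_ge0/bt_p_itv|case: ifP]. Qed.

Lemma bt_coord_sum1 e : \sum_a bt_coord e a = 1.
Proof.
rewrite /bt_coord; case: (e.1 < e.2)%N; first exact: sum_binw.
by rewrite big_ord_recl /= big1 ?addr0.
Qed.

Notation Ex := (expect (T := 'I_K.+1) bt_coord).

Let Ex_le := expect_le bt_coord_ge0.

Lemma bt_probE (P : pred (outcome n K)) : bt_prob beta P = Ex (fun w => (P w)%:R).
Proof.
rewrite /bt_prob big_mkcond; apply: eq_bigr => w _ /=.
by case: (P w); rewrite ?mulr1 ?mulr0.
Qed.

Definition bt_dev w i j : R := bt_a R w i j - K%:R * sigm (beta i - beta j).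
Definition bt_score w i : R := \sum_(j < n | j != i) bt_dev w i j.
(** The coordinate that stores the game between [i] and [j], in whichever order they are named;
    games on distinct edges are independent. *)
Definition edge i j := if (i < j)%N then (i, j) else (j, i).

Lemma edgeC i j : edge i j = edge j i.
Proof. by rewrite /edge; case: ltngtP => // /val_inj ->. Qed.

Lemma edge_inj i j i' j' : edge i j = edge i' j' -> i = i' /\ j = j' \/ i = j' /\ j = i'.
Proof. by rewrite /edge; do 2 case: ifP => _; case=> -> ->; auto. Qed.

Lemma bt_devE w i j : (i < j)%N ->
  bt_dev w i j = ((w (i, j) : nat)%:R - K%:R * bt_p beta i j).
Proof. by move=> ij; rewrite /bt_dev /bt_a ij. Qed.

Lemma bt_devC w i j : i != j -> bt_dev w j i = - bt_dev w i j.
Proof.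
rewrite /bt_dev /bt_a -(opprB (beta i)) sigmN => ij.
have : (i : nat) != j := ij.
by case: ltngtP => // _ _; ring.
Qed.

Lemma bt_dev_edge w w' i j : i != j ->
  w (edge i j) = w' (edge i j) -> bt_dev w i j = bt_dev w' i j.
Proof.
have : forall i j, (i < j)%N -> w (edge i j) = w' (edge i j) -> bt_dev w i j = bt_dev w' i j.
  by move=> {}i {}j ij; rewrite !bt_devE// /edge ij => ->.
move=> H ij; have : (i : nat) != j := ij; case: ltngtP => // [?|ji] _; first exact: H.
by rewrite edgeC => /(H _ _ ji) E; rewrite !(@bt_devC _ j i) 1?eq_sym// E.
Qed.

Lemma bt_dev_abs w i j : i != j -> `|bt_dev w i j| <= K%:R.
Proof.
have H i' j' : (i' < j')%N -> `|bt_dev w i' j'| <= K%:R.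
  move=> ij; rewrite bt_devE// ler_norml.
  have := bt_p_itv i' j' => /andP[p0 p1].
  have a0 : 0 <= (w (i', j') : nat)%:R :> R by rewrite ler0n.
  have a1 : (w (i', j') : nat)%:R <= K%:R :> R by rewrite ler_nat -ltnS.
  have K0 : 0 <= K%:R :> R by rewrite ler0n.
  by apply/andP; split; nra.
move=> ij; have : (i : nat) != j := ij; case: ltngtP => // [?|ji] _; first exact: H.
by rewrite bt_devC 1?eq_sym// normrN H.
Qed.

Lemma expect_bt_dev i j (h : R -> R) : (i < j)%N ->
  Ex (fun w => h (bt_dev w i j)) =
  \sum_(a < K.+1) binw K (bt_p beta i j) a * h (a%:R - K%:R * bt_p beta i j).
Proof.
move=> ij; rewrite (@eq_expect _ _ _ _ _ (fun w => (fun a : 'I_K.+1 => h ((a : nat)%:R - K%:R * bt_p beta i j)) (w (i, j)))).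
  rewrite (expect1 bt_coord_sum1 _ (fun a : 'I_K.+1 => h ((a : nat)%:R - K%:R * bt_p beta i j))).
  by apply: eq_bigr => a _; rewrite /bt_coord ij.
by move=> w; rewrite bt_devE.
Qed.

Lemma expect_bt_dev0 i j : i != j -> Ex (fun w => bt_dev w i j) = 0.
Proof.
have H i' j' : (i' < j')%N -> Ex (fun w => bt_dev w i' j') = 0.
  by move=> ij; rewrite (expect_bt_dev (fun t => t))// binw_centered_mean.
move=> ij; have : (i : nat) != j := ij; case: ltngtP => // [?|ji] _; first exact: H.
rewrite (@eq_expect _ _ _ _ _ (fun w => - bt_dev w j i)).
  by rewrite expectN H ?oppr0.
by move=> w; rewrite bt_devC// eq_sym.
Qed.

Lemma expect_bt_dev_sqr i j : i != j ->
  Ex (fun w => bt_dev w i j ^+ 2) = K%:R * dsigm (beta i - beta j).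
Proof.
have H i' j' : (i' < j')%N -> Ex (fun w => bt_dev w i' j' ^+ 2) = K%:R * dsigm (beta i' - beta j').
  by move=> ij; rewrite (expect_bt_dev (fun t => t ^+ 2))// binw_var.
move=> ij; have : (i : nat) != j := ij; case: ltngtP => // [?|ji] _; first exact: H.
rewrite (@eq_expect _ _ _ _ _ (fun w => bt_dev w j i ^+ 2)).
  by rewrite H// -(opprB (beta i)) dsigmN.
by move=> w; rewrite bt_devC 1?eq_sym// sqrrN.
Qed.

Lemma expect_bt_dev_mul i j i' j' : i != j -> i' != j' -> edge i j != edge i' j' ->
  Ex (fun w => bt_dev w i j * bt_dev w i' j') = 0.
Proof.
move=> ij ij' ee; rewrite (expect_indep bt_coord_sum1 (S := [set edge i j])).
- by rewrite expect_bt_dev0// mul0r.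
- by move=> w w' H; apply: bt_dev_edge => //; apply: H; rewrite inE.
- by move=> w w' H; apply: bt_dev_edge => //; apply: H; rewrite inE eq_sym.
Qed.

Lemma expR1_le4 : expR (1 : R) <= 4.
Proof.
have := expR_ge1Dx (- 2^-1 : R); rewrite expRN => h.
have e0 := expR_gt0 (2^-1 : R).
have -> : (1 : R) = 2^-1 + 2^-1 by lra.
have : expR (2^-1 : R) <= 2.
  by rewrite -ler_pV2 ?inE ?unitfE ?gt_eqF//; lra.
rewrite expRD; nra.
Qed.

(** On [-1, 1] one has [expR x <= 1 + x + 2 * x ^+ 2], where 2 is half of the bound 4 for [expR 1];
    the linear term has mean zero. *)
Lemma expect_expR_bt_dev i j l : i != j -> `|l| * K%:R <= 1 ->
  Ex (fun w => expR (l * bt_dev w i j)) <= expR (2 * l ^+ 2 * K%:R ^+ 2).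
Proof.
move=> ij lK.
apply: (@le_trans _ _ (Ex (fun w => 1 + l * bt_dev w i j + 2 * l ^+ 2 * K%:R ^+ 2))).
  apply: Ex_le => w; set x := l * _.
  have xlK : `|x| <= `|l| * K%:R by rewrite normrM ler_wpM2l// bt_dev_abs.
  have x2 : x ^+ 2 <= l ^+ 2 * K%:R ^+ 2.
    by rewrite -(@real_normK _ x) ?num_real// -(@real_normK _ l) ?num_real// -exprMn lerXn2r ?nnegrE// mulr_ge0.
  have x1 : expR `|x| <= 4.
    by rewrite (le_trans _ expR1_le4)// ler_expR (le_trans xlK).
  have := le_trans (ler_norm _) (expR_sub2_le x); have := sqr_ge0 x.
  have := expR_gt0 `|x|; nra.
rewrite !expectD (expect_cst bt_coord_sum1) expectZ expect_bt_dev0// mulr0 addr0.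
by rewrite (expect_cst bt_coord_sum1) expR_ge1Dx.
Qed.

Lemma expect_expR_bt_score i l : `|l| * K%:R <= 1 ->
  Ex (fun w => expR (l * bt_score w i)) <= expR (2 * l ^+ 2 * K%:R ^+ 2 * n%:R).
Proof.
move=> lK; set c := 2 * l ^+ 2 * K%:R ^+ 2.
have c0 : 0 <= c by apply: mulr_ge0; [apply: mulr_ge0|]; rewrite ?sqr_ge0.
(* The games of [i] against distinct opponents sit on distinct edges, so over a duplicate-free list
   the factors split off one by one. *)
pose F (s : seq 'I_n) w := expR (l * \sum_(j <- s) bt_dev w i j).
have H (s : seq 'I_n) : uniq s -> i \notin s -> Ex (F s) <= expR (c * (size s)%:R).
  elim: s => [|j s IH] /=.
    rewrite mulr0 expR0 (@eq_expect _ _ _ _ _ (fun=> 1)) ?(expect_cst bt_coord_sum1)//.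
    by move=> w; rewrite /F big_nil mulr0 expR0.
  rewrite inE negb_or => /andP[js us] /andP[ij is_].
  rewrite (@eq_expect _ _ _ _ _ (fun w => expR (l * bt_dev w i j) * F s w)); last first.
    by move=> w; rewrite /F big_cons mulrDr expRD.
  rewrite (expect_indep bt_coord_sum1 (S := [set edge i j])).
  - rewrite -(addn1 (size s)) natrD mulrDr mulr1 addrC expRD ler_pM//.
    + by rewrite -(expect_cst bt_coord_sum1 0) Ex_le// => w; exact: expR_ge0.
    + by rewrite -(expect_cst bt_coord_sum1 0) Ex_le// => w; exact: expR_ge0.
    + exact: expect_expR_bt_dev.
    + exact: IH.
  - by move=> w w' h; congr (expR (l * _)); apply: bt_dev_edge => //; apply: h; rewrite inE.
  - move=> w w' h; congr (expR (l * _)); rewrite !big_seq; apply: eq_bigr => k ks.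
    have ki : i != k by apply: contraNneq is_ => ->.
    apply: bt_dev_edge => //; apply: h; rewrite inE; apply: contraNneq js.
    by move=> /edge_inj[[_ <-]//|[E _]]; move: ij; rewrite E eqxx.
pose s := rem i (enum 'I_n).
have us : uniq s by rewrite rem_uniq ?enum_uniq.
have is_ : i \notin s by rewrite mem_rem_uniq ?enum_uniq// !inE eqxx.
apply: le_trans (le_trans (H s us is_) _); last first.
  by rewrite ler_expR ler_wpM2l// ler_nat size_rem ?mem_enum// size_enum_ord leq_pred.
rewrite le_eqVlt; apply/orP; left; apply/eqP/eq_expect => w.
congr (expR (l * _)); rewrite /bt_score -big_filter /s rem_filter ?enum_uniq//.
by apply: perm_big; rewrite enumT.
Qed.

(** Chernoff's bound with both signs of [l], which stays free until [good_event_prob] optimizes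
    it. *)
Lemma score_tail1 i l t : l * K%:R <= 1 -> 0 <= l ->
  bt_prob beta (fun w => t < `|bt_score w i|) <=
  2 * expR (2 * l ^+ 2 * K%:R ^+ 2 * n%:R - l * t).
Proof.
move=> lK l0; rewrite bt_probE.
apply: (@le_trans _ _ (expR (- (l * t)) *
  (Ex (fun w => expR (l * bt_score w i)) + Ex (fun w => expR (- l * bt_score w i))))).
  rewrite -expectD -expectZ; apply: Ex_le => w.
  case: ltP => [ts|_]; last by rewrite mulr_ge0 ?addr_ge0 ?expR_ge0.
  rewrite mulrDr -!expRD -(expR0 R).
  have [s0|s0] := leP 0 (bt_score w i).
    apply: (@le_trans _ _ (expR (- (l * t) + l * bt_score w i))); last by rewrite lerDl expR_ge0.
    by rewrite ler_expR addrC -mulrBr mulr_ge0// subr_ge0 ltW// -(ger0_norm s0).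
  apply: (@le_trans _ _ (expR (- (l * t) + - l * bt_score w i))); last by rewrite lerDr expR_ge0.
  rewrite ler_expR -mulrN mulNr -mulrN -mulrDr mulr_ge0// addrC subr_ge0.
  by rewrite -(ltr0_norm s0) ltW.
rewrite expRD mulrA [leRHS]mulrC ler_wpM2l ?expR_ge0// mulrDl mul1r lerD//.
  by apply: expect_expR_bt_score; rewrite ger0_norm.
by rewrite -(sqrrN l); apply: expect_expR_bt_score; rewrite normrN ger0_norm.
Qed.

Lemma score_tail l t : l * K%:R <= 1 -> 0 <= l ->
  bt_prob beta (fun w => ~~ [forall i, `|bt_score w i| <= t]) <=
  n%:R * (2 * expR (2 * l ^+ 2 * K%:R ^+ 2 * n%:R - l * t)).
Proof.
move=> lK l0.
apply: (@le_trans _ _ (\sum_(i < n) bt_prob beta (fun w => t < `|bt_score w i|))).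
  rewrite bt_probE; under eq_bigr do rewrite bt_probE.
  rewrite -expect_sum; apply: Ex_le => w.
  case: forallP => [_|]; first by rewrite sumr_ge0.
  move=> /existsNP[i] /negP; rewrite -ltNge => ti /=.
  by rewrite (bigD1 i)//= ti lerDl sumr_ge0.
apply: (le_trans (ler_sum _ (fun i _ => score_tail1 i t lK l0))).
by rewrite big_const_ord iter_addr_0 -[_ *+ n]mulr_natl.
Qed.

End BradleyTerryLaw.

(** * Sums over ordered pairs of distinct subjects *)

Section OffDiagonalSums.
Variables (R : realType) (n : nat).
Implicit Types (F : 'I_n -> 'I_n -> R).

Lemma sum_ord_const (c : R) : \sum_(i < n) c = n%:R * c.
Proof. by rewrite sumr_const card_ord -(mulr_natl c). Qed.

Lemma offdiag_exchange F :
  \sum_(i < n) \sum_(j < n | j != i) F i j = \sum_(i < n) \sum_(j < n | j != i) F j i.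
Proof.
rewrite (exchange_big_dep predT)//=; apply: eq_bigr => i _.
by apply: eq_bigl => j; rewrite eq_sym.
Qed.

Lemma offdiag_sym_lt F : (forall i j, F i j = F j i) ->
  \sum_(i < n) \sum_(j < n | j != i) F i j = 2 * \sum_(i < n) \sum_(j < n | (i < j)%N) F i j.
Proof.
move=> FC; rewrite mulr_natl mulr2n.
have -> : \sum_(i < n) \sum_(j < n | j != i) F i j =
  \sum_(i < n) \sum_(j < n | (i < j)%N) F i j + \sum_(i < n) \sum_(j < n | (j < i)%N) F i j.
  rewrite -big_split; apply: eq_bigr => i _ /=.
  rewrite (bigID (fun j : 'I_n => (i < j)%N))/=; congr (_ + _); apply: eq_bigl => j.
    by rewrite -(inj_eq val_inj) /=; case: ltngtP.
  by rewrite -(inj_eq val_inj) /=; case: ltngtP.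
congr (_ + _); rewrite (exchange_big_dep predT)//=.
by apply: eq_bigr => i _; apply: eq_bigr => j _.
Qed.

Lemma offdiag_block F (G : {set 'I_n}) : (forall i j, F i j = F j i) ->
  (forall i j, i \notin G -> j \notin G -> F i j = 0) ->
  \sum_(i < n) \sum_(j < n | j != i) F i j =
  \sum_(i in G) \sum_(j in G | j != i) F i j + 2 * \sum_(i in G) \sum_(j | j \notin G) F i j.
Proof.
move=> FC F0; rewrite (bigID (mem G))/= mulr_natl mulr2n addrA; congr (_ + _).
  rewrite -big_split; apply: eq_bigr => i iG /=.
  rewrite (bigID (mem G))/=; congr (_ + _); apply: eq_bigl => j; first by rewrite andbC.
  by rewrite andbC; case: (boolP (j \in G)) => //= jG; apply: contraNneq jG => ->.
rewrite [RHS](exchange_big_dep (fun j => j \notin G))//=; apply: eq_bigr => i iG.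
rewrite (bigID (mem G))/= [X in _ + X]big1 ?addr0; last by move=> j /andP[_ jG]; exact: F0.
apply: eq_big => [j|j _]; last exact: FC.
rewrite andbC iG; case: (boolP (j \in G)) => //= jG.
by apply: contraNneq iG => <-.
Qed.

Lemma sum_offdiag_diff_eq0 F : (forall i j, i != j -> F j i = - F i j) ->
  \sum_(i < n) \sum_(j < n | j != i) F i j = 0.
Proof.
move=> FN; have : \sum_(i < n) \sum_(j < n | j != i) F i j = - \sum_(i < n) \sum_(j < n | j != i) F i j.
  rewrite {1}offdiag_exchange -sumrN; apply: eq_bigr => i _.
  by rewrite -sumrN; apply: eq_bigr => j; rewrite eq_sym => ij; exact: FN.
lra.
Qed.

End OffDiagonalSums.

(** * Exact expansion of the log-likelihood *)

Section LikelihoodExpansion.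
Variables (R : realType) (n K : nat) (w : outcome n K).
Implicit Types (b D : 'I_n -> R) (i j : 'I_n).

Lemma ell_bt_offdiag b : ell_bt w b = \sum_(i < n) \sum_(j < n | j != i)
   (bt_a R w i j * b i - K%:R / 2 * (b j + softplus (b i - b j))).
Proof.
rewrite /ell_bt; under [RHS]eq_bigr do rewrite sumrB.
rewrite sumrB; congr (_ - _).
  by apply: eq_bigr => i _; rewrite mulrC mulr_suml.
have := @offdiag_sym_lt R n (fun i j => ln (expR (b i) + expR (b j))) (fun i j => congr1 _ (addrC _ _)) => H.
under [in RHS]eq_bigr => i _ do rewrite -mulr_sumr.
rewrite -mulr_sumr.
transitivity (K%:R / 2 * (2 * \sum_(i < n) \sum_(j < n | (i < j)%N) ln (expR (b i) + expR (b j)))).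
  by rewrite mulrA divfK.
rewrite -H; congr (_ * _); apply: eq_bigr => i _; apply: eq_bigr => j _.
exact: ln_expRD.
Qed.

Lemma sum_bt_score b : \sum_(i < n) bt_score b w i = 0.
Proof. by apply: sum_offdiag_diff_eq0 => i j; exact: bt_devC. Qed.

(** An identity without remainder and with arbitrary base point: it is applied at the truth, at
    near-maximizers and at points constant on the block. *)
Lemma ell_bt_expand b D : ell_bt w (fun i => b i + D i) - ell_bt w b =
  \sum_(i < n) D i * bt_score b w i
  - K%:R / 2 * \sum_(i < n) \sum_(j < n | j != i) bregman (b i - b j) (D i - D j).
Proof.
rewrite !ell_bt_offdiag -sumrB.
under eq_bigr do rewrite -sumrB.
have -> : \sum_(i < n) D i * bt_score b w i =
   \sum_(i < n) \sum_(j < n | j != i) D i * bt_dev b w i j.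
  by apply: eq_bigr => i _; rewrite mulr_sumr.
rewrite mulr_sumr -sumrB; under [RHS]eq_bigr do rewrite mulr_sumr -sumrB.
(* Summand by summand the two sides differ by this antisymmetric term, which cancels over ordered
   pairs. *)
pose F i j := K%:R / 2 * (sigm (b i - b j) * D i - sigm (b j - b i) * D j).
have F0 : \sum_(i < n) \sum_(j < n | j != i) F i j = 0.
  by apply: sum_offdiag_diff_eq0 => i j _; rewrite /F; ring.
rewrite -[RHS]addr0 -[X in _ = _ + X]F0.
rewrite -big_split; apply: eq_bigr => i _; rewrite -big_split; apply: eq_bigr => j _ /=.
rewrite /F /bt_dev /bregman -(opprB (b i)) sigmN.
rewrite (_ : b i + D i - (b j + D j) = b i - b j + (D i - D j)); last by ring.
by field.
Qed.

End LikelihoodExpansion.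

(** * Localization on the good event *)

Section GoodEvent.
Variables (R : realType) (n K : nat) (w : outcome n K) (beta : 'I_n -> R) (b e : R).
Hypotheses (K_gt0 : (0 < K)%N) (n_gt0 : (0 < n)%N) (b_gt0 : 0 < b) (e_gt0 : 0 < e).
Hypothesis dsigm_ge : forall i j : 'I_n, i != j -> b^-1 <= dsigm (beta i - beta j).
Hypothesis score_le : forall i : 'I_n, `|bt_score beta w i| <= e * n%:R.
Hypothesis be_small : 4 * b * e / K%:R < 1.
Implicit Types (D : 'I_n -> R) (i j : 'I_n).

Let rho : R := 8 * b * e / K%:R.
Let K0 : 0 < K%:R :> R. Proof. by rewrite ltr0n. Qed.
Let n0 : 0 < n%:R :> R. Proof. by rewrite ltr0n. Qed.

Definition spread D : R := \sum_(i < n) \sum_(j < n) `|D i - D j|.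

(** As the scores sum to zero, the linear term is an average over pairs of [D i - D j] times a
    score, hence at most [e * spread D]; the divergence grows linearly with a larger slope. *)
Lemma ell_bt_sub_le D :
  ell_bt w (fun i => beta i + D i) - ell_bt w beta <= e * (rho * n%:R ^+ 2 - spread D).
Proof.
rewrite ell_bt_expand.
have H1 : \sum_(i < n) D i * bt_score beta w i <= e * spread D.
  have -> : \sum_(i < n) D i * bt_score beta w i =
     n%:R^-1 * \sum_(i < n) \sum_(j < n) (D i - D j) * bt_score beta w i.
    under [in RHS]eq_bigr => i _ do rewrite -mulr_suml sumrB mulrBl.
    rewrite sumrB -mulr_sumr sum_bt_score mulr0 subr0 mulr_sumr.
    apply: eq_bigr => i _; rewrite sumr_const card_ord -(mulr_natl (D i)).
    by rewrite -mulrA mulKf ?gt_eqF.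
  rewrite mulrC ler_pdivrMr// /spread mulr_sumr mulr_suml; apply: ler_sum => i _.
  rewrite mulr_sumr mulr_suml; apply: ler_sum => j _.
  rewrite (le_trans (ler_norm _))// normrM mulrC mulrAC; exact: ler_wpM2r.
(* Chosen so that [K / (2 * b) * eta = 2 * e], twice the slope of the linear term; the intercept
   then gives [rho = 2 * eta]. *)
pose eta : R := 4 * b * e / K%:R.
have eta0 : 0 <= eta by rewrite /eta divr_ge0 ?mulr_ge0// ltW.
have H2 : eta * spread D - eta ^+ 2 * n%:R ^+ 2 <=
    b * \sum_(i < n) \sum_(j < n | j != i) bregman (beta i - beta j) (D i - D j).
  rewrite (_ : eta ^+ 2 * n%:R ^+ 2 = \sum_(i < n) \sum_(j < n) eta ^+ 2); last first.
    by rewrite !sum_ord_const; ring.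
  rewrite /spread !mulr_sumr -sumrB; apply: ler_sum => i _.
  rewrite !mulr_sumr -sumrB [leLHS](bigD1 i)//= -[leRHS]add0r; apply: lerD.
    by rewrite subrr normr0 mulr0 sub0r oppr_le0 sqr_ge0.
  apply: ler_sum => j ji.
  rewrite (le_trans (smoothabs_ge_lin _ _))//; first by rewrite eta0.
  rewrite (le_trans _ (ler_wpM2l (ltW b_gt0) (bregman_ge _ _)))// mulrA ler_peMl ?smoothabs_ge0//.
  by rewrite -ler_pdivrMl// mulr1 dsigm_ge// eq_sym.
move: H1 H2; set S := \sum_(i < n) \sum_(j < n | _) _; set T := spread D; set L := \sum_(i < n) _.
move=> H1 H2.
have -> : e * (rho * n%:R ^+ 2 - T) = e * T - K%:R / (2 * b) * (eta * T - eta ^+ 2 * n%:R ^+ 2).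
  by rewrite /rho /eta; field; rewrite !gt_eqF.
apply: lerB => //; rewrite (_ : K%:R / 2 * S = K%:R / (2 * b) * (b * S)); last first.
  by field; rewrite gt_eqF.
by apply: ler_wpM2l => //; rewrite divr_ge0 ?mulr_ge0// ltW.
Qed.

(** [ell_bt_sub_le] forces [spread D <= rho * n ^+ 2], so one of the [n] rows of that double sum is
    at most [rho * n]; its index serves as center. *)
Lemma spread_center D : ell_bt w beta <= ell_bt w (fun i => beta i + D i) ->
  exists c, \sum_(j < n) `|D c - D j| <= rho * n%:R.
Proof.
move=> H; have := ell_bt_sub_le D.
have [//|/forallNP N] := pselect (exists c, \sum_(j < n) `|D c - D j| <= rho * n%:R).
have : rho * n%:R ^+ 2 < spread D; last first.
  by move: H; rewrite -subr_ge0; move: e_gt0; nra.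
rewrite (_ : rho * _ = \sum_(i < n) rho * n%:R); last first.
  by rewrite sum_ord_const; ring.
apply: ltr_sum; first by apply/hasP; exists (Ordinal n_gt0); rewrite ?mem_index_enum.
by move=> i _; rewrite ltNge; apply/negP/N.
Qed.

(** Near-optimality under joint shifts of [S] makes the total score of [S] of order [sqrt n] per
    member. Were [d0] far from [D c], the win probabilities of [S] against the outside subjects, at
    least half of all, would have moved in one direction and made that score large. [S] will be a
    single member of the block, or all of it. *)
Lemma block_center (S : {set 'I_n}) D d0 c :
  (0 < #|S|)%N -> (#|S|.*2 <= n)%N -> (forall i, i \in S -> D i = d0) ->
  (forall t, ell_bt w (fun i => (beta i + D i) + t * (i \in S)%:R)
             <= ell_bt w (fun i => beta i + D i) + 1) ->
  \sum_(j < n) `|D c - D j| <= rho * n%:R ->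
  1 - expR (- `|d0 - D c|) <= 2 * b * (e / K%:R + (Num.sqrt n%:R)^-1 + rho / 4).
Proof.
move=> S0 S2 DS Dt Dc; set g := fun i => beta i + D i.
pose s : R := #|S|%:R.
have s1 : 1 <= s by rewrite /s ler1n.
pose V := \sum_(i in S) bt_score g w i.
have sumS (F : 'I_n -> R) : \sum_(i < n) (i \in S)%:R * F i = \sum_(i in S) F i.
  rewrite [RHS]big_mkcond; apply: eq_bigr => i _.
  by case: (i \in S); rewrite ?mul1r ?mul0r.
have cstS (x : R) : \sum_(i in S) x = s * x by rewrite sumr_const -(mulr_natl x).
(* The exact expansion at the shifted point, with the global bound [bregman x h <= h ^+ 2 / 8];
   pairs with both ends or no end in [S] do not feel the shift. *)
have Vt t : t * V - K%:R * s * n%:R * t ^+ 2 / 8 <= 1.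
  have := Dt t; rewrite -/g -lerBlDl ell_bt_expand; apply: le_trans.
  apply: lerB.
    by rewrite /V -sumS mulr_sumr le_eqVlt; apply/orP; left; apply/eqP/eq_bigr => i _; rewrite mulrA.
  have -> : K%:R * s * n%:R * t ^+ 2 / 8 = K%:R / 2 * (t ^+ 2 / 8 * (2 * (n%:R * s))).
    by field.
  apply: ler_wpM2l; first by rewrite divr_ge0.
  have -> : 2 * (n%:R * s) = \sum_(i < n) \sum_(j < n) ((i \in S)%:R + (j \in S)%:R).
    under eq_bigr do rewrite big_split /= sum_ord_const.
    have E : \sum_(j < n) (j \in S)%:R = s :> R.
      by have := sumS (fun=> 1); under eq_bigr do rewrite mulr1; rewrite cstS mulr1.
    by rewrite big_split /= sum_ord_const -mulr_sumr E; ring.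
  rewrite mulr_sumr; apply: ler_sum => i _.
  rewrite mulr_sumr big_mkcond; apply: ler_sum => j _ /=.
  case: ifP => _; last by rewrite mulr_ge0 ?divr_ge0 ?sqr_ge0.
  rewrite (le_trans (bregman_le_sqr _ _))// -mulrBr exprMn mulrAC.
  rewrite ler_wpM2l ?divr_ge0 ?sqr_ge0//.
  by case: (i \in S); case: (j \in S); rewrite /= expr2; lra.
pose q := Num.sqrt n%:R : R.
have q0 : 0 < q by rewrite sqrtr_gt0.
have qq : q ^+ 2 = n%:R by rewrite sqr_sqrtr ?ltW.
have VK : `|V| <= K%:R * s * q.
  have K1 : 1 <= K%:R :> R by rewrite ler1n.
  (* The maximizer in [t] of the left side of [Vt]. *)
  have := Vt (4 * V / (K%:R * s * n%:R)).
  have s0 : 0 < s by lra.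
  rewrite (_ : _ - _ = 2 * V ^+ 2 / (K%:R * s * n%:R)); last first.
    by field; rewrite !gt_eqF.
  rewrite ler_pdivrMr ?mulr_gt0// mul1r => H.
  have Z0 : 0 <= K%:R * s * q by apply/ltW; rewrite !mulr_gt0.
  rewrite -(@ler_pXn2r _ 2) ?nnegrE// real_normK ?num_real// exprMn qq.
  have Ks : 1 <= K%:R * s by rewrite (le_trans s1)// ler_peMl// (le_trans ler01).
  have : K%:R * s * n%:R <= (K%:R * s) ^+ 2 * n%:R by rewrite (ler_wpM2r (ltW n0))// expr2 ler_peMr// ltW// mulr_gt0.
  have := sqr_ge0 V; lra.
pose d := d0 - D c.
(* The change of win probabilities if every outside subject deviated by exactly [D c]. The true
   change is [B] below; as [sigm] has Lipschitz constant 1/4, the two differ by at most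
   [rho * n / 4] per member. *)
pose A := \sum_(i in S) \sum_(j | j \notin S) (sigm (beta i - beta j + d) - sigm (beta i - beta j)).
have scoreE i : bt_score g w i = bt_score beta w i - K%:R * \sum_(j < n | j != i)
    (sigm (beta i - beta j + (D i - D j)) - sigm (beta i - beta j)).
  rewrite mulr_sumr -sumrB; apply: eq_bigr => j _; rewrite /bt_dev.
  by rewrite (_ : g i - g j = beta i - beta j + (D i - D j)) /g; ring.
have HA : `|A| <= s * (e * n%:R / K%:R + q + rho * n%:R / 4).
  pose B := \sum_(i in S) \sum_(j | j \notin S)
    (sigm (beta i - beta j + (D i - D j)) - sigm (beta i - beta j)).
  have VE : V = \sum_(i in S) bt_score beta w i - K%:R * B.
    rewrite /V /B mulr_sumr -sumrB; apply: eq_bigr => i iS; rewrite scoreE; congr (_ - _ * _).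
    rewrite (bigID (mem S))/= big1 ?add0r; last first.
      by move=> j /andP[_ jS]; rewrite !DS// subrr addr0 subrr.
    by apply: eq_bigl => j; rewrite andbC; case: (boolP (j \in S)) => //= jS; apply: contraNneq jS => ->.
  have HB : `|B| <= s * (e * n%:R / K%:R + q).
    have -> : B = (\sum_(i in S) bt_score beta w i - V) / K%:R by rewrite VE; field; rewrite gt_eqF.
    rewrite normrM normfV (ger0_norm (ltW K0)) ler_pdivrMr// (le_trans (ler_normB _ _))//.
    have -> : s * (e * n%:R / K%:R + q) * K%:R = s * (e * n%:R) + K%:R * s * q.
      by field; rewrite gt_eqF.
    by rewrite lerD// (le_trans (ler_norm_sum _ _ _))// -cstS ler_sum.
  have HAB : `|A - B| <= s * (rho * n%:R / 4).
    rewrite /A /B -sumrB -cstS (le_trans (ler_norm_sum _ _ _))// ler_sum// => i iS.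
    rewrite -sumrB (le_trans (ler_norm_sum _ _ _))//.
    apply: (@le_trans _ _ (4^-1 * \sum_(j < n) `|D c - D j|)); last by rewrite mulrC ler_pM2r ?invr_gt0.
    rewrite mulr_sumr [leRHS](bigID (fun j => j \notin S))/= -[leLHS]addr0.
    apply: lerD; last by rewrite sumr_ge0// => j _; rewrite mulr_ge0.
    apply: ler_sum => j _.
    rewrite (_ : _ - _ = sigm (beta i - beta j + (D i - D j) + (D j - D c)) - sigm (beta i - beta j + (D i - D j))).
      by rewrite (le_trans (sigm_lip _ _))// mulrC distrC.
    have -> : beta i - beta j + (D i - D j) + (D j - D c) = beta i - beta j + d.
      by rewrite /d (DS _ iS); ring.
    by ring.
  have := ler_normD (A - B) B; rewrite subrK => /le_trans; apply.
  by rewrite (mulrDr s (_ + _)) addrC lerD.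
have n2S : n%:R <= 2 * (n%:R - s).
  have : (#|S|.*2)%:R <= n%:R :> R by rewrite ler_nat.
  by rewrite -muln2 natrM -/s; lra.
(* All summands of [A] have the sign of [d], so nothing cancels. *)
have AL : s * ((n%:R - s) * ((1 - expR (- `|d|)) / b)) <= `|A|.
  have P0 : 0 <= 1 - expR (- `|d|) by rewrite subr_ge0 -ler_ln ?posrE ?expR_gt0// ln1 expRK oppr_le0.
  have -> : `|A| = \sum_(i in S) \sum_(j | j \notin S) `|sigm (beta i - beta j + d) - sigm (beta i - beta j)|.
    have [dd|dd] := leP 0 d.
      rewrite ger0_norm.
        by apply: eq_bigr => i _; apply: eq_bigr => j _; rewrite ger0_norm// subr_ge0 sigm_mono.
      by rewrite sumr_ge0// => i _; rewrite sumr_ge0// => j _; rewrite subr_ge0 sigm_mono.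
    have M x : sigm (x + d) - sigm x <= 0.
      by rewrite subr_le0 -{2}(addrK d x) sigm_mono// oppr_ge0 ltW.
    rewrite ler0_norm; last by rewrite sumr_le0// => i _; rewrite sumr_le0.
    rewrite /A -sumrN; apply: eq_bigr => i _; rewrite -sumrN; apply: eq_bigr => j _.
    by rewrite ler0_norm.
  rewrite -cstS; apply: ler_sum => i iS.
  have -> : n%:R - s = \sum_(j | j \notin S) (1 : R).
    rewrite sumr_const -[#|_|]/(#|[predC S]|) -[n in LHS]card_ord -(cardC (mem S)) natrD.
    by rewrite addrC addKr.
  rewrite mulr_suml; apply: ler_sum => j jS; rewrite mul1r.
  apply: le_trans (sigm_sub_abs_ge _ _); rewrite mulrC ler_wpM2r//.
  by apply: dsigm_ge; apply: contraNneq jS => <-.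
have : (n%:R - s) * ((1 - expR (- `|d|)) / b) <= e * n%:R / K%:R + q + rho * n%:R / 4.
  by rewrite -(@ler_pM2l _ s) ?(lt_le_trans ltr01)// (le_trans AL).
rewrite -/d; have P0 : 0 <= 1 - expR (- `|d|).
  by rewrite subr_ge0 -ler_ln ?posrE ?expR_gt0// ln1 expRK oppr_le0.
move: (1 - _) P0 => p p0 H.
have -> : (Num.sqrt n%:R)^-1 = q / n%:R :> R by rewrite -/q -qq; field; rewrite gt_eqF.
have -> : 2 * b * (e / K%:R + q / n%:R + rho / 4) = 2 * b / n%:R * (e * n%:R / K%:R + q + rho * n%:R / 4).
  by field; rewrite !gt_eqF.
have H' : n%:R / 2 * (p / b) <= e * n%:R / K%:R + q + rho * n%:R / 4.
  apply: le_trans H; apply: ler_wpM2r; first by rewrite divr_ge0 ?(ltW b_gt0).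
  by lra.
rewrite [leRHS]mulrC -ler_pdivrMr ?divr_gt0 ?mulr_gt0//.
by apply: le_trans H'; rewrite le_eqVlt; apply/orP; left; apply/eqP; field; rewrite !gt_eqF.
Qed.

End GoodEvent.

(** * Perturbations around a point that is constant on the block *)

Section FlatBlock.
Variables (R : realType) (n K : nat) (G : {set 'I_n}) (g : 'I_n).
Hypothesis gG : g \in G.
Implicit Types (beta c D : 'I_n -> R) (w : outcome n K) (i j : 'I_n).

Definition flat c := forall i j, i \in G -> j \in G -> c i = c j.

(* The diagonal Fisher information entry of a member of [G], counting only the games against
   subjects outside [G]. *)
Definition block_info c : R := K%:R * \sum_(j | j \notin G) dsigm (c g - c j).

Definition block_dev beta w i : R :=
  bt_score beta w i - (\sum_(k in G) bt_score beta w k) / #|G|%:R.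

Lemma card_block_gt0 : 0 < #|G|%:R :> R.
Proof. by rewrite ltr0n; apply/card_gt0P; exists g. Qed.

Lemma sum_block_const (x : R) : \sum_(i in G) x = #|G|%:R * x.
Proof. by rewrite sumr_const -(mulr_natl x). Qed.

Lemma sum_block_dev beta w : \sum_(i in G) block_dev beta w i = 0.
Proof.
rewrite sumrB sum_block_const mulrC divfK ?subrr//.
by rewrite gt_eqF// card_block_gt0.
Qed.

(** Block members share one parameter in [beta] and one in [c], so their win probabilities change
    alike. A common change pairs to zero with perturbations of sum zero; thus the other parameters
    of [c] leave the linear term. *)
Lemma flat_score beta c w i : flat beta -> flat c -> i \in G ->
  bt_score c w i - bt_score beta w i = bt_score c w g - bt_score beta w g.
Proof.
move=> fb fc iG.
have E k : k \in G -> bt_score c w k - bt_score beta w k =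
    K%:R * \sum_(j < n) (sigm (beta g - beta j) - sigm (c g - c j)).
  move=> kG; rewrite /bt_score -sumrB [in RHS](bigD1 k)//= (fb g k)// (fc g k)// !subrr add0r mulr_sumr.
  by apply: eq_bigr => j _; rewrite /bt_dev; ring.
by rewrite !E.
Qed.

Lemma flat_expand beta c D w : flat beta -> flat c ->
  (forall i, i \notin G -> D i = 0) -> \sum_(i in G) D i = 0 ->
  ell_bt w (fun i => c i + D i) - ell_bt w c =
  \sum_(i in G) D i * block_dev beta w i
  - K%:R / 2 * \sum_(i in G) \sum_(j in G | j != i) bregman 0 (D i - D j)
  - K%:R * \sum_(i in G) \sum_(j | j \notin G) bregman (c g - c j) (D i).
Proof.
move=> fb fc D0 DG; rewrite ell_bt_expand (@offdiag_block _ _ _ G); first last.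
- by move=> i j iG jG; rewrite !D0// subrr bregman0.
- by move=> i j; rewrite -bregmanN !opprB.
rewrite mulrDr opprD addrA; congr (_ - _ - _).
- rewrite (bigID (mem G))/= [X in _ + X]big1 ?addr0; last by move=> i /D0 ->; rewrite mul0r.
  apply/eqP; rewrite -subr_eq0 -sumrB; apply/eqP.
  rewrite (eq_bigr (fun i => D i * (bt_score c w g - bt_score beta w g +
       (\sum_(k in G) bt_score beta w k) / #|G|%:R))).
    by rewrite -mulr_suml DG mul0r.
  by move=> i iG; rewrite -(flat_score w fb fc iG) /block_dev; ring.
- congr (_ * _); apply: eq_bigr => i iG; apply: eq_bigr => j /andP[jG _].
  by rewrite (fc i j)// subrr.
- rewrite mulrA divfK//; congr (_ * _); apply: eq_bigr => i iG; apply: eq_bigr => j jG.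
  by rewrite (fc i g)// (D0 j)// subr0.
Qed.

(** Dropping the divergence between block members decouples the coordinates, and each is bounded by
    the conjugate of [smoothabs], whatever the size of [D]. *)
Lemma flat_sub_le beta c D w : flat beta -> flat c ->
  (forall i, i \notin G -> D i = 0) -> \sum_(i in G) D i = 0 -> 0 < block_info c ->
  (forall i, i \in G -> `|block_dev beta w i| <= block_info c / 2) ->
  ell_bt w (fun i => c i + D i) - ell_bt w c <=
  \sum_(i in G) block_dev beta w i ^+ 2 /
     (2 * block_info c * (1 - `|block_dev beta w i| / block_info c)).
Proof.
move=> fb fc D0 DG A0 yA; rewrite (flat_expand w fb fc D0 DG).
set y := block_dev beta w; set A := block_info c in A0 yA *.
apply: (@le_trans _ _ (\sum_(i in G) (y i * D i - A * smoothabs (D i)))); last first.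
  by apply: ler_sum => i iG; apply: lin_sub_smoothabs_le => //; exact: yA.
rewrite sumrB; apply: lerB.
  apply: (@le_trans _ _ (\sum_(i in G) D i * y i)).
    rewrite gerBl mulr_ge0 ?divr_ge0// sumr_ge0// => i _; rewrite sumr_ge0// => j _.
    exact: bregman_ge0.
  by rewrite le_eqVlt; apply/orP; left; apply/eqP/eq_bigr => i _; rewrite mulrC.
rewrite mulr_sumr; apply: ler_sum => i iG; rewrite /A /block_info -mulrA.
apply: ler_wpM2l => //; rewrite mulr_suml; apply: ler_sum => j _; exact: bregman_ge.
Qed.

(** [D] is a Newton step with curvature [a]. The factor [expR e] covers the change of curvature
    along the step, the last term the games within the block, which [block_info] does not count. *)
Lemma flat_sub_ge beta c w (a e : R)
    (D := fun i => if i \in G then block_dev beta w i / a else 0)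
    (Q := \sum_(i in G) block_dev beta w i ^+ 2 / a) :
  flat beta -> flat c -> 0 < a ->
  (forall i, i \in G -> `|block_dev beta w i| <= e * a) ->
  Q * (2 - block_info c / a * expR e - K%:R * #|G|%:R / (4 * a))
  <= 2 * (ell_bt w (fun i => c i + D i) - ell_bt w c).
Proof.
move=> fb fc a0 ya; set y := block_dev beta w in ya D Q *.
have a0' := lt0r_neq0 a0.
have D0 i : i \notin G -> D i = 0 by rewrite /D => /negbTE ->.
have DG : \sum_(i in G) D i = 0.
  rewrite (eq_bigr (fun i => y i / a)) ?[X in X = _](mulr_suml)//.
    by rewrite -mulr_suml sum_block_dev mul0r.
  by move=> i iG; rewrite /D iG.
rewrite (flat_expand w fb fc D0 DG) -/y.
have S2 : \sum_(i in G) D i ^+ 2 = Q / a.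
  rewrite /Q mulr_suml; apply: eq_bigr => i iG; rewrite /D iG; field; exact: a0'.
have -> : \sum_(i in G) D i * y i = Q.
  by apply: eq_bigr => i iG; rewrite /D iG; field; exact: a0'.
have H1 : \sum_(i in G) \sum_(j in G | j != i) bregman 0 (D i - D j) <= #|G|%:R * (Q / a) / 4.
  have -> : #|G|%:R * (Q / a) / 4 = \sum_(i in G) \sum_(j in G) (D i - D j) ^+ 2 / 8.
    transitivity (\sum_(i in G) \sum_(j in G) (8^-1 * D i ^+ 2 + 8^-1 * D j ^+ 2 - 4^-1 * D i * D j)).
      under eq_bigr => i _ do rewrite sumrB big_split /= sum_block_const -!mulr_sumr DG mulr0 subr0.
      by rewrite big_split /= sum_block_const -!mulr_sumr S2; field.
    by apply: eq_bigr => i _; apply: eq_bigr => j _; field.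
  apply: ler_sum => i iG; rewrite big_mkcondr; apply: ler_sum => j jG.
  by case: ifP => _; [exact: bregman_le_sqr|rewrite divr_ge0 ?sqr_ge0].
have H2 : K%:R * \sum_(i in G) \sum_(j | j \notin G) bregman (c g - c j) (D i) <=
    block_info c * (Q / a / 2 * expR e).
  rewrite /block_info -[leRHS]mulrA; apply: ler_wpM2l => //.
  rewrite -S2 ![in X in _ * X]mulr_suml mulr_sumr; apply: ler_sum => i iG.
  rewrite mulr_suml; apply: ler_sum => j _.
  apply: (le_trans (bregman_le _ _)); apply: ler_wpM2l; first exact/ltW/dsigm_gt0.
  have [_ H _ _] := expR_taylor2 (normr_ge0 (D i)).
  apply: (le_trans H); rewrite real_normK ?num_real//.
  apply: ler_wpM2l; first by rewrite divr_ge0 ?sqr_ge0.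
  by rewrite ler_expR /D iG normrM normfV (gtr0_norm a0) ler_pdivrMr// ya.
have -> : Q * (2 - block_info c / a * expR e - K%:R * #|G|%:R / (4 * a)) =
   2 * (Q - K%:R / 2 * (#|G|%:R * (Q / a) / 4) - block_info c * (Q / a / 2 * expR e)).
  by field; exact: a0'.
rewrite ler_pM2l//; apply: lerB => //; apply: lerB => //.
by apply: ler_wpM2l => //; rewrite divr_ge0.
Qed.

Lemma block_info_close beta c (v : R) : `|block_info c - block_info beta| <=
  K%:R / 4 * (n%:R * `|(c g - beta g) - v| + \sum_(j | j \notin G) `|v - (c j - beta j)|).
Proof.
rewrite /block_info -mulrBr normrM ger0_norm// -!mulrA; apply: ler_wpM2l => //.
rewrite -sumrB (le_trans (ler_norm_sum _ _ _))//.
apply: (@le_trans _ _ (4^-1 * (\sum_(j | j \notin G) `|(c g - beta g) - v| +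
   \sum_(j | j \notin G) `|v - (c j - beta j)|))); last first.
  rewrite ler_pM2l// lerD2r -sum_ord_const [leRHS](bigID (fun j => j \notin G))/= lerDl.
  by rewrite sumr_ge0.
rewrite -big_split mulr_sumr; apply: ler_sum => j _; apply: (le_trans (dsigm_lip _ _)).
rewrite mulrC ler_pM2l//.
have -> : c g - c j - (beta g - beta j) = ((c g - beta g) - v) + (v - (c j - beta j)) by ring.
exact: ler_normD.
Qed.

Lemma block_info_ge beta (b : R) : (forall i j, i != j -> b^-1 <= dsigm (beta i - beta j)) ->
  K%:R * (n%:R - #|G|%:R) / b <= block_info beta.
Proof.
move=> H; rewrite /block_info -mulrA; apply: ler_wpM2l => //.
have -> : n%:R - #|G|%:R = \sum_(j | j \notin G) (1 : R).
  have E : (#|G| + #|[predC G]|)%N = n by rewrite cardC card_ord.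
  have := congr1 (fun k => k%:R : R) E; rewrite natrD => <-.
  by rewrite addrAC subrr add0r sumr_const.
rewrite mulr_suml; apply: ler_sum => j jG; rewrite mul1r H//.
by apply: contraNneq jG => <-.
Qed.

Lemma block_dev_le beta w (t : R) : (forall i, `|bt_score beta w i| <= t) ->
  forall i, `|block_dev beta w i| <= 2 * t.
Proof.
move=> H i; rewrite (le_trans (ler_normB _ _))// mulr_natl mulr2n lerD//.
rewrite normrM normfV (gtr0_norm card_block_gt0) ler_pdivrMr ?card_block_gt0//.
rewrite (le_trans (ler_norm_sum _ _ _))// mulrC -sum_block_const; exact: ler_sum.
Qed.

End FlatBlock.

(** * Two-sided bounds for the likelihood ratio *)

Section LikelihoodRatioBounds.
Variables (R : realType) (n K r : nat) (w : outcome n K) (beta : 'I_n -> R) (b e : R).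
Hypotheses (K_gt0 : (0 < K)%N) (r_gt2 : (2 < r)%N) (r_le_n : (r.*2 <= n)%N).
Hypotheses (b_ge1 : 1 <= b) (e_ge : (Num.sqrt n%:R)^-1 <= e) (z_small : b ^+ 3 * e <= 100^-1).
Hypothesis beta0 : Theta0 n r beta.
Hypothesis dsigm_ge : forall i j : 'I_n, i != j -> b^-1 <= dsigm (beta i - beta j).
Hypothesis score_le : forall i : 'I_n, `|bt_score beta w i| <= e * n%:R.

Definition null_block : {set 'I_n} := [set i : 'I_n | (1 <= i < r)%N].

Let n_gt1 : (1 < n)%N.
Proof. by apply: leq_trans r_le_n; rewrite -addnn ltn_addr// ltnW. Qed.

Let g : 'I_n := Ordinal n_gt1.

Let gG : g \in null_block. Proof. by rewrite inE /= ltnW. Qed.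

Lemma theta0P (c : 'I_n -> R) : Theta0 n r c <-> Theta n c /\ flat null_block c.
Proof.
split=> -[H1 H2]; split => // i j; first by rewrite !inE; exact: H2.
by move=> hi hj; apply: H2; rewrite inE.
Qed.

Lemma card_null_block : #|null_block| = r.-1.
Proof.
have r0 : (0 < r)%N by apply: leq_trans r_gt2.
rewrite cardE -(size_map val) -[RHS](size_iota 1); apply: perm_size; apply: uniq_perm.
- by rewrite (map_inj_uniq val_inj) enum_uniq.
- exact: iota_uniq.
move=> k; rewrite mem_iota add1n prednK//.
apply/mapP/idP => [[i]|kr]; first by rewrite mem_enum inE => ? ->.
have kn : (k < n)%N.
  case/andP: kr => _ kr; apply: (leq_trans kr); apply: leq_trans r_le_n.
  by rewrite -addnn leq_addr.
by exists (Ordinal kn) => //; rewrite mem_enum inE.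
Qed.

(** The value must also stay above that at [c0], because localization requires beating the truth; if
    [c0] is itself within [xi], it is taken. *)
Lemma near_max (X : set ('I_n -> R)) c0 B xi : X c0 -> (forall c, X c -> ell_bt w c <= B) -> 0 < xi ->
  exists c, [/\ X c, sup [set ell_bt w c | c in X] - xi <= ell_bt w c & ell_bt w c0 <= ell_bt w c].
Proof.
move=> Xc0 XB xi0.
have hs : has_sup [set ell_bt w c | c in X].
  by split; [exists (ell_bt w c0), c0|exists B => _ [c /XB ? <-]].
have [h|h] := leP (sup [set ell_bt w c | c in X] - xi) (ell_bt w c0).
  by exists c0.
have [_ [c Xc <-] hc] := sup_adherent xi0 hs.
by exists c; split => //; [exact: ltW|apply/ltW/(lt_trans h)].
Qed.

Lemma le_sup_ell (X : set ('I_n -> R)) c B : X c -> (forall c, X c -> ell_bt w c <= B) ->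
  ell_bt w c <= sup [set ell_bt w c | c in X].
Proof. by move=> Xc XB; apply: ub_le_sup; [exists B => _ [? /XB ? <-]|exists c]. Qed.

(** Near-maximizers are located on the block up to order [b ^+ 2 * e]; comparison with an
    information that may be as small as [K * n / (2 * b)] costs the third factor [b]. *)
Let z : R := b ^+ 3 * e.
Let rho : R := 8 * b * e / K%:R.
Let kap : R := 2 * b * (e / K%:R + (Num.sqrt n%:R)^-1 + rho / 4).
Let m : R := (r.-1)%:R.
Local Notation G := null_block.
Local Notation info := (block_info K G g).
Local Notation y := (block_dev G beta w).

Let n_gt0 : (0 < n)%N. Proof. exact: ltnW. Qed.
Let n0 : 0 < n%:R :> R. Proof. by rewrite ltr0n. Qed.
Let K1 : 1 <= K%:R :> R. Proof. by rewrite ler1n. Qed.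
Let K0 : 0 < K%:R :> R. Proof. by rewrite ltr0n. Qed.
Let b0 : 0 < b. Proof. exact: lt_le_trans b_ge1. Qed.
Let e0 : 0 < e.
Proof. by apply: lt_le_trans e_ge; rewrite invr_gt0 sqrtr_gt0. Qed.
Let be0 : 0 < b * e. Proof. exact: mulr_gt0. Qed.
Let bbe : b * e <= b ^+ 2 * e.
Proof. by rewrite ler_pM2r// expr2 ler_peMr// ltW. Qed.
Let bbbe : b ^+ 2 * e <= z.
Proof. by rewrite /z ler_pM2r// [b ^+ 3]exprSr ler_peMr// sqr_ge0. Qed.

Let rho_le : rho <= 8 * (b * e).
Proof.
by rewrite /rho ler_pdivrMr// -mulrA ler_peMr// mulr_ge0// ltW.
Qed.

Let be_small : 4 * b * e / K%:R < 1.
Proof.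
have -> : 4 * b * e / K%:R = rho / 2 by rewrite /rho; field; rewrite gt_eqF.
move: z_small; rewrite -/z; have := rho_le; have := bbe; have := bbbe; lra.
Qed.

Let kap_le : kap <= 8 * (b ^+ 2 * e).
Proof.
have h : e / K%:R + (Num.sqrt n%:R)^-1 + rho / 4 <= 2 * e + 2 * (b * e).
  have : e / K%:R <= e by rewrite ler_pdivrMr// ler_peMr// ltW.
  have := rho_le; have := e_ge; lra.
have b20 : 0 <= 2 * b by rewrite mulr_ge0// ltW.
apply: (le_trans (ler_wpM2l b20 h)); rewrite -subr_ge0.
rewrite (_ : _ - _ = 4 * (b ^+ 2 * e - b * e)); last by ring.
by rewrite mulr_ge0// subr_ge0.
Qed.

Let A0 : R := info beta.

Let flat_beta : flat G beta. Proof. by have [] := (theta0P beta).1 beta0. Qed.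

Let A0_ge : K%:R * n%:R / (2 * b) <= A0.
Proof.
apply: le_trans (block_info_ge K gG dsigm_ge).
rewrite card_null_block invfM mulrA ler_pM2r ?invr_gt0// -mulrA ler_pM2l//.
have : (r.*2)%:R <= n%:R :> R by rewrite ler_nat.
have : (r.-1)%:R <= r%:R :> R by rewrite ler_nat leq_pred.
rewrite -muln2 natrM; lra.
Qed.

Let A0_gt0 : 0 < A0.
Proof. by apply: lt_le_trans A0_ge; rewrite divr_gt0 ?mulr_gt0. Qed.

Let y_le i : `|y i| <= 4 * z * A0.
Proof.
apply: (le_trans (block_dev_le gG score_le i)).
apply: (@le_trans _ _ (4 * (b * e) * (K%:R * n%:R / (2 * b)))).
  have -> : 4 * (b * e) * (K%:R * n%:R / (2 * b)) = K%:R * (2 * (e * n%:R)).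
    by field; rewrite gt_eqF.
  by rewrite ler_peMl// ?mulr_ge0// ltW.
apply: ler_pM => //; first by rewrite mulr_ge0// ltW.
  by rewrite divr_ge0 ?mulr_ge0// ltW.
by rewrite ler_pM2l// (le_trans bbe).
Qed.

(** [kap] is the bound delivered by [block_center]; as it is at most 1/2, [1 - expR (- (2 * kap)) >=
    2 * kap / (1 + 2 * kap) >= kap]. *)
Let dev_le (x : R) : 0 <= x -> 1 - expR (- x) <= kap -> x <= 2 * kap.
Proof.
move=> x0 h; rewrite leNgt; apply/negP => kx.
have k1 : kap <= 2^-1.
  by move: z_small; rewrite -/z; have := kap_le; have := bbbe; lra.
have k0 : 0 <= kap by apply: le_trans h; rewrite subr_ge0 -(expR0 R) ler_expR oppr_le0.
have : expR (- x) < expR (- (2 * kap)) by rewrite ltr_expR ltrN2.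
have := expR_ge1Dx (2 * kap); have := expR_gt0 (- (2 * kap)); have := expRxMexpNx_1 (2 * kap).
move: (expR (- x)) (expR (2 * kap)) (expR (- _)) h => u v t; nra.
Qed.

(** Keeps the likelihood values bounded above; otherwise [sup] would return a default value. *)
Let bounded c : ell_bt w c <= ell_bt w beta + e * (rho * n%:R ^+ 2).
Proof.
have := ell_bt_sub_le K_gt0 n_gt0 b0 e0 dsigm_ge score_le be_small (fun i => c i - beta i).
have -> : (fun i => beta i + (c i - beta i)) = c by apply/funext => i; rewrite addrC subrK.
have : 0 <= spread (fun i => c i - beta i) by rewrite sumr_ge0// => i _; rewrite sumr_ge0.
rewrite -/rho mulrBr => s0; have : 0 <= e * spread (fun i => c i - beta i) by rewrite mulr_ge0// ltW.
lra.
Qed.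

(* For a near-maximizer [c], every coordinate block of the deviation [c - beta] on which the
   likelihood may still be varied is close to one common value [v]. *)
Let near_max_center (c : 'I_n -> R) (B : R) :
  ell_bt w beta <= ell_bt w c -> B - 1 <= ell_bt w c ->
  exists v, \sum_(j < n) `|v - (c j - beta j)| <= rho * n%:R /\
   forall (S : {set 'I_n}) d0, (0 < #|S|)%N -> S \subset G ->
     (forall i, i \in S -> c i - beta i = d0) ->
     (forall t, ell_bt w (fun i => c i + t * (i \in S)%:R) <= B) ->
     `|d0 - v| <= 2 * kap.
Proof.
move=> h1 h2; pose D i := c i - beta i.
have Dc : (fun i => beta i + D i) = c by apply/funext => i; rewrite addrC subrK.
have [k hk] := @spread_center R n K w beta b e K_gt0 n_gt0 b0 e0 dsigm_ge score_le be_small D ltac:(by rewrite Dc).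
exists (D k); split => // S d0 S0 SG HS Ht; apply: dev_le => //.
apply: (@block_center R n K w beta b e K_gt0 n_gt0 b0 dsigm_ge score_le S D d0 k) => //.
  apply: leq_trans r_le_n; rewrite leq_double (leq_trans (subset_leq_card SG))//.
  by rewrite card_null_block leq_pred.
move=> t; rewrite Dc; apply: (@le_trans _ _ B); last by rewrite -lerBlDr.
by apply: le_trans (Ht t); rewrite (_ : (fun i => _ + _) = fun i => c i + t * (i \in S)%:R)//; apply/funext => i; rewrite -[in RHS]Dc.
Qed.

Let info_close (c : 'I_n -> R) v : \sum_(j | j \notin G) `|v - (c j - beta j)| <= rho * n%:R ->
  `|(c g - beta g) - v| <= 2 * kap -> `|info c - A0| <= 12 * z * A0.
Proof.
move=> h1 h2; apply: (le_trans (block_info_close K G g beta c v)).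
apply: (@le_trans _ _ (12 * z * (K%:R * n%:R / (2 * b)))); last first.
  by rewrite ler_wpM2l// mulr_ge0// (le_trans (ltW be0))// (le_trans bbe).
have -> : 12 * z * (K%:R * n%:R / (2 * b)) = K%:R / 4 * (n%:R * (16 * (b ^+ 2 * e)) + 8 * (b ^+ 2 * e) * n%:R).
  by rewrite /z; field; rewrite gt_eqF.
apply: ler_wpM2l; first by rewrite divr_ge0// ltW.
apply: lerD.
  by rewrite ler_pM2l//; apply: (le_trans h2); have := kap_le; lra.
apply: (le_trans h1); rewrite ler_pM2r//; have := rho_le; have := bbe; lra.
Qed.

Let mem0 (i : 'I_n) : val i = 0%N -> i \in G = false.
Proof. by move=> i0; rewrite inE [(i : nat)]i0. Qed.

Definition quad_stat : R := \sum_(i in null_block) y i ^+ 2 / A0.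

Let bound_ge0 : 0 <= quad_stat.
Proof. by rewrite sumr_ge0// => i _; rewrite divr_ge0 ?sqr_ge0// ltW. Qed.

Let Th_beta : Theta n beta. Proof. by have [] := (theta0P beta).1 beta0. Qed.

Let Th_shift (c : 'I_n -> R) (S : {set 'I_n}) (t : R) : S \subset G -> Theta n c ->
  Theta n (fun i => c i + t * (i \in S)%:R).
Proof.
move=> SG Tc i i0; rewrite Tc// add0r.
case: (boolP (i \in S)) => [/(fintype.subsetP SG)|_]; last by rewrite mulr0.
by rewrite mem0.
Qed.

Let LR_upper xi : 0 < xi <= 1 -> LR_stat n K r w <= quad_stat / (1 - 16 * z) + 2 * xi.
Proof.
move=> /andP[xi0 xi1].
set s1 := sup [set ell_bt w c | c in @Theta R n]; set s0 := sup [set ell_bt w c | c in @Theta0 R n r].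
have [c [Tc sc lc]] := near_max Th_beta (fun c _ => bounded c) xi0.
rewrite -/s1 in sc.
have scb c' : Theta n c' -> ell_bt w c' <= s1 by move=> ?; apply: le_sup_ell (fun c _ => bounded c).
have [v [hv Hv]] := near_max_center lc (le_trans (lerB (lexx s1) xi1) sc).
(* Within [Theta] each block coordinate may be varied alone, so the center estimate applies to
   singletons. *)
have Hi i : i \in G -> `|(c i - beta i) - v| <= 2 * kap.
  move=> iG; apply: (Hv [set i]%SET); rewrite ?cards1 ?finset.sub1set//.
    by move=> j; rewrite inE => /eqP ->.
  by move=> t; apply: scb; apply: Th_shift => //; rewrite finset.sub1set.
pose mu := (\sum_(i in G) c i) / #|G|%:R.
have G0 : 0 < #|G|%:R :> R := card_block_gt0 R gG.
pose c' i := if i \in G then mu else c i.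
have Tc' : Theta n c' by move=> i i0; rewrite /c' mem0// Tc.
have fc' : flat G c' by move=> i j iG jG; rewrite /c' iG jG.
have T0c' : Theta0 n r c' by apply/theta0P.
have sc' : ell_bt w c' <= s0 by apply: le_sup_ell (fun c _ => bounded c).
pose D i := c i - c' i.
have cE : (fun i => c' i + D i) = c by apply/funext => i; rewrite addrC subrK.
have DN i : i \notin G -> D i = 0 by rewrite /D /c' => /negbTE ->; rewrite subrr.
have DG : \sum_(i in G) D i = 0.
  rewrite (eq_bigr (fun i => c i - mu)); last by move=> i iG; rewrite /D /c' iG.
  by rewrite sumrB sum_block_const mulrC divfK ?subrr// gt_eqF.
(* Averaging preserves the distance to [v] because [beta] is constant on the block. *)
have muv : `|(c' g - beta g) - v| <= 2 * kap.
  have -> : c' g - beta g - v = (\sum_(i in G) (c i - beta i - v)) / #|G|%:R.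
    rewrite (eq_bigr (fun i => c i - (beta g + v))); last first.
      by move=> i iG; rewrite (flat_beta iG gG); ring.
    by rewrite sumrB sum_block_const /c' gG /mu; field; rewrite gt_eqF.
  rewrite normrM normfV (gtr0_norm G0) ler_pdivrMr//.
  by rewrite (le_trans (ler_norm_sum _ _ _))// mulrC -sum_block_const ler_sum.
have hv' : \sum_(j | j \notin G) `|v - (c' j - beta j)| <= rho * n%:R.
  apply: le_trans hv; rewrite [leRHS](bigID (fun j => j \notin G))/= -[leLHS]addr0.
  apply: lerD; last by rewrite sumr_ge0.
  by apply: ler_sum => j /negbTE jG; rewrite /c' jG.
have := info_close hv' muv; rewrite ler_norml => /andP[lo _].
have z1 : z <= 100^-1 := z_small.
have z0 : 0 <= z by rewrite (le_trans (ltW be0))// (le_trans bbe).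
have A1 : A0 * (1 - 12 * z) <= info c' by lra.
have A2 : 0 < info c' by apply: lt_le_trans A1; rewrite mulr_gt0//; lra.
have yA i : i \in G -> `|y i| <= info c' / 2.
  move=> _; apply: (le_trans (y_le i)); apply: (@le_trans _ _ (A0 * (1 - 12 * z) / 2)); last by lra.
  rewrite mulrC -mulrA ler_pM2l//; lra.
have := flat_sub_le gG flat_beta fc' DN DG A2 yA; rewrite cE => H.
have H' : 2 * (ell_bt w c - ell_bt w c') <= quad_stat / (1 - 16 * z).
  apply: (@le_trans _ _ (2 * \sum_(i in G) y i ^+ 2 / (2 * info c' * (1 - `|y i| / info c')))).
    by rewrite ler_pM2l.
  rewrite /quad_stat mulr_sumr mulr_suml; apply: ler_sum => i iG.
  have -> : 2 * info c' * (1 - `|y i| / info c') = 2 * (info c' - `|y i|).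
    by field; rewrite gt_eqF.
  have p1 : 0 < A0 * (1 - 16 * z) by rewrite mulr_gt0//; lra.
  (* 16 = 12 + 4: the error of the information in [info_close] plus the size of the scores in
     [y_le]. *)
  have p2 : A0 * (1 - 16 * z) <= info c' - `|y i| by have := y_le i; lra.
  have p3 : 0 < info c' - `|y i| by exact: lt_le_trans p2.
  have -> : 2 * (y i ^+ 2 / (2 * (info c' - `|y i|))) = y i ^+ 2 / (info c' - `|y i|).
    by field; rewrite gt_eqF.
  rewrite -[leRHS]mulrA -invfM.
  by rewrite ler_wpM2l ?sqr_ge0// lef_pV2.
by rewrite /LR_stat -/s1 -/s0; lra.
Qed.

Let LR_lower xi : 0 < xi <= 1 ->
  quad_stat * (2 - (1 + 12 * z) * expR (4 * z) - m * z) - 2 * xi <= LR_stat n K r w.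
Proof.
move=> /andP[xi0 xi1].
set s1 := sup [set ell_bt w c | c in @Theta R n]; set s0 := sup [set ell_bt w c | c in @Theta0 R n r].
have [c [T0c sc lc]] := near_max beta0 (fun c _ => bounded c) xi0.
rewrite -/s0 in sc.
have scb c' : Theta0 n r c' -> ell_bt w c' <= s0 by move=> ?; apply: le_sup_ell (fun c _ => bounded c).
have [v [hv Hv]] := near_max_center lc (le_trans (lerB (lexx s0) xi1) sc).
have [Tc fc] := (theta0P c).1 T0c.
have Hg : `|(c g - beta g) - v| <= 2 * kap.
  (* Within [Theta0] the block moves as a whole, so the center estimate is applied with [S = G]. *)
  apply: (Hv G) => //; first by apply/card_gt0P; exists g.
    by move=> i iG; rewrite (fc i g)// (flat_beta iG gG).
  move=> t; apply: scb; apply/theta0P; split; first exact: Th_shift.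
  by move=> i j iG jG; rewrite (fc i j)// iG jG.
have hv' : \sum_(j | j \notin G) `|v - (c j - beta j)| <= rho * n%:R.
  apply: le_trans hv; rewrite [leRHS](bigID (fun j => j \notin G))/= -[leLHS]addr0.
  by apply: lerD; last by rewrite sumr_ge0.
have := info_close hv' Hg; rewrite ler_norml => /andP[_ up].
have z0 : 0 <= z by rewrite (le_trans (ltW be0))// (le_trans bbe).
have := @flat_sub_ge _ _ _ _ g gG beta c w A0 (4 * z) flat_beta fc A0_gt0 (fun i _ => y_le i).
rewrite -/quad_stat; set D := (fun i : 'I_n => _) => H.
have Tc' : Theta n D by move=> i i0; rewrite /D Tc// mem0// addr0.
have sc' : ell_bt w D <= s1 by apply: le_sup_ell (fun c _ => bounded c).
have HQ : quad_stat * (2 - (1 + 12 * z) * expR (4 * z) - m * z) <=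
   quad_stat * (2 - info c / A0 * expR (4 * z) - K%:R * #|G|%:R / (4 * A0)).
  apply: ler_wpM2l => //; rewrite card_null_block -/m; apply: lerB.
    apply: lerB => //; apply: ler_wpM2r; first exact: expR_ge0.
    by rewrite ler_pdivrMr//; lra.
  rewrite ler_pdivrMr; last by rewrite pmulr_rgt0.
  apply: (@le_trans _ _ (m * z * (4 * (K%:R * n%:R / (2 * b))))); last first.
    apply: ler_wpM2l; first by apply: mulr_ge0; rewrite // /m ler0n.
    by rewrite ler_pM2l.
  have -> : m * z * (4 * (K%:R * n%:R / (2 * b))) = K%:R * m * (2 * (b ^+ 2 * e) * n%:R).
    by rewrite /z; field; rewrite gt_eqF.
  rewrite ler_peMr ?mulr_ge0 ?ler0n//.
  (* From [e >= 1 / sqrt n]; this absorbs the games inside the block, a constant over [A0], into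
     [m * z]. *)
  have : 1 <= e * n%:R.
    have := e_ge; have : Num.sqrt n%:R ^+ 2 = n%:R :> R by rewrite sqr_sqrtr ?ltW.
    have q1 : 1 <= Num.sqrt n%:R :> R by rewrite -[leLHS]sqrtr1 ler_wsqrtr// ler1n.
    move: (Num.sqrt _) q1 => q q1 <-.
    have q0 : 0 < q by lra.
    rewrite -(@ler_pM2r _ q)// mulVf ?gt_eqF// => h.
    apply: (le_trans h); rewrite ler_pM2l// expr2 ler_peMr//; lra.
  have : e <= b ^+ 2 * e by rewrite ler_peMl ?(ltW e0)// -(expr1n _ 2) lerXn2r ?nnegrE// ltW.
  move: n0; move: (b ^+ 2 * e) => u; nra.
rewrite /LR_stat -/s1 -/s0; lra.
Qed.

Lemma LR_stat_bounds :
  quad_stat * (2 - (1 + 12 * z) * expR (4 * z) - m * z) <= LR_stat n K r w <= quad_stat / (1 - 16 * z).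
Proof.
apply/andP; split; apply/ler_addgt0Pr => x x0; have xi : 0 < Num.min (x / 2) 1 <= 1.
- by rewrite lt_min ge_min lexx orbT ltr01 divr_gt0.
- have := LR_lower xi; have : Num.min (x / 2) 1 <= x / 2 by rewrite ge_min lexx.
  lra.
- by rewrite lt_min ge_min lexx orbT ltr01 divr_gt0.
- have := LR_upper xi; have : Num.min (x / 2) 1 <= x / 2 by rewrite ge_min lexx.
  lra.
Qed.

End LikelihoodRatioBounds.

(** * Scalar remainders for one replacement step *)

Section HeatStepScalars.
Variable R : realType.
Implicit Types (a c t x y k B U : R).

Lemma cube_expR_le c : 0 <= c -> (1 + c) ^+ 3 * expR (- (c / 2)) <= 96.
Proof.
move=> c0; set s := (1 + c) / 2.
have s0 : 0 <= s by rewrite /s; lra.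
have h := @expR_ge1Dxn R s 2 s0.
have h2 : (1 + c) ^+ 3 <= 48 * expR s.
  have -> : (1 + c) ^+ 3 = 48 * (s ^+ 3 / 3`!%:R) by rewrite /s -[3`!]/6%N; field.
  by rewrite ler_pM2l//; lra.
apply: (le_trans (ler_wpM2r (expR_ge0 _) h2)).
rewrite -mulrA -expRD (_ : s - c / 2 = 2^-1); last by rewrite /s; field.
have := expR_ge1Dx (- 2^-1 : R); rewrite expRN => h3.
have e0 := expR_gt0 (2^-1 : R).
have : expR (2^-1 : R) <= 2 by rewrite -ler_pV2 ?inE ?unitfE ?gt_eqF//; lra.
lra.
Qed.

Lemma lin_expR_le c : 0 <= c -> (1 + c) * expR (- c) <= 1.
Proof. by move=> c0; rewrite expRN ler_pdivrMr ?expR_gt0// mul1r expR_ge1Dx. Qed.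

(** 16 is 96 / 6: the constant of [cube_expR_le] times the third-order Taylor coefficient. *)
Definition cubic_const B : R := 16 * (2 + 2 * B) ^+ 3 * expR (3 * B).

(** Here [c] is the exponent before a step and [y] its change. Since [y] grows at most like the
    square root of [c], the factor [expR (- c)] makes the bound uniform in [c]. *)
Lemma cubic_remainder c y x B U : 0 <= c -> 0 <= x <= 1 -> 0 <= B -> 0 <= U -> U ^+ 2 <= B * c ->
  `|y| <= x * (2 * U + B) ->
  expR (- c) * `|expR y - 1 - y - y ^+ 2 / 2| <= cubic_const B * x ^+ 3.
Proof.
move=> c0 /andP[x0 x1] B0 U0 UB yx.
have P1 : 2 * U + B <= (2 + 2 * B) * (1 + c) by nra.
have P0 : 0 <= 2 * U + B by lra.
(* Arithmetic-geometric mean applied to [U ^+ 2 <= B * c]. Half of [expR (- c)] pays for the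
   exponential of |y|, the other half for the powers of [1 + c]. *)
have E1 : `|y| <= c / 2 + 3 * B.
  have [B00|Bn0] := eqVneq B 0.
    have U00 : U = 0 by apply/eqP; rewrite -sqrf_eq0 eq_le sqr_ge0 andbT (le_trans UB)// B00 mul0r.
    by apply: (le_trans yx); rewrite B00 U00; lra.
  have Bp : 0 < B by rewrite lt_def Bn0.
  have UU : U <= c / 4 + B.
    have h : 0 <= (U - 2 * B) ^+ 2 by exact: sqr_ge0.
    rewrite -(@ler_pM2l _ B)//; move: h; rewrite expr2; move: UB; rewrite expr2; lra.
  by apply: (le_trans yx); nra.
apply: (le_trans (ler_wpM2l (expR_ge0 _) (expR_sub3_le y))).
have y3 : `|y| ^+ 3 <= x ^+ 3 * ((2 + 2 * B) ^+ 3 * (1 + c) ^+ 3).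
  rewrite -!exprMn lerXn2r ?nnegrE//; first by rewrite mulr_ge0// mulr_ge0//; lra.
  by rewrite (le_trans yx)// ler_wpM2l.
have e3 : expR (- c) * expR `|y| <= expR (- (c / 2)) * expR (3 * B).
  by rewrite -!expRD ler_expR; lra.
rewrite [leLHS](_ : _ = `|y| ^+ 3 / 6 * (expR (- c) * expR `|y|)); last by ring.
apply: (@le_trans _ _ (x ^+ 3 * ((2 + 2 * B) ^+ 3 * (1 + c) ^+ 3) / 6 * (expR (- (c / 2)) * expR (3 * B)))).
  apply: ler_pM => //; rewrite ?mulr_ge0 ?expR_ge0 ?exprn_ge0//.
  by rewrite ler_wpM2r.
rewrite /cubic_const.
rewrite [leLHS](_ : _ = (x ^+ 3 * (2 + 2 * B) ^+ 3 * expR (3 * B) / 6) * ((1 + c) ^+ 3 * expR (- (c / 2)))); last by ring.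
rewrite [leRHS](_ : _ = (x ^+ 3 * (2 + 2 * B) ^+ 3 * expR (3 * B) / 6) * 96); last by field.
apply: ler_wpM2l; last exact: cube_expR_le.
by rewrite divr_ge0// !mulr_ge0 ?expR_ge0 ?exprn_ge0//; lra.
Qed.

Definition quad_const a k : R := 4 * (a + 1 + 2 * k) ^+ 2 * expR (2 * k * a) + a + 1.

(** The first-order expansion of [heat] in time, in rescaled variables and uniformly in the exponent
    [c]. *)
Lemma quad_remainder a c t k : 0 <= a -> 0 <= c -> 0 <= t <= 2 * k ->
  `|expR (- a * ln (1 + t) - c / (1 + t)) - expR (- c) * (1 + (c - a) * t)|
   <= quad_const a k * t ^+ 2.
Proof.
move=> a0 c0 /andP[t0 tk].
have t1 : 0 < 1 + t by lra.
set W := - a * ln (1 + t) + c * t / (1 + t).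
have -> : - a * ln (1 + t) - c / (1 + t) = - c + W.
  by rewrite /W; field; rewrite gt_eqF.
rewrite expRD -mulrBr normrM (ger0_norm (expR_ge0 _)).
have l1 : ln (1 + t) <= t by apply: le_ln1Dx; lra.
have l0 : 0 <= ln (1 + t) by apply: ln_ge0; lra.
have l2 : t - t ^+ 2 <= ln (1 + t).
  have h : -1 < - (t / (1 + t)) by rewrite ltrN2 ltr_pdivrMr//; lra.
  have := le_ln1Dx h; rewrite (_ : 1 - t / (1 + t) = (1 + t)^-1); last by field; rewrite gt_eqF.
  rewrite lnV ?posrE// lerN2; apply: le_trans.
  rewrite ler_pdivlMr//; have := exprn_ge0 3 t0; rewrite !exprS expr0; nra.
have r1 : c * t / (1 + t) <= c * t by rewrite ler_pdivrMr// ler_peMr ?mulr_ge0//; lra.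
have r0 : 0 <= c * t / (1 + t) by rewrite divr_ge0 ?mulr_ge0// ltW.
have r2 : c * t - c * t ^+ 2 <= c * t / (1 + t).
  rewrite ler_pdivlMr//.
  have := mulr_ge0 c0 (exprn_ge0 3 t0); rewrite !exprS expr0; nra.
have W1 : `|W - (c - a) * t| <= (a + c) * t ^+ 2.
  rewrite ler_norml; apply/andP; split; rewrite /W; nra.
have W2 : `|W| <= (a + c) * t.
  rewrite ler_norml; apply/andP; split; rewrite /W; nra.
(* The decay that survives the division by [1 + t], as [t <= 2 * k]; it absorbs the polynomial
   factors in [c]. *)
set s := c / (1 + 2 * k).
have k1 : 0 < 1 + 2 * k by lra.
have s0 : 0 <= s by rewrite divr_ge0// ltW.
have cs : c = (1 + 2 * k) * s by rewrite /s mulrC divfK// gt_eqF.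
have W3 : - c + `|W| <= 2 * k * a - s.
  have : `|W| <= a * t + c * t / (1 + t).
    by rewrite ler_norml; apply/andP; split; rewrite /W; nra.
  have : s <= c - c * t / (1 + t).
    rewrite (_ : c - _ = c / (1 + t)); last by field; rewrite gt_eqF.
    by rewrite ler_wpM2l// lef_pV2 ?posrE//; lra.
  nra.
have L0 : 0 <= a + 1 + 2 * k by lra.
have E2 : expR (- c) * `|expR W - 1 - W| <= 4 * (a + 1 + 2 * k) ^+ 2 * expR (2 * k * a) * t ^+ 2.
  apply: (le_trans (ler_wpM2l (expR_ge0 _) (expR_sub2_le W))).
  rewrite mulrCA -expRD.
  have W4 : W ^+ 2 <= ((a + 1 + 2 * k) * (1 + s) * t) ^+ 2.
    rewrite -real_normK ?num_real// lerXn2r ?nnegrE//; first by rewrite !mulr_ge0//; lra.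
    apply: (le_trans W2); apply: ler_wpM2r => //; rewrite cs; nra.
  apply: (@le_trans _ _ (((a + 1 + 2 * k) * (1 + s) * t) ^+ 2 / 2 * expR (2 * k * a - s))).
    by apply: ler_pM; rewrite ?divr_ge0 ?sqr_ge0 ?expR_ge0 ?ler_expR// ler_wpM2r.
  rewrite expRD.
  rewrite [leLHS](_ : _ = (a + 1 + 2 * k) ^+ 2 * expR (2 * k * a) * t ^+ 2 * ((1 + s) ^+ 2 * expR (- s) / 2)); last by ring.
  rewrite [leRHS](_ : _ = (a + 1 + 2 * k) ^+ 2 * expR (2 * k * a) * t ^+ 2 * 4); last by ring.
  apply: ler_wpM2l; first by rewrite !mulr_ge0 ?expR_ge0 ?exprn_ge0.
  rewrite ler_pdivrMr//.
  have -> : - s = - (s / 2) + - (s / 2) by lra.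
  have h2 : 1 + s <= 2 * expR (s / 2) by have := expR_ge1Dx (s / 2); lra.
  rewrite expRD !expRN; have e0 := expR_gt0 (s / 2).
  rewrite (_ : (1 + s) ^+ 2 * _ = ((1 + s) / expR (s / 2)) ^+ 2); last by ring.
  have h3 : (1 + s) / expR (s / 2) <= 2 by rewrite ler_pdivrMr.
  have : ((1 + s) / expR (s / 2)) ^+ 2 <= 2 ^+ 2.
    by rewrite lerXn2r ?nnegrE// divr_ge0 ?(ltW e0)//; lra.
  by rewrite expr2; lra.
have E3 : expR (- c) * `|W - (c - a) * t| <= (a + 1) * t ^+ 2.
  apply: (le_trans (ler_wpM2l (expR_ge0 _) W1)); rewrite mulrA ler_wpM2r ?sqr_ge0//.
  apply: (@le_trans _ _ ((a + 1) * ((1 + c) * expR (- c)))).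
    by rewrite mulrC mulrA ler_wpM2r ?expR_ge0//; nra.
  by rewrite ler_piMr ?lin_expR_le//; lra.
have -> : quad_const a k * t ^+ 2 = 4 * (a + 1 + 2 * k) ^+ 2 * expR (2 * k * a) * t ^+ 2 + (a + 1) * t ^+ 2.
  by rewrite /quad_const; ring.
apply: le_trans (lerD E2 E3); rewrite -mulrDr.
apply: ler_wpM2l; first exact: expR_ge0.
by apply: le_trans (ler_normD _ _); rewrite le_eqVlt; apply/orP; left; apply/eqP; congr `|_|; ring.
Qed.

End HeatStepScalars.

(** * Centered sums of squares *)

Section CenteredSumOfSquares.
Variables (R : realType) (I : finType) (G : {set I}).
Hypothesis G_gt0 : (0 < #|G|)%N.
Implicit Types z x u : I -> R.

Definition mean z : R := (\sum_(i in G) z i) / #|G|%:R.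
Definition cssq z : R := \sum_(i in G) (z i - mean z) ^+ 2.

Let m0 : 0 < #|G|%:R :> R. Proof. by rewrite ltr0n. Qed.

Lemma cssq_ge0 z : 0 <= cssq z.
Proof. by rewrite sumr_ge0// => i _; exact: sqr_ge0. Qed.

Lemma sum_set_const (c : R) : \sum_(i in G) c = #|G|%:R * c.
Proof. by rewrite sumr_const -(mulr_natl c). Qed.

Lemma sum_sub_mean z : \sum_(i in G) (z i - mean z) = 0.
Proof. by rewrite sumrB sum_set_const /mean mulrC divfK ?subrr// gt_eqF. Qed.

Lemma meanD z x : mean (fun i => z i + x i) = mean z + mean x.
Proof. by rewrite /mean big_split mulrDl. Qed.

Lemma cssqE z : cssq z = \sum_(i in G) z i ^+ 2 - (\sum_(i in G) z i) ^+ 2 / #|G|%:R.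
Proof.
rewrite /cssq (eq_bigr (fun i => z i ^+ 2 - 2 * mean z * z i + mean z ^+ 2)); last first.
  by move=> i _; ring.
rewrite big_split sumrB /= sum_set_const -mulr_sumr /mean; field; rewrite gt_eqF//.
Qed.

Lemma cssqD z x : cssq (fun i => z i + x i) =
  cssq z + 2 * \sum_(i in G) (z i - mean z) * x i + cssq x.
Proof.
rewrite {1}/cssq meanD.
rewrite (eq_bigr (fun i => (z i - mean z) ^+ 2 + 2 * ((z i - mean z) * x i) -
  2 * mean x * (z i - mean z) + (x i - mean x) ^+ 2)); last by move=> i _; ring.
by rewrite big_split /= sumrB big_split /= -!mulr_sumr sum_sub_mean mulr0 subr0.
Qed.

Lemma cssq_le z (x : R) : (forall i, i \in G -> `|z i| <= x) -> cssq z <= #|G|%:R * x ^+ 2.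
Proof.
move=> zx; rewrite cssqE -sum_set_const; apply: (@le_trans _ _ (\sum_(i in G) z i ^+ 2)).
  by rewrite gerBl divr_ge0 ?sqr_ge0// ltW.
apply: ler_sum => i iG; rewrite -real_normK ?num_real// lerXn2r ?nnegrE ?zx//.
by apply: le_trans (zx _ iG).
Qed.

(** Cauchy-Schwarz, as nonnegativity of the centered sum of squares of |u|. *)
Lemma sum_norm_sqr_le u : (\sum_(i in G) `|u i|) ^+ 2 <= #|G|%:R * \sum_(i in G) u i ^+ 2.
Proof.
have := cssq_ge0 (fun i => `|u i|); rewrite cssqE subr_ge0 ler_pdivrMr// mulrC.
suff -> : \sum_(i in G) `|u i| ^+ 2 = \sum_(i in G) u i ^+ 2 by [].
by apply: eq_bigr => i _; rewrite real_normK ?num_real.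
Qed.

End CenteredSumOfSquares.

(** * One replacement step for the heat semigroup *)

Section HeatStep.
Variables (R : realType) (E T : finType) (mu : E -> T -> R).
Hypothesis mu_ge0 : forall e a, 0 <= mu e a.
Hypothesis mu_sum1 : forall e, \sum_a mu e a = 1.
Variables (I : finType) (G : {set I}).
Hypothesis G_gt0 : (0 < #|G|)%N.
Local Notation W := {ffun E -> T}.
Local Notation Ex := (expect mu).
Local Notation m := (#|G|%:R : R).

(* The expectation of [exp (- k |centered part of z + Z|^2)] for a Gaussian [Z] with covariance
   [tau * Id] on [R^G], as a function of [q = cssq G z]; it solves the heat equation. *)
Definition heat (k tau q : R) : R :=
  expR (- ((m - 1) / 2) * ln (1 + 2 * k * tau) - k * q / (1 + 2 * k * tau)).

(** In order: the third-order Taylor remainder, the higher moments inside the second-order term (two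
    summands), and the time expansion of [heat]. Nothing depends on [tau], so the errors of
    successive steps simply add up. *)
Definition heat_const (k : R) : R :=
  cubic_const (k * m) + 2 * (k * m) + 3 * (k * m) ^+ 2 + 4 * k ^+ 2 * quad_const ((m - 1) / 2) k.

Let m1 : 1 <= m. Proof. by rewrite ler1n. Qed.

Lemma heat_const_ge0 k : 0 <= k -> 0 <= heat_const k.
Proof.
move=> k0; have km : 0 <= k * m by rewrite mulr_ge0// (le_trans ler01).
have a0 : 0 <= (m - 1) / 2 by rewrite divr_ge0// subr_ge0 m1.
have q0 : 0 <= quad_const ((m - 1) / 2) k.
  by rewrite /quad_const addr_ge0// addr_ge0// mulr_ge0 ?expR_ge0// mulr_ge0 ?sqr_ge0.
have c0 : 0 <= cubic_const (k * m).
  by rewrite /cubic_const mulr_ge0 ?expR_ge0// mulr_ge0// exprn_ge0//; lra.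
by rewrite /heat_const !addr_ge0// ?mulr_ge0 ?sqr_ge0.
Qed.

Variables (X : W -> I -> R) (v x : R).
Hypothesis X_mean : forall i, i \in G -> Ex (fun w => X w i) = 0.
Hypothesis X_var : forall i, i \in G -> Ex (fun w => X w i ^+ 2) = v.
Hypothesis X_cov : forall i j, i \in G -> j \in G -> i != j -> Ex (fun w => X w i * X w j) = 0.
Hypothesis X_le : forall w i, i \in G -> `|X w i| <= x.
Hypothesis x_itv : 0 <= x <= 1.

Let Ex_le := expect_le mu_ge0.
Let Ex_cst := expect_cst mu_sum1.

Let v_itv : 0 <= v <= x ^+ 2.
Proof.
have /card_gt0P[i iG] := G_gt0; rewrite -(X_var iG); apply/andP; split.
  by rewrite -(Ex_cst 0) Ex_le// => w; exact: sqr_ge0.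
rewrite -[leRHS]Ex_cst Ex_le// => w.
by rewrite -real_normK ?num_real// lerXn2r ?nnegrE ?X_le//; case/andP: x_itv.
Qed.

Let expect_lin_sqr (u : I -> R) :
  Ex (fun w => (\sum_(i in G) u i * X w i) ^+ 2) = v * \sum_(i in G) u i ^+ 2.
Proof.
under eq_expect => w do rewrite expr2 mulr_suml.
rewrite expect_sum mulr_sumr; apply: eq_bigr => i iG.
under eq_expect => w do rewrite mulr_sumr.
rewrite expect_sum (bigD1 i)//= [X in _ + X]big1 ?addr0.
  transitivity (Ex (fun w => u i ^+ 2 * X w i ^+ 2)); first by apply: eq_expect => w; ring.
  by rewrite expectZ X_var// mulrC.
move=> j /andP[jG ji].
transitivity (Ex (fun w => u i * u j * (X w i * X w j))); first by apply: eq_expect => w; ring.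
by rewrite expectZ X_cov ?mulr0// eq_sym.
Qed.

Let expect_cssq : Ex (fun w => cssq G (X w)) = (m - 1) * v.
Proof.
transitivity (Ex (fun w => \sum_(i in G) X w i ^+ 2 -
    m^-1 * (\sum_(i in G) 1 * X w i) ^+ 2)).
  apply: eq_expect => w; rewrite cssqE// [m^-1 * _]mulrC; congr (_ - _ ^+ 2 / _).
  by apply: eq_bigr => i _; rewrite mul1r.
rewrite expectB expect_sum expectZ expect_lin_sqr (eq_bigr _ X_var).
rewrite sum_set_const; under eq_bigr do rewrite expr1n.
by rewrite sum_set_const; field; rewrite gt_eqF// (lt_le_trans ltr01).
Qed.

(** Lindeberg's argument in closed form. [X] shares its first two moments with a Gaussian increment
    of covariance [v * Id], so both sides have the main term [expR (- c) * (1 + (c - a) * t)], up to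
    the factor [E0]; what is left is cubic in [x]. *)
Lemma heat_step (k tau : R) z : 0 <= k -> 0 <= tau ->
  `|Ex (fun w => heat k tau (cssq G (fun i => z i + X w i))) - heat k (tau + v) (cssq G z)|
   <= heat_const k * x ^+ 3.
Proof.
move=> k0 tau0; have /andP[x0 x1] := x_itv; have /andP[v0 vx] := v_itv.
set a := (m - 1) / 2; have a0 : 0 <= a by rewrite divr_ge0// subr_ge0 m1.
have ktau : 0 <= 2 * k * tau by rewrite !mulr_ge0.
have T1 : 0 < 1 + 2 * k * tau by lra.
(* At time [tau] the function is again exponential in the squared length, with rate [kap] and
   prefactor [E0]; [kap <= k] makes the bounds uniform in [tau]. *)
pose kap := k / (1 + 2 * k * tau).
have kap0 : 0 <= kap by rewrite divr_ge0// ltW.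
have kapk : kap <= k by rewrite ler_pdivrMr// ler_peMr//; lra.
pose E0 := expR (- a * ln (1 + 2 * k * tau)).
have E01 : 0 <= E0 <= 1.
  rewrite expR_ge0 -(expR0 R) ler_expR mulNr oppr_le0 mulr_ge0// ln_ge0//; lra.
set q := cssq G z; have q0 : 0 <= q := cssq_ge0 G z.
set c := kap * q; have c0 : 0 <= c by rewrite mulr_ge0.
pose t := 2 * kap * v.
have t0 : 0 <= t by apply: mulr_ge0 => //; apply: mulr_ge0.
have x2 : x ^+ 2 <= x by rewrite expr2 ler_piMl.
have tk : t <= 2 * k * x ^+ 2 by rewrite /t; apply: ler_pM => //; [exact: mulr_ge0|rewrite ler_pM2l].
have h1 w : heat k tau (cssq G (fun i => z i + X w i)) =
    E0 * expR (- kap * cssq G (fun i => z i + X w i)).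
  by rewrite /heat -/a expRD; congr (_ * expR _); rewrite /kap; field; rewrite gt_eqF.
have h2 : heat k (tau + v) q = E0 * expR (- a * ln (1 + t) - c / (1 + t)).
  have Et : 1 + 2 * k * (tau + v) = (1 + 2 * k * tau) * (1 + t).
    by rewrite /t /kap; field; rewrite gt_eqF.
  have t1 : 0 < 1 + t by lra.
  rewrite /heat -/a Et lnM ?posrE// /E0 -expRD; congr expR.
  by rewrite /c /kap; field; rewrite !gt_eqF.
under eq_expect => w do rewrite h1.
rewrite h2 expectZ -mulrBr normrM ger0_norm; last by case/andP: E01.
rewrite (le_trans (ler_piMl _ _))//; first by case/andP: E01.
clear h1 h2; clearbody kap.
set u := fun i => z i - mean G z; pose L w := \sum_(i in G) u i * X w i.
pose Y w := - kap * (2 * L w + cssq G (X w)).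
pose B := k * m; have B0 : 0 <= B by rewrite mulr_ge0// (le_trans ler01).
pose U := kap * \sum_(i in G) `|u i|.
have U0 : 0 <= U by rewrite mulr_ge0// sumr_ge0.
have UB : U ^+ 2 <= B * c.
  rewrite /U exprMn; apply: (le_trans (ler_wpM2l (sqr_ge0 _) (sum_norm_sqr_le G_gt0 _))).
  rewrite -/(cssq G z) -/q (_ : kap ^+ 2 * _ = kap * m * c); last by rewrite /c; ring.
  by rewrite ler_wpM2r// ler_wpM2r// (le_trans ler01).
have kL w : kap * `|L w| <= U * x.
  rewrite /U -[leRHS]mulrA ler_wpM2l// mulr_suml (le_trans (ler_norm_sum _ _ _))// ler_sum// => i iG.
  by rewrite normrM ler_wpM2l// X_le.
have kS w : kap * cssq G (X w) <= B * x ^+ 2.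
  apply: (@le_trans _ _ (k * (m * x ^+ 2))); last by rewrite mulrA.
  by apply: ler_pM => //; [exact: cssq_ge0|exact: cssq_le (X_le w)].
have kS0 w : 0 <= kap * cssq G (X w) by rewrite mulr_ge0// cssq_ge0.
have Yx w : `|Y w| <= x * (2 * U + B).
  rewrite /Y mulNr normrN mulrDr (le_trans (ler_normD _ _))//.
  rewrite (ger0_norm (kS0 w)) mulrCA normrM (ger0_norm (_ : 0 <= 2)) ?normrM ?(ger0_norm kap0)//.
  have := kL w; have := kS w; have : B * x ^+ 2 <= B * x by rewrite ler_wpM2l.
  lra.
have eY w : expR (- kap * cssq G (fun i => z i + X w i)) = expR (- c) * expR (Y w).
  by rewrite -expRD cssqD// -/q; congr expR; rewrite /c /Y /L; ring.
under eq_expect => w do rewrite eY.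
rewrite expectZ.
have EL : Ex L = 0.
  by rewrite expect_sum big1// => i iG; rewrite expectZ X_mean// mulr0.
have EY : Ex Y = - kap * ((m - 1) * v).
  by rewrite /Y expectZ expectD expectZ EL mulr0 add0r expect_cssq.
have EL2 : Ex (fun w => L w ^+ 2) = v * q by rewrite expect_lin_sqr.
(* The part of [Y ^+ 2 / 2] beyond the squared linear term, of order at least three in [X]. *)
pose Rm := Ex (fun w => 2 * kap ^+ 2 * (L w * cssq G (X w)) + kap ^+ 2 * cssq G (X w) ^+ 2 / 2).
have EY2 : Ex (fun w => Y w ^+ 2 / 2) = 2 * kap ^+ 2 * (v * q) + Rm.
  rewrite -EL2 -expectZ -expectD; by apply: eq_expect => w; rewrite /Y; field.
have HRm : `|Rm| <= x ^+ 3 * (2 * B * U + B ^+ 2).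
  apply: (le_trans (expect_abs_le mu_ge0 _)); rewrite -[leRHS]Ex_cst; apply: Ex_le => w.
  apply: (le_trans (ler_normD _ _)).
  have e1 : `|2 * kap ^+ 2 * (L w * cssq G (X w))| = 2 * ((kap * `|L w|) * (kap * cssq G (X w))).
    by rewrite !normrM (ger0_norm (_ : 0 <= 2)) // !(ger0_norm kap0) (ger0_norm (cssq_ge0 _ _)); ring.
  have e2 : `|kap ^+ 2 * cssq G (X w) ^+ 2 / 2| = (kap * cssq G (X w)) ^+ 2 / 2.
    by rewrite -exprMn ger0_norm// divr_ge0 ?sqr_ge0.
  have i1 : (kap * `|L w|) * (kap * cssq G (X w)) <= (U * x) * (B * x ^+ 2).
    by apply: ler_pM => //; rewrite mulr_ge0.
  have i3 : (kap * cssq G (X w)) ^+ 2 <= B ^+ 2 * x ^+ 3.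
    have : (kap * cssq G (X w)) ^+ 2 <= (B * x ^+ 2) ^+ 2.
      by rewrite lerXn2r ?nnegrE ?mulr_ge0 ?cssq_ge0 ?sqr_ge0.
    move=> /le_trans; apply; rewrite exprMn ler_wpM2l ?sqr_ge0//.
    by rewrite (_ : x ^+ 2 ^+ 2 = x ^+ 3 * x); [rewrite ler_piMr// exprn_ge0|ring].
  rewrite e1 e2; have := mulr_ge0 (sqr_ge0 B) (exprn_ge0 3 x0); move: i1 i3; rewrite !exprS !expr0; lra.
have M1 : expR (- c) * `|Ex (fun w => expR (Y w)) - (1 + Ex Y + Ex (fun w => Y w ^+ 2 / 2))| <=
   cubic_const B * x ^+ 3.
  have -> : Ex (fun w => expR (Y w)) - (1 + Ex Y + Ex (fun w => Y w ^+ 2 / 2)) =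
     Ex (fun w => expR (Y w) - 1 - Y w - Y w ^+ 2 / 2).
    by rewrite !expectB Ex_cst; ring.
  apply: (le_trans (ler_wpM2l (expR_ge0 _) (expect_abs_le mu_ge0 _))).
  rewrite -expectZ -[leRHS]Ex_cst; apply: Ex_le => w.
  by apply: (@cubic_remainder _ c _ x B U) => //.
have M2 : expR (- c) * `|Rm| <= (2 * B + 3 * B ^+ 2) * x ^+ 3.
  apply: (le_trans (ler_wpM2l (expR_ge0 _) HRm)).
  have U1 : 2 * B * U + B ^+ 2 <= (2 * B + 3 * B ^+ 2) * (1 + c).
    have : 2 * U <= 1 + B * c by have := sqr_ge0 (U - 1); move: UB; rewrite !expr2; lra.
    have := mulr_ge0 B0 c0; nra.
  rewrite mulrCA mulrC; apply: ler_wpM2r; first exact: exprn_ge0.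
  apply: (le_trans (ler_wpM2l (expR_ge0 _) U1)); rewrite mulrCA ler_piMr//.
    by rewrite addr_ge0 ?mulr_ge0 ?sqr_ge0.
  by rewrite mulrC lin_expR_le.
have tk2 : 0 <= t <= 2 * k.
  by rewrite t0 (le_trans tk)// ler_piMr ?mulr_ge0// (le_trans x2).
have M3 := quad_remainder a0 c0 tk2.
have t2 : t ^+ 2 <= 4 * k ^+ 2 * x ^+ 3.
  apply: (@le_trans _ _ ((2 * k * x ^+ 2) ^+ 2)); first by rewrite lerXn2r ?nnegrE// !mulr_ge0 ?sqr_ge0.
  rewrite (_ : (2 * k * x ^+ 2) ^+ 2 = 4 * k ^+ 2 * (x ^+ 3 * x)); last by ring.
  by rewrite ler_wpM2l ?mulr_ge0 ?sqr_ge0// ler_piMr// exprn_ge0.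
have qc0 : 0 <= quad_const a k.
  by rewrite /quad_const addr_ge0// addr_ge0// mulr_ge0 ?expR_ge0// mulr_ge0 ?sqr_ge0.
have M4 := le_trans M3 (ler_wpM2l qc0 t2).
(* The moments match: they reproduce the time derivative of [heat]. *)
have E1 : 1 + Ex Y + Ex (fun w => Y w ^+ 2 / 2) = 1 + (c - a) * t + Rm.
  by rewrite EY EY2 /c /t /a; field.
rewrite E1 in M1.
set F := expR (- a * _ - _) in M4 *.
have -> : expR (- c) * Ex (fun w => expR (Y w)) - F =
  expR (- c) * (Ex (fun w => expR (Y w)) - (1 + (c - a) * t + Rm)) + expR (- c) * Rm
   - (F - expR (- c) * (1 + (c - a) * t)) by ring.
apply: (le_trans (ler_normB _ _)); apply: (le_trans (lerD (ler_normD _ _) (lexx _))).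
rewrite !normrM (ger0_norm (expR_ge0 (- c))).
apply: (le_trans (lerD (lerD M1 M2) M4)).
by rewrite /heat_const -/a -/B le_eqVlt; apply/orP; left; apply/eqP; ring.
Qed.

End HeatStep.

(** * Laplace transform of the quadratic statistic *)

Section QuadStatLaplace.
Variables (R : realType) (n K : nat) (beta : 'I_n -> R) (G : {set 'I_n}) (g : 'I_n).
Hypotheses (gG : g \in G) (flat_beta : flat G beta).
Local Notation A := (block_info K G g beta).
Hypothesis A_gt0 : 0 < A.
Implicit Types (w : outcome n K) (js : seq 'I_n).
Local Notation Ex := (expect (@bt_coord R n K beta)).

Let ge0 := @bt_coord_ge0 R n K beta.
Let sum1 := @bt_coord_sum1 R n K beta.
Let Ex_le := expect_le ge0.
Let Ex_cst := expect_cst sum1.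

Lemma eq_cssq (z z' : 'I_n -> R) : (forall i, i \in G -> z i = z' i) -> cssq G z = cssq G z'.
Proof.
move=> zz; have E : mean G z = mean G z' by rewrite /mean (eq_bigr z').
by rewrite /cssq E; apply: eq_bigr => i iG; rewrite zz.
Qed.

Let a : R := Num.sqrt A.
Let a_gt0 : 0 < a. Proof. by rewrite sqrtr_gt0. Qed.
Let aa : a ^+ 2 = A. Proof. by rewrite sqr_sqrtr// ltW. Qed.
Let x : R := K%:R / a.
Hypothesis x_le1 : K%:R / Num.sqrt A <= 1.

Let G_gt0 : (0 < #|G|)%N. Proof. by apply/card_gt0P; exists g. Qed.

(** Counts the games inside the block and those against [js]; games against the other outside
    subjects have been traded for heat time. Dividing by [a] makes the total heat time 1. *)
Definition partial_score js w i : R :=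
  (\sum_(j in G | j != i) bt_dev beta w i j + \sum_(j <- js) bt_dev beta w i j) / a.

Definition step_var j : R := K%:R * dsigm (beta g - beta j) / A.

Let C k : R := heat_const G k * x ^+ 3.

Let step k tau j z : j \notin G -> 0 <= k -> 0 <= tau ->
  `|Ex (fun w => heat G k tau (cssq G (fun i => z i + bt_dev beta w i j / a)))
     - heat G k (tau + step_var j) (cssq G z)| <= C k.
Proof.
move=> jG k0 tau0.
have ij i : i \in G -> i != j by move=> iG; apply: contraNneq jG => <-.
apply: (heat_step ge0 sum1 G_gt0) => //.
- move=> i iG; under eq_expect => w do rewrite mulrC.
  by rewrite expectZ expect_bt_dev0 ?mulr0// ij.
- move=> i iG; under eq_expect => w do rewrite exprMn mulrC.
  by rewrite expectZ expect_bt_dev_sqr ?ij// exprVn aa (flat_beta iG gG) mulrC.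
- move=> i l iG lG il.
  rewrite (@eq_expect _ _ _ _ _ (fun w => a^-2 * (bt_dev beta w i j * bt_dev beta w l j))).
    rewrite expectZ expect_bt_dev_mul ?mulr0 ?ij//.
    apply: contraNneq il => /edge_inj[[-> _]//|[E _]].
    by move: (ij _ iG); rewrite E eqxx.
  by move=> w; rewrite expr2 invfM; ring.
- move=> w i iG; rewrite normrM normfV (gtr0_norm a_gt0) ler_wpM2r ?invr_ge0 ?(ltW a_gt0)//.
  exact: bt_dev_abs (ij _ iG).
- by rewrite x_le1 divr_ge0// ltW.
Qed.

Let step_var_ge0 j : 0 <= step_var j.
Proof.
apply: divr_ge0; last exact: ltW.
by apply: mulr_ge0 => //; exact/ltW/dsigm_gt0.
Qed.

(** The games of the block against one outside subject form uncorrelated increments of equal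
    variance, as [beta] is constant on the block; hence the replacement subject by subject. *)
Let telescope k js tau : 0 <= k -> 0 <= tau -> uniq js -> (forall j, j \in js -> j \notin G) ->
  `|Ex (fun w => heat G k tau (cssq G (partial_score js w)))
    - Ex (fun w => heat G k (tau + \sum_(j <- js) step_var j) (cssq G (partial_score [::] w)))|
   <= (size js)%:R * C k.
Proof.
move=> k0; elim: js tau => [|j js IH] tau tau0 /=.
  by rewrite big_nil addr0 subrr normr0 mul0r.
move=> /andP[jjs ujs] jsG.
have jG : j \notin G by apply: jsG; rewrite mem_head.
have jsG' l : l \in js -> l \notin G by move=> ls; apply: jsG; rewrite inE ls orbT.
(* The edges between the block and [j]. Resampling them isolates one increment, so that [heat_step]
   applies with all other games frozen. *)
pose B : {set 'I_n * 'I_n} := [set edge i j | i in G]%SET.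
have ij i : i \in G -> i != j by move=> iG; apply: contraNneq jG => <-.
have M w w' i : i \in G -> partial_score (j :: js) (mix B w w') i =
   partial_score js w i + bt_dev beta w' i j / a.
  move=> iG; rewrite /partial_score big_cons addrCA [_ + (_ + _)]addrC mulrDl; congr (_ / a + _ / a).
    have H l : l != i -> (l \in G) || (l \in js) -> bt_dev beta (mix B w w') i l = bt_dev beta w i l.
      move=> li lGj; apply: bt_dev_edge; first by rewrite eq_sym.
      rewrite ffunE; case: ifP => // /imsetP[i' i'G] /edge_inj[[_ E]|[E _]].
        by move: lGj; rewrite E (negbTE jG) (negbTE jjs).
      by move: (ij _ iG); rewrite E eqxx.
    congr (_ + _).
      by apply: eq_bigr => l /andP[lG li]; apply: H; rewrite ?lG.
    rewrite !big_seq; apply: eq_bigr => l ls; apply: H; rewrite ?ls ?orbT//.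
    by apply: contraTneq iG => <-; exact: jsG'.
  apply: bt_dev_edge; first exact: ij.
  by rewrite ffunE ifT//; apply/imsetP; exists i.
rewrite (expect_mix sum1 B) big_cons.
under eq_expect => w do under eq_expect => w' do
  rewrite (eq_cssq (M w w')).
set F := Ex _; set F2 := Ex _.
have H1 : `|F - Ex (fun w => heat G k (tau + step_var j) (cssq G (partial_score js w)))| <= C k.
  rewrite /F -expectB; apply: (le_trans (expect_abs_le ge0 _)).
  by rewrite -[leRHS]Ex_cst; apply: Ex_le => w; exact: step.
have := IH (tau + step_var j) (addr_ge0 tau0 (step_var_ge0 j)) ujs jsG'.
rewrite -addrA -/F2 => H2.
rewrite (le_trans (ler_distD (Ex (fun w => heat G k (tau + step_var j) (cssq G (partial_score js w)))) _ _))//.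
by rewrite -natr1 mulrDl mul1r addrC lerD.
Qed.

Let m : R := #|G|%:R.
Let m1 : 1 <= m. Proof. by rewrite ler1n. Qed.

Lemma cssq_score w : cssq G (fun i => bt_score beta w i / a) =
  \sum_(i in G) block_dev G beta w i ^+ 2 / A.
Proof.
rewrite /cssq; apply: eq_bigr => i iG; rewrite /mean -mulr_suml /block_dev -aa -exprVn -exprMn.
by congr (_ ^+ 2); rewrite mulrBl mulrAC.
Qed.

Lemma quad_stat_laplace k : 0 <= k ->
  `|Ex (fun w => expR (- k * \sum_(i in G) block_dev G beta w i ^+ 2 / A))
     - expR (- ((m - 1) / 2) * ln (1 + 2 * k))|
   <= n%:R * (heat_const G k * (K%:R / Num.sqrt A) ^+ 3) + k * (m ^+ 3 * (K%:R / Num.sqrt A) ^+ 2).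
Proof.
move=> k0; pose js := [seq j <- enum 'I_n | j \notin G].
have ujs : uniq js by rewrite filter_uniq ?enum_uniq.
have jsG j : j \in js -> j \notin G by rewrite mem_filter => /andP[].
have SV : \sum_(j <- js) step_var j = 1.
  rewrite big_filter big_enum_cond/= /step_var -mulr_suml -mulr_sumr.
  by rewrite -[X in X / _]/A divff// gt_eqF.
have T := telescope k0 (lexx 0) ujs jsG.
rewrite SV add0r in T.
have E1 : Ex (fun w => heat G k 0 (cssq G (partial_score js w))) =
   Ex (fun w => expR (- k * \sum_(i in G) block_dev G beta w i ^+ 2 / A)).
  apply: eq_expect => w; rewrite /heat mulr0 addr0 ln1 mulr0 sub0r divr1 -mulNr -cssq_score.
  congr (expR (_ * _)); apply: eq_cssq => i iG; rewrite /partial_score; congr (_ / a).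
  rewrite big_filter big_enum_cond/= /bt_score [RHS](bigID (mem G))/=; congr (_ + _).
    by apply: eq_bigl => j; rewrite andbC.
  by apply: eq_bigl => j; rewrite andbC; case: (boolP (j \in G)) => //= jG; apply/esym; apply: contraNneq jG => ->.
have T' : `|Ex (fun w => expR (- k * \sum_(i in G) block_dev G beta w i ^+ 2 / A)) -
    Ex (fun w => heat G k 1 (cssq G (partial_score [::] w)))| <= n%:R * C k.
  rewrite -E1; apply: (le_trans T); apply: ler_wpM2r.
    rewrite mulr_ge0 ?heat_const_ge0// exprn_ge0// divr_ge0// ltW//.
  by rewrite ler_nat size_filter -[leqRHS](size_enum_ord n) count_size.
(* What remains are the games inside the block. They are not replaced: with at most [m] of them per
   member, each of size at most [x], they hardly perturb [heat] at time 1. *)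
have B0 w : 0 <= expR (- ((m - 1) / 2) * ln (1 + 2 * k)) - heat G k 1 (cssq G (partial_score [::] w))
    <= k * (m ^+ 3 * x ^+ 2).
  set q := cssq _ _; have q0 : 0 <= q by exact: cssq_ge0.
  have q1 : q <= m * (m * x) ^+ 2.
    apply: cssq_le => // i iG; rewrite /partial_score big_nil addr0 normrM normfV (gtr0_norm a_gt0).
    rewrite /x mulrA ler_wpM2r ?invr_ge0 ?(ltW a_gt0)//.
    rewrite (le_trans (ler_norm_sum _ _ _))// -sum_set_const big_mkcondr; apply: ler_sum => j jG.
    by case: ifP => // ji; apply: bt_dev_abs; rewrite eq_sym.
  rewrite /heat mulr1 -/m expRD; set P := expR (_ * _).
  have P1 : 0 <= P <= 1.
    rewrite expR_ge0 -(expR0 R) ler_expR mulNr oppr_le0 mulr_ge0//.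
      by rewrite divr_ge0// subr_ge0.
    by rewrite ln_ge0//; lra.
  have k1 : 0 <= k * q / (1 + 2 * k) <= k * q.
    rewrite divr_ge0 ?mulr_ge0//; last by lra.
    by rewrite ler_pdivrMr ?ler_peMr ?mulr_ge0//; lra.
  have e1 := expR_ge1Dx (- (k * q / (1 + 2 * k))).
  have e2 : expR (- (k * q / (1 + 2 * k))) <= 1.
    by rewrite expR_le1 oppr_le0; case/andP: k1.
  have : k * q <= k * (m ^+ 3 * x ^+ 2).
    by rewrite ler_wpM2l// (le_trans q1)// le_eqVlt; apply/orP; left; apply/eqP; ring.
  case/andP: P1 k1 => P0 P1 /andP[k1 k2]; move: (expR _) e1 e2 => e e1 e2 kq; nra.
have D0 : `|Ex (fun w => heat G k 1 (cssq G (partial_score [::] w))) -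
    expR (- ((m - 1) / 2) * ln (1 + 2 * k))| <= k * (m ^+ 3 * x ^+ 2).
  rewrite distrC -[X in `|X - _|]Ex_cst -expectB; apply: (le_trans (expect_abs_le ge0 _)).
  rewrite -[leRHS]Ex_cst; apply: Ex_le => w.
  by have /andP[h1 h2] := B0 w; rewrite ger0_norm.
rewrite (le_trans (ler_distD (Ex (fun w => heat G k 1 (cssq G (partial_score [::] w)))) _ _))//.
exact: lerD.
Qed.

End QuadStatLaplace.

(** * Polynomial approximation of indicators *)

Section BernsteinStep.
Variable R : realType.
Implicit Types (y th ga eps : R).

(* The Bernstein polynomial of the indicator of [th, 1]. *)
Definition bernstein_step (N : nat) th : {poly R} :=
  \sum_(a < N.+1 | th * N%:R <= a%:R) 'C(N, a)%:R *: ('X^a * (1 - 'X) ^+ (N - a)).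

Lemma horner_bernstein_step N th y :
  (bernstein_step N th).[y] = \sum_(a < N.+1 | th * N%:R <= a%:R) binw N y a.
Proof.
rewrite horner_sum; apply: eq_bigr => a _.
by rewrite hornerZ hornerM !horner_exp hornerD hornerN hornerX hornerC /binw mulrA.
Qed.

Lemma binw_tail N y ga (P : pred 'I_N.+1) : 0 <= y <= 1 -> 0 < ga -> (0 < N)%N ->
  (forall a, P a -> ga ^+ 2 <= ((a : nat)%:R / N%:R - y) ^+ 2) ->
  \sum_(a < N.+1 | P a) binw N y a <= (4 * N%:R * ga ^+ 2)^-1.
Proof.
move=> y01 ga0 N0 HP; have Np : 0 < N%:R :> R by rewrite ltr0n.
have g2 : 0 < ga ^+ 2 by rewrite exprn_gt0.
apply: (@le_trans _ _ (\sum_(a < N.+1) binw N y a * ((a%:R - N%:R * y) ^+ 2 / (N%:R * ga) ^+ 2))).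
  rewrite [leRHS](bigID P)/= -[leLHS]addr0; apply: lerD; last first.
    by rewrite sumr_ge0// => a _; rewrite mulr_ge0 ?binw_ge0// divr_ge0 ?sqr_ge0.
  apply: ler_sum => a Pa; rewrite ler_peMr ?binw_ge0//.
  rewrite -expr_div_n (_ : (a%:R - N%:R * y) / (N%:R * ga) = (a%:R / N%:R - y) / ga); last first.
    by field; rewrite !gt_eqF.
  by rewrite expr_div_n ler_pdivlMr// mul1r HP.
under eq_bigr do rewrite mulrA.
rewrite -mulr_suml binw_var exprMn.
have yy : y * (1 - y) <= 4^-1 by have := sqr_ge0 (y - 2^-1); rewrite expr2; lra.
rewrite ler_pdivrMr ?mulr_gt0 ?exprn_gt0//.
apply: (@le_trans _ _ (N%:R * 4^-1)); first by rewrite ler_pM2l.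
by rewrite le_eqVlt; apply/orP; left; apply/eqP; field; rewrite !gt_eqF.
Qed.

Lemma bernstein_stepP th ga eps : 0 < ga -> 0 < eps -> exists N, forall y, 0 <= y <= 1 ->
  [/\ 0 <= (bernstein_step N th).[y] <= 1,
      th + ga <= y -> 1 - eps <= (bernstein_step N th).[y] &
      y <= th - ga -> (bernstein_step N th).[y] <= eps].
Proof.
move=> ga0 eps0; pose N := (Num.truncn (4 * eps * ga ^+ 2)^-1).+1; exists N => y y01.
have g2 : 0 < ga ^+ 2 by rewrite exprn_gt0.
have N0 : (0 < N)%N by [].
have Np : 0 < N%:R :> R by rewrite ltr0n.
have Ne : (4 * N%:R * ga ^+ 2)^-1 <= eps.
  have h : (4 * eps * ga ^+ 2)^-1 < N%:R.
    by rewrite /N; apply: truncnS_gt.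
  rewrite invf_ple ?posrE ?mulr_gt0//.
  move: h; rewrite -[ltLHS]div1r ltr_pdivrMr ?mulr_gt0// => h.
  rewrite -[leLHS]div1r ler_pdivrMr// (le_trans (ltW h))// le_eqVlt; apply/orP; left; apply/eqP; ring.
rewrite !horner_bernstein_step.
have S1 := sum_binw N y; rewrite (bigID (fun a : 'I_N.+1 => th * N%:R <= a%:R))/= in S1.
have P0 (P : pred 'I_N.+1) : 0 <= \sum_(a < N.+1 | P a) binw N y a.
  by rewrite sumr_ge0// => a _; exact: binw_ge0.
have := P0 (fun a : 'I_N.+1 => th * N%:R <= a%:R); have := P0 (fun a : 'I_N.+1 => ~~ (th * N%:R <= a%:R)).
move=> p1 p2; split; first by rewrite p2 /=; lra.
- move=> thy; suff : \sum_(i < N.+1 | ~~ (th * N%:R <= i%:R)) binw N y i <= eps by lra.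
  apply: le_trans Ne; apply: binw_tail => // a; rewrite -ltNge -ltr_pdivrMr// => h.
  rewrite -[leRHS]sqrrN opprB lerXn2r ?nnegrE ?(ltW ga0)//; lra.
- move=> thy; apply: le_trans Ne; apply: binw_tail => // a; rewrite -ler_pdivlMr// => h.
  rewrite lerXn2r ?nnegrE ?(ltW ga0)//; lra.
Qed.

(** In the variable [expR (- q)] the gap from [s] to [t] becomes the one from [expR (- t)] to
    [expR (- s)]; its midpoint is the Bernstein threshold and half its width the margin. *)
Lemma poly_step (s t eps : R) : s < t -> 0 < eps -> exists p : {poly R}, forall q : R, 0 <= q ->
  (q <= s)%R%:R - eps <= p.[expR (- q)] <= (q <= t)%R%:R + eps.
Proof.
move=> st eps0; set u := expR (- s); set v := expR (- t).
have uv : v < u by rewrite ltr_expR ltrN2.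
have ga0 : 0 < (u - v) / 2 by lra.
have [N HN] := bernstein_stepP ((u + v) / 2) ga0 eps0.
exists (bernstein_step N ((u + v) / 2)) => q q0.
have y01 : 0 <= expR (- q) <= 1 by rewrite expR_ge0 expR_le1 oppr_le0.
have [/andP[b0 b1] h1 h2] := HN _ y01.
apply/andP; split.
  case: (leP q s) => [qs|_] /=; last by lra.
  by apply: h1; rewrite (_ : _ + _ = u) ?ler_expR ?lerN2//; field.
case: (leP q t) => [_|qt] /=; first by lra.
by rewrite add0r; apply: h2; rewrite (_ : _ - _ = v) ?ler_expR ?lerN2 ?ltW//; field.
Qed.

End BernsteinStep.

(** * The chi-square density: Laplace transform and total mass *)

Section ChiSquare.
Variable R : realType.
Local Notation mu := (@lebesgue_measure R).
Local Notation half := (`[0%R, +oo[%classic : set R).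
Implicit Types (f : R -> R) (c : R).

(** The dilated, rescaled Lebesgue measure agrees with Lebesgue measure on half-open intervals,
    hence on all measurable sets. *)
Lemma ge0_integral_scale c (f : R -> \bar R) : 0 < c -> measurable_fun half f ->
  (forall t, half t -> (0 <= f t)%E) ->
  (\int[mu]_(t in half) f t = c%:E * \int[mu]_(t in half) f (c * t)%R)%E.
Proof.
move=> c0 mf f0.
pose phi : measurableTypeR R -> measurableTypeR R := *%R c.
have mphi : measurable_fun setT phi by exact: mulrl_measurable.
pose push0 : {measure set (measurableTypeR R) -> \bar R} := pushforward mu phi.
pose push := push0 mphi.
pose nu : {measure set (measurableTypeR R) -> \bar R} := mscale (NngNum (ltW c0)) push.
have H : forall X, ocitv X -> mu X = nu X.
  move=> X [[a b] /= ab <-]; rewrite /nu /= /mscale /= /push /push0 /= /pushforward.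
  have -> : phi @^-1` `]a, b]%classic = `]a / c, b / c]%classic.
    by apply/seteqP; split=> y /=; rewrite !in_itv /= ltr_pdivrMr// ler_pdivlMr// mulrC.
  rewrite !lebesgue_measure_itv /= !lte_fin ltr_pM2r ?invr_gt0//.
  case: ifP => _; last by rewrite mule0.
  by rewrite -!EFinD -EFinM; congr EFin; field; rewrite gt_eqF.
rewrite (eq_measure_integral nu); last by move=> A mA _; exact: lebesgue_measure_unique H A mA.
rewrite ge0_integral_mscale//=; congr (_ * _)%E.
rewrite ge0_integral_pushforward//; last by move=> y /set_mem/f0.
have -> // : phi @^-1` half = half.
by apply/seteqP; split=> y /=; rewrite !in_itv /= !andbT pmulr_rge0.
Qed.

Variable k : nat.
Hypothesis k_gt0 : (0 < k)%N.
Local Notation f := (@chi2_dens_unnorm R k).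

Lemma chi2_dens_ge0 t : 0 <= f t.
Proof. by rewrite mulr_ge0 ?powR_ge0 ?expR_ge0. Qed.

Lemma measurable_chi2_dens (D : set R) : measurable_fun D f.
Proof.
apply: measurable_funTS; apply: measurable_funM; first exact: measurable_powR.
by apply: measurableT_comp; [exact: measurable_expR|apply: measurable_funM].
Qed.

Definition chi2_mass : \bar R := (\int[mu]_(t in half) (f t)%:E)%E.

(** Dilation by [c = 1 + 2 * j] turns [expR (- t / 2)] into [expR (- t * j) * expR (- t / 2)]; the
    power of [c] comes from the power of [t] and the Jacobian. *)
Lemma chi2_laplace (j : nat) :
  (\int[mu]_(t in half) (expR (- t * j%:R) * f t)%:E =
   (expR (- (k%:R / 2) * ln (1 + 2 * j%:R)))%:E * chi2_mass)%E.
Proof.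
set c : R := 1 + 2 * j%:R.
have c0 : 0 < c by rewrite ltr_wpDr// mulr_ge0.
have mf : measurable_fun half (EFin \o f) by apply/measurable_EFinP; exact: measurable_chi2_dens.
have mg : measurable_fun half (fun t => expR (- t * j%:R) * f t).
  apply: measurable_funM; last exact: measurable_chi2_dens.
  apply: measurable_funTS; apply: measurableT_comp; first exact: measurable_expR.
  by apply: measurable_funM.
rewrite /chi2_mass (ge0_integral_scale c0 mf); last by move=> t _; rewrite lee_fin chi2_dens_ge0.
have E t : half t -> f (c * t) = powR c (k%:R / 2 - 1) * (expR (- t * j%:R) * f t).
  rewrite /= in_itv /= andbT => t0.
  rewrite /chi2_dens_unnorm powRM ?(ltW c0)// -mulrA; congr (_ * _); rewrite mulrCA -expRD.
  by congr (_ * expR _); rewrite /c; field.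
rewrite [X in (_ * (_ * X))%E](_ : _ = ((powR c (k%:R / 2 - 1))%:E *
    \int[mu]_(t in half) (expR (- t * j%:R) * f t)%:E)%E); last first.
  rewrite -ge0_integralZl//; last first.
  - by rewrite lee_fin powR_ge0.
  - by move=> t _; rewrite lee_fin mulr_ge0 ?expR_ge0 ?chi2_dens_ge0.
  - by apply/measurable_EFinP.
  by apply: eq_integral => t /set_mem /E /= ->.
rewrite !muleA -!EFinM -[LHS]mul1e; congr (_%:E * _)%E.
rewrite /powR gt_eqF// -{2}(lnK (c0 : c \in Num.pos)) -!expRD.
by rewrite [X in expR X](_ : _ = 0) ?expR0//; field.
Qed.

(** A majorant with the bounded antiderivative [H]: of order -1/2 at 0, the singularity of the
    density for [k = 1], and of order -3/2 at infinity. *)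
Let h (t : R) : R := powR t (- 2^-1) / 2 / (1 + powR t (2^-1)) ^+ 2.
Let H (t : R) : R := - (1 + powR t (2^-1))^-1.

Let dH (t : R) : 0 < t -> is_derive t 1 H (h t).
Proof.
move=> t0; have d1 := is_derive1_powR (2^-1) t0.
have p0 : (cst (1 : R) + (@powR R) ^~ (2^-1)) t != 0 :> R.
  by rewrite gt_eqF// -[ltRHS]/(1 + powR t 2^-1) ltr_wpDr ?powR_ge0.
have d2 := is_deriveD (is_derive_cst (1:R) t (1:R)) d1.
have d3 := is_deriveN (is_deriveV p0 d2).
apply: (is_derive_eq d3).
rewrite add0r /h -[_ *: _]/(_ * _) mulNr opprK.
rewrite -[X in X ^- 2]/(1 + powR t 2^-1) (_ : 2^-1 - 1 = - 2^-1 :> R); last by lra.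
by rewrite mulrC; congr (_ / _); rewrite mulrC.
Qed.

Let h_ge0 (t : R) : 0 <= h t.
Proof. by rewrite !mulr_ge0 ?invr_ge0 ?exprn_ge0 ?addr_ge0 ?powR_ge0. Qed.

Let hE : h = (fun t => powR t (- 2^-1) * 2^-1 * powR (1 + powR t 2^-1) (- 2%:R)).
Proof. by apply/funext => t; rewrite /h powR_invn// addr_ge0// powR_ge0. Qed.

Let mh (D : set R) : measurable_fun D h.
Proof.
rewrite hE.
apply: measurable_funTS; apply: measurable_funM.
  by apply: measurable_funM => //; exact: measurable_powR.
have mg : measurable_fun setT (fun t : R => 1 + powR t 2^-1).
  by apply: measurable_funD => //; exact: measurable_powR.
exact: (measurableT_comp (measurable_powR (- 2%:R)) mg).
Qed.

(** Compact intervals exhausting the open half-line; the right end [n.+2] keeps the first one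
    nondegenerate. *)
Let int_h_itv (n : nat) : (\int[mu]_(t in `[(n.+1%:R)^-1%R, n.+2%:R]) (h t)%:E <= 1)%E.
Proof.
set a : R := n.+1%:R^-1; set b : R := n.+2%:R.
have a0 : 0 < a by rewrite invr_gt0.
have ab : a < b.
  by rewrite (@le_lt_trans _ _ 1)// ?ltr1n// invf_le1// ler1n.
have cH t : 0 < t -> {for t, continuous H}.
  by move=> t0; apply: differentiable_continuous; apply/derivable1_diffP; case: (dH t0).
have tp t : t \in `[a, b] -> 0 < t by rewrite in_itv /= => /andP[/(lt_le_trans a0)].
have ch : {within `[a, b], continuous h}.
  rewrite hE; apply: derivable_within_continuous => t /tp t0.
  have p0 : 0 < 1 + powR t 2^-1 by rewrite ltr_wpDr ?powR_ge0.
  have d2 := is_deriveD (is_derive_cst (1:R) t (1:R)) (is_derive1_powR 2^-1 t0).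
  have d3 : is_derive ((cst (1 : R) + (@powR R) ^~ (2^-1)) t) 1 (@powR R ^~ (- 2%:R)) _ :=
    is_derive1_powR (- 2%:R) p0.
  have d4 := is_deriveM (is_deriveM (is_derive1_powR (- 2^-1) t0) (is_derive_cst (2^-1 : R) t (1:R)))
    (is_derive1_comp d3 d2).
  by case: d4.
have cH' : derivable_oo_LRcontinuous H a b.
  split.
  - by move=> t; rewrite in_itv /= => /andP[at_ _]; case: (dH (lt_trans a0 at_)).
  - by apply: cvg_at_right_filter; exact: cH.
  - by apply: cvg_at_left_filter; apply: cH; exact: lt_trans ab.
have dE : {in `]a, b[, (H^`())%classic =1 h}.
  move=> t; rewrite in_itv /= => /andP[at_ _].
  by rewrite derive1E (@derive_val _ _ _ _ _ _ _ (dH (lt_trans a0 at_))).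
rewrite (continuous_FTC2 ab ch cH' dE) -EFinB lee_fin /H opprK.
have : 0 <= (1 + b `^ 2^-1)^-1 by rewrite invr_ge0 addr_ge0 ?powR_ge0.
have : (1 + a `^ 2^-1)^-1 <= 1 by rewrite invf_le1 ?ltr_wpDr ?powR_ge0// lerDl powR_ge0.
lra.
Qed.

Let int_h : (\int[mu]_(t in `]0%R, +oo[) (h t)%:E <= 1)%E.
Proof.
pose F (n : nat) : set (measurableTypeR R) := `[(n.+1%:R)^-1, n.+2%:R]%classic.
have -> : `]0%R, +oo[%classic = \bigcup_n F n.
  apply/seteqP; split=> [t|t [n _]] /=; rewrite !in_itv /=; last first.
    by rewrite /F /= in_itv /= => /andP[h1 _]; rewrite andbT (lt_le_trans _ h1)// invr_gt0.
  rewrite andbT => t0; exists (maxn (Num.truncn t) (Num.truncn t^-1)) => //.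
  rewrite /F /= in_itv /=; apply/andP; split.
    rewrite invf_ple ?posrE//; apply/ltW/(lt_le_trans (truncnS_gt _)).
    by rewrite ler_nat ltnS leq_maxr.
  apply/ltW/(lt_le_trans (truncnS_gt _)).
  by rewrite ler_nat ltnS (leq_trans (leq_maxl _ (Num.truncn t^-1))).
have mF i : measurable (F i) by exact: measurable_itv.
have nF : nondecreasing_seq F.
  move=> i j ij; apply/subsetPset => t; rewrite /F /= !in_itv /= => /andP[h1 h2].
  apply/andP; split.
    by rewrite (le_trans _ h1)// lef_pV2 ?posrE// ler_nat ltnS.
  by rewrite (le_trans h2)// ler_nat !ltnS.
have mhF i : measurable_fun (F i) (EFin \o h) by apply/measurable_EFinP; exact: mh.
have cv := @ge0_nondecreasing_set_cvg_integral _ _ _ F (EFin \o h) mu nF mF mhF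
  (fun i x _ => h_ge0 x).
rewrite -(cvg_lim _ cv)//; apply: lime_le; first by apply/cvg_ex; eexists; exact: cv.
by apply: nearW => i; exact: int_h_itv.
Qed.

Let fh : exists2 M : R, 0 <= M & forall t, 0 < t -> f t <= M * h t.
Proof.
(* 2 cancels the 1/2 in [h]; the factorial bounds [(1 + s) ^+ k.+1] by [expR (1 + s)];
   [expR (3 / 2)] comes from [1 + s <= 3 / 2 + t / 2], where [s ^+ 2 = t]. *)
pose M : R := 2 * (k.+1)`!%:R * expR (3 / 2); exists M.
  by rewrite !mulr_ge0 ?expR_ge0.
move=> t t0; set s := powR t 2^-1.
have s0 : 0 < s by rewrite powR_gt0.
have ss : s ^+ 2 = t.
  by rewrite -powR_mulrn ?ltW// -powRrM mulVf// powRr1// ltW.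
have -> : f t = powR t (- 2^-1) * (s ^+ k.-1 * expR (- t / 2)).
  rewrite /chi2_dens_unnorm mulrA; congr (_ * _).
  rewrite -powR_mulrn ?ltW// -powRrM -powRD; last by apply/implyP => _; rewrite gt_eqF.
  congr (powR _ _); have : k%:R = k.-1%:R + 1 :> R by rewrite natr1 prednK.
  by move=> ->; field.
rewrite /h -/s.
have -> : M * (t `^ (- 2^-1) / 2 / (1 + s) ^+ 2) = t `^ (- 2^-1) * (M / (2 * (1 + s) ^+ 2)).
  by field; rewrite gt_eqF// addr_gt0.
apply: ler_wpM2l; first exact: powR_ge0.
have p0 : 0 < 2 * (1 + s) ^+ 2 by rewrite mulr_gt0// exprn_gt0// addr_gt0.
rewrite ler_pdivlMr//.
have e0 := expR_gt0 (- t / 2).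
have H1 : s ^+ k.-1 * (1 + s) ^+ 2 <= (1 + s) ^+ k.+1.
  have -> : (1 + s) ^+ k.+1 = (1 + s) ^+ k.-1 * (1 + s) ^+ 2.
    by rewrite -exprD; congr (_ ^+ _); rewrite addn2 prednK.
  apply: ler_wpM2r; first exact: sqr_ge0.
  by rewrite lerXn2r ?nnegrE ?addr_ge0 ?ltW// ltr_pwDl.
have H2 : (1 + s) ^+ k.+1 <= k.+1`!%:R * expR (1 + s).
  have s1 : 0 <= 1 + s by rewrite addr_ge0 ?ltW.
  have := @expR_ge1Dxn R (1 + s) k s1.
  rewrite -ler_pdivrMl ?ltr0n ?fact_gt0// mulrC; lra.
have H3 : expR (1 + s) <= expR (3 / 2) * expR (t / 2).
  rewrite -expRD ler_expR -ss; have := sqr_ge0 (s - 1); rewrite !expr2; lra.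
apply: (@le_trans _ _ (2 * (k.+1`!%:R * (expR (3 / 2) * expR (t / 2))) * expR (- t / 2))).
  rewrite [leLHS](_ : _ = 2 * (s ^+ k.-1 * (1 + s) ^+ 2) * expR (- t / 2)); last first.
    by move: (s ^+ k.-1) => u; ring.
  rewrite ler_pM2r// ler_pM2l// (le_trans H1)// (le_trans H2)// ler_wpM2l//.
rewrite le_eqVlt; apply/orP; left; apply/eqP.
have := expRxMexpNx_1 (t / 2); rewrite -mulNr /M; move: (expR (t / 2)) (expR (- t / 2)) => u v uv.
by transitivity (2 * k.+1`!%:R * expR (3 / 2) * (u * v)); [ring|rewrite uv mulr1].
Qed.

Lemma chi2_mass_lty : (chi2_mass < +oo)%E.
Proof.
have [M M0 HM] := fh.
have mf0 : measurable_fun (`]0%R, +oo[%classic : set R) (EFin \o f).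
  by apply/measurable_EFinP; exact: measurable_chi2_dens.
rewrite /chi2_mass -integral_itv_obnd_cbnd//.
apply: (@le_lt_trans _ _ (\int[mu]_(t in `]0%R, +oo[) (M%:E * (h t)%:E))%E).
  apply: ge0_le_integral => //.
  - by move=> t _; rewrite lee_fin chi2_dens_ge0.
  - apply/measurable_EFinP; apply: measurable_funM => //; exact: mh.
  - by move=> t; rewrite /= in_itv /= andbT => t0; rewrite lee_fin HM.
rewrite ge0_integralZl//; last 2 first.
- by apply/measurable_EFinP; exact: mh.
- by move=> t _; rewrite lee_fin h_ge0.
by apply: (@le_lt_trans _ _ (M%:E * 1)%E); rewrite ?lee_wpmul2l ?mule1 ?ltry.
Qed.

Lemma chi2_mass_gt0 : (0 < chi2_mass)%E.
Proof.
(* The exponent [k / 2 - 1] is negative for [k = 1], so the power is smallest at 1 or at 2 according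
   to [k]. *)
pose c : R := Num.min 1 (powR 2 (k%:R / 2 - 1)) * expR (- 1).
have c0 : 0 < c by rewrite mulr_gt0 ?expR_gt0// lt_min ltr01 powR_gt0.
have cf t : t \in `[1, 2]%R -> c <= f t.
  rewrite in_itv /= => /andP[t1 t2].
  have t0 : 0 < t by lra.
  apply: ler_pM; rewrite ?expR_ge0 ?ler_expR//; last by lra.
  rewrite ge_min; have [a0|/ltW a0] := leP 0 (k%:R / 2 - 1 : R).
    by apply/orP; left; rewrite /powR gt_eqF// leNgt expR_lt1 -leNgt mulr_ge0 ?ln_ge0.
  apply/orP; right; rewrite /powR !gt_eqF// ler_expR ler_wnM2l// ler_ln ?posrE//.
have mf : measurable_fun half (EFin \o f).
  by apply/measurable_EFinP; exact: measurable_chi2_dens.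
apply: (@lt_le_trans _ _ (\int[mu]_(t in `[1%R, 2%R]) (c%:E))%E).
  rewrite integral_cst//= lebesgue_measure_itv /= lte_fin ltr1n /=.
  by rewrite -EFinB -EFinM lte_fin mulr_gt0//; lra.
apply: (@le_trans _ _ (\int[mu]_(t in `[1%R, 2%R]) (f t)%:E)%E).
  apply: ge0_le_integral => //.
  - by move=> t _; rewrite lee_fin ltW.
  - by apply/measurable_EFinP; exact: measurable_chi2_dens.
apply: ge0_subset_integral => //.
  by move=> t _; rewrite lee_fin chi2_dens_ge0.
by move=> t /=; rewrite !in_itv /= andbT => /andP[]; lra.
Qed.

End ChiSquare.

(** * The chi-square distribution function *)

Section ChiSquareCdf.
Variables (R : realType) (k : nat).
Hypothesis k_gt0 : (0 < k)%N.
Local Notation mu := (@lebesgue_measure R).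
Local Notation half := (`[0%R, +oo[%classic : set R).
Local Notation f := (@chi2_dens_unnorm R k).

Let mhalf : measurable half. Proof. exact: measurable_itv. Qed.

Let D0 : R := fine (chi2_mass R k).

Let massE : chi2_mass R k = D0%:E.
Proof.
by rewrite fineK// ge0_fin_numE ?chi2_mass_lty// ltW// chi2_mass_gt0.
Qed.

Let D0_gt0 : 0 < D0.
Proof. by rewrite -lte_fin -massE chi2_mass_gt0. Qed.

Let int_f : mu.-integrable half (EFin \o f).
Proof.
apply/integrableP; split; first by apply/measurable_EFinP; exact: measurable_chi2_dens.
rewrite [ltLHS](_ : _ = chi2_mass R k) ?chi2_mass_lty//.
by apply: eq_integral => t _; rewrite /= ger0_norm// chi2_dens_ge0.
Qed.

Let cj (j : nat) : R := expR (- (k%:R / 2) * ln (1 + 2 * j%:R)).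
Let gj (j : nat) (t : R) : R := expR (- t * j%:R) * f t.

Let int_gj j : mu.-integrable half (EFin \o gj j).
Proof.
apply: (@le_integrable _ _ _ mu half mhalf (EFin \o gj j) (EFin \o f)); last exact: int_f.
  apply/measurable_EFinP; apply: measurable_funM; last exact: measurable_chi2_dens.
  apply: measurable_funTS; apply: measurableT_comp; first exact: measurable_expR.
  by apply: measurable_funM.
move=> t; rewrite /= in_itv /= andbT => t0.
have g0 : 0 <= gj j t := mulr_ge0 (expR_ge0 _) (chi2_dens_ge0 _ _).
rewrite lee_fin (ger0_norm g0) ger0_norm ?chi2_dens_ge0//.
by rewrite ler_piMl ?chi2_dens_ge0// expR_le1 mulNr oppr_le0 mulr_ge0.
Qed.

Let Rint_gj j : (\int[mu]_(t in half) gj j t)%R = cj j * D0.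
Proof. by rewrite /Rintegral (chi2_laplace R k j) massE -EFinM. Qed.

Let Rint_sum (s : seq nat) (a : nat -> R) :
  mu.-integrable half (EFin \o (fun t => \sum_(j <- s) a j * gj j t)) /\
  (\int[mu]_(t in half) (\sum_(j <- s) a j * gj j t))%R = \sum_(j <- s) a j * (cj j * D0).
Proof.
elim: s => [|j s [IH1 IH2]].
  split.
    rewrite (_ : _ \o _ = cst 0%E); first exact: integrable0.
    by apply/funext => t /=; rewrite big_nil.
  by rewrite big_nil; under eq_Rintegral do rewrite big_nil; rewrite Rintegral_cst// mul0r.
have Z : mu.-integrable half (EFin \o (fun t => a j * gj j t)).
  rewrite (_ : _ \o _ = (fun t => (a j)%:E * (EFin \o gj j) t)%E) //.
  exact: integrableZl.
split.
  rewrite (_ : _ \o _ = (EFin \o (fun t => a j * gj j t)) \+ (EFin \o (fun t => \sum_(j <- s) a j * gj j t))).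
    exact: integrableD.
  by apply/funext => t /=; rewrite big_cons EFinD.
rewrite big_cons -IH2 -Rint_gj -RintegralZl// -RintegralD//.
by apply: eq_Rintegral => t _; rewrite big_cons.
Qed.

Let Ix (x : R) : R := (\int[mu]_(t in `[0%R, x]) f t)%R.

Let int_fx x : mu.-integrable (`[0%R, x]%classic : set R) (EFin \o f).
Proof.
apply: (@integrableS _ _ _ mu half _ (EFin \o f) mhalf _ _ int_f); first exact: measurable_itv.
by move=> t /=; rewrite !in_itv /= andbT => /andP[].
Qed.

Lemma chi2_cdfE x : chi2_cdf k x = Ix x / D0.
Proof.
rewrite /chi2_cdf -/(chi2_mass R k) massE.
have fi := @integrable_fin_num _ _ _ mu `[0%R, x]%classic (measurable_itv _) _ (int_fx x).
by rewrite -(fineK fi) inver gt_eqF// -EFinM.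
Qed.

Let Rint_ind x : (\int[mu]_(t in half) (f \_ `]-oo, x]%classic) t)%R = Ix x.
Proof.
rewrite -Rintegral_mkcondr; congr Rintegral.
by apply/seteqP; split=> t /=; rewrite !in_itv /= andbT; [case=> -> ->|move=> /andP[]].
Qed.

Let int_ind x : mu.-integrable half (EFin \o (f \_ `]-oo, x]%classic)).
Proof.
have mp : measurable_fun half (EFin \o (f \_ `]-oo, x]%classic)).
  apply/measurable_EFinP; apply/measurable_restrict => //.
  exact: measurable_chi2_dens.
apply: (@le_integrable _ _ _ mu half mhalf _ (EFin \o f) mp _ int_f).
move=> t _; rewrite /= lee_fin patchE; case: ifP => // _.
by rewrite normr0.
Qed.

(** Integrates the sandwich against the normalized density; by [chi2_laplace] the middle becomes the
    combination of Laplace transforms to which the same [p] leads for the quadratic statistic. *)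
Lemma chi2_cdf_poly (p : {poly R}) (s t eps : R) :
  (forall q : R, 0 <= q -> (q <= s)%R%:R - eps <= p.[expR (- q)] <= (q <= t)%R%:R + eps) ->
  chi2_cdf k s - eps <= \sum_(j < size p) p`_j * expR (- (k%:R / 2) * ln (1 + 2 * j%:R))
    <= chi2_cdf k t + eps.
Proof.
move=> Hp; rewrite !chi2_cdfE.
have [I1 I2] := Rint_sum (index_iota 0 (size p)) (fun j => p`_j).
rewrite big_mkord in I2.
have HJ u : \sum_(j <- index_iota 0 (size p)) p`_j * gj j u = p.[expR (- u)] * f u.
  rewrite big_mkord horner_coef mulr_suml; apply: eq_bigr => j _.
  by rewrite /gj -expRM_natr mulrA.
have E1 : (\int[mu]_(u in half) (p.[expR (- u)] * f u))%R =
   (\sum_(j < size p) p`_j * cj j) * D0.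
  rewrite -[RHS](_ : \sum_(j < size p) p`_j * (cj j * D0) = _).
    by rewrite -I2; apply: eq_Rintegral => u _; rewrite HJ.
  by rewrite mulr_suml; apply: eq_bigr => j _; rewrite mulrA.
have I3 : mu.-integrable half (EFin \o (fun u => p.[expR (- u)] * f u)).
  by rewrite (_ : (fun u => _) = (fun u => \sum_(j <- index_iota 0 (size p)) p`_j * gj j u)) //; apply/funext => u; rewrite HJ.
have Ie : mu.-integrable half (EFin \o (fun u => eps * f u)).
  by rewrite (_ : _ \o _ = (fun t => eps%:E * (EFin \o f) t)%E) //; exact: integrableZl.
have Re : (\int[mu]_(u in half) (eps * f u))%R = eps * D0 by rewrite RintegralZl.
have indE x u : (f \_ `]-oo, x]%classic) u = (u <= x)%R%:R * f u.
  rewrite patchE; case: ifPn => [/set_mem|/negP h] /=; rewrite ?in_itv /=.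
    by move=> ->; rewrite mul1r.
  by case: leP => [ux|_]; [case: h; apply/mem_set; rewrite /= in_itv|rewrite mul0r].
apply/andP; split.
  rewrite -(ler_pM2r D0_gt0) mulrBl divfK ?gt_eqF// -E1 -Re -Rint_ind -RintegralB//.
  apply: le_Rintegral => //.
    have := @integrableB _ _ _ mu half mhalf _ _ (int_ind s) Ie.
    by congr (is_true (integrable _ _ _)); apply/funext => u /=; rewrite EFinB.
  move=> u; rewrite /= in_itv /= andbT => u0; rewrite indE -mulrBl.
  by rewrite ler_wpM2r ?chi2_dens_ge0//; have /andP[] := Hp u u0.
rewrite -(ler_pM2r D0_gt0) mulrDl divfK ?gt_eqF// -E1 -Re -Rint_ind -RintegralD//.
apply: le_Rintegral => //.
  have := @integrableD _ _ _ mu half mhalf _ _ (int_ind t) Ie.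
  by congr (is_true (integrable _ _ _)); apply/funext => u /=; rewrite EFinD.
move=> u; rewrite /= in_itv /= andbT => u0; rewrite indE -mulrDl.
by rewrite ler_wpM2r ?chi2_dens_ge0//; have /andP[] := Hp u u0.
Qed.

Lemma chi2_cdf_le0 x : x <= 0 -> chi2_cdf k x = 0 :> R.
Proof.
rewrite chi2_cdfE /Ix le_eqVlt => /predU1P[->|x0].
  by rewrite set_itv1 Rintegral_set1 mul0r.
by rewrite set_itv_ge ?Rintegral_set0 ?mul0r// bnd_simp -ltNge.
Qed.

Let Ix_cont b : 0 < b -> {within `[0, b], continuous Ix}.
Proof. by move=> b0; apply: parameterized_integral_continuous; [exact: ltW|exact: int_fx]. Qed.

Let Ix_at_right x : 0 <= x -> Ix y @[y --> x^'+] --> Ix x.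
Proof.
move=> x0; have x1 : 0 < x + 1 by lra.
have := Ix_cont x1; move/(continuous_within_itvP _ x1) => [C1 C2 _].
have [->|xn0] := eqVneq x 0; first exact: C2.
apply: cvg_at_right_filter; apply: C1.
by rewrite in_itv /= lt_def xn0 x0 ltrDl ltr01.
Qed.

Let Ix_at_left x : 0 < x -> Ix y @[y --> x^'-] --> Ix x.
Proof.
move=> x0; have x1 : 0 < x + 1 by lra.
have := Ix_cont x1; move/(continuous_within_itvP _ x1) => [C1 _ _].
by apply: cvg_at_left_filter; apply: C1; rewrite in_itv /= x0 ltrDl ltr01.
Qed.

Lemma chi2_cdf_right x (d : R) : 0 < d ->
  exists2 h : R, 0 < h & chi2_cdf k (x + h) <= chi2_cdf k x + d.
Proof.
move=> d0; have [x0|x0] := leP 0 x; last first.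
  exists (- x / 2); first by lra.
  by rewrite !chi2_cdf_le0; lra.
have dD : 0 < d * D0 by rewrite mulr_gt0.
have C := Ix_at_right x0.
near x^'+ => y.
exists (y - x); first by rewrite subr_gt0.
rewrite addrC subrK !chi2_cdfE -[d](mulfK (lt0r_neq0 D0_gt0)) -mulrDl ler_pM2r ?invr_gt0//.
have : `|Ix x - Ix y| < d * D0 by near: y; exact: cvgr_dist_lt.
rewrite distrC => /ltW /(le_trans (ler_norm _)); lra.
Unshelve. all: by end_near. Qed.

Lemma chi2_cdf_left x (d : R) : 0 < x -> 0 < d ->
  exists2 h : R, 0 < h & chi2_cdf k x - d <= chi2_cdf k (x - h).
Proof.
move=> x0 d0; have dD : 0 < d * D0 by rewrite mulr_gt0.
have C := Ix_at_left x0.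
near x^'- => y.
exists (x - y); first by rewrite subr_gt0.
rewrite subKr !chi2_cdfE -[d](mulfK (lt0r_neq0 D0_gt0)) -mulrBl ler_pM2r ?invr_gt0//.
have : `|Ix x - Ix y| < d * D0 by near: y; exact: cvgr_dist_lt.
move=> /ltW /(le_trans (ler_norm _)); lra.
Unshelve. all: by end_near. Qed.

End ChiSquareCdf.

(** * Explicit bounds for a fixed number of subjects *)

Section FiniteSample.
Variables (R : realType).

Lemma bt_gE n (beta : 'I_n -> R) i j : bt_g beta i j = (dsigm (beta i - beta j))^-1.
Proof. by rewrite dsigmE invf_div. Qed.

Lemma bt_g_le_b n (beta : 'I_n -> R) (i j : 'I_n) : i != j -> bt_g beta i j <= bt_b beta.
Proof.
move=> ij; apply: le_trans (le_bigmax _ _ i).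
exact: (le_bigmax_cond _ (bt_g beta i)).
Qed.

Lemma dsigm_ge_bt_b n (beta : 'I_n -> R) (i j : 'I_n) : i != j ->
  (bt_b beta)^-1 <= dsigm (beta i - beta j).
Proof.
move=> ij; have := bt_g_le_b beta ij; rewrite bt_gE => h.
have d0 := dsigm_gt0 (beta i - beta j).
have b0 : 0 < bt_b beta by apply: lt_le_trans h; rewrite invr_gt0.
by rewrite invf_ple ?posrE.
Qed.

Lemma bt_c_le_g n (beta : 'I_n -> R) (i j : 'I_n) : i != j -> bt_c beta <= bt_g beta i j.
Proof.
move=> ij; apply: (le_trans (bigmin_le _ i _)).
exact: bigmin_le_cond.
Qed.

Lemma bt_g_gt0 n (beta : 'I_n -> R) i j : 0 < bt_g beta i j.
Proof. by rewrite bt_gE invr_gt0 dsigm_gt0. Qed.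

Lemma bt_c_gt0 n (beta : 'I_n -> R) : 0 < bt_b beta -> 0 < bt_c beta.
Proof.
move=> b0; apply: lt_bigmin => // i _; apply: lt_bigmin => // j _.
exact: bt_g_gt0.
Qed.

Section Fixed.
Variables (n K r : nat) (beta : 'I_n -> R).
Hypotheses (K_gt0 : (0 < K)%N) (r_gt2 : (2 < r)%N) (r_le_n : (r.*2 <= n)%N).
Hypothesis beta0 : Theta0 n r beta.

Let n_gt2 : (2 < n)%N.
Proof. by apply: leq_trans r_le_n; rewrite -addnn ltn_addr. Qed.

(** As [r > 2], the block has two distinct members; their equal parameters give [bt_g] its smallest
    possible value. This bounds [bt_b] below and [bt_c] above. *)
Lemma null_pair : exists i j : 'I_n, i != j /\ bt_g beta i j = 4.
Proof.
have n1 : (1 < n)%N by apply: ltnW.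
exists (Ordinal n1), (Ordinal n_gt2); split=> //.
have E : beta (Ordinal n1) = beta (Ordinal n_gt2).
  have [_ H] := beta0; apply: H => /=; last exact: r_gt2.
  exact: ltnW r_gt2.
by rewrite /bt_g E subrr expR0 divr1; ring.
Qed.

Lemma bt_b_ge4 : 4 <= bt_b beta.
Proof. by have [i [j [ij <-]]] := null_pair; exact: bt_g_le_b. Qed.

Lemma bt_c_itv : 0 < bt_c beta <= 4.
Proof.
have [i [j [ij E]]] := null_pair; rewrite -E bt_c_le_g// andbT.
by apply: bt_c_gt0; apply: lt_le_trans bt_b_ge4.
Qed.

Local Notation b := (bt_b beta).
Local Notation m := ((r.-1)%:R : R).

(* The radius [rate * n] of the good event for the scores: large enough for a union bound over
   [n] Hoeffding-type tails. *)
Definition rate : R := 4 * K%:R * (Num.sqrt (ln n%:R) / Num.sqrt n%:R).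
Definition rel_err : R := b ^+ 3 * rate.

Hypothesis lnn : 1 <= ln (n%:R : R).
Hypothesis small : K%:R * rel_err <= 100^-1.

Let n0 : 0 < n%:R :> R. Proof. by rewrite ltr0n (ltn_trans _ n_gt2). Qed.
Let q0 : 0 < Num.sqrt n%:R :> R. Proof. by rewrite sqrtr_gt0. Qed.
Let K1 : 1 <= K%:R :> R. Proof. by rewrite ler1n. Qed.
Let b1 : 1 <= b. Proof. by apply: le_trans bt_b_ge4; lra. Qed.
Let l1 : 1 <= Num.sqrt (ln n%:R) :> R.
Proof. by rewrite -[leLHS]sqrtr1 ler_wsqrtr. Qed.

Let rate_ge : (Num.sqrt n%:R)^-1 <= rate.
Proof.
rewrite /rate mulrA -[leLHS]mul1r ler_pM2r ?invr_gt0//.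
have := K1; have := l1; move: (Num.sqrt (ln _)) => l; nra.
Qed.

Let rate0 : 0 < rate. Proof. by apply: lt_le_trans rate_ge; rewrite invr_gt0. Qed.
Let rate_le : rate <= rel_err.
Proof. by rewrite /rel_err ler_peMl ?(ltW rate0)// exprn_ege1. Qed.
Let rel0 : 0 < rel_err. Proof. exact: lt_le_trans rate_le. Qed.

Let rel_small : rel_err <= 100^-1.
Proof. by apply: le_trans small; rewrite ler_peMl ?(ltW rel0). Qed.

Lemma good_event_prob :
  bt_prob beta (fun w : outcome n K => ~~ [forall i, `|bt_score beta w i| <= rate * n%:R]) <= 2 / n%:R.
Proof.
have K0 : 0 < K%:R :> R by rewrite ltr0n.
(* Minimizes the exponent in [score_tail]; the minimum is [- 2 * ln n], so the union bound leaves
   [2 / n]. *)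
pose l := rate / (4 * K%:R ^+ 2).
have lK : l * K%:R <= 1.
  have -> : l * K%:R = Num.sqrt (ln n%:R) / Num.sqrt n%:R.
    by rewrite /l /rate; field; rewrite !gt_eqF.
  rewrite ler_pdivrMr// mul1r ler_wsqrtr// ltW// ln_sublinear//.
have l0 : 0 <= l by rewrite divr_ge0 ?(ltW rate0)// mulr_ge0 ?sqr_ge0.
apply: (le_trans (score_tail beta (rate * n%:R) lK l0)).
have -> : 2 * l ^+ 2 * K%:R ^+ 2 * n%:R - l * (rate * n%:R) = - ln n%:R - ln n%:R.
  have lE : Num.sqrt (ln n%:R) ^+ 2 = ln n%:R :> R by rewrite sqr_sqrtr// (le_trans ler01).
  have nE : Num.sqrt n%:R ^+ 2 = n%:R :> R by rewrite sqr_sqrtr// ltW.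
  rewrite -lE /l /rate -[X in _ * X - _]nE -[X in _ - _ * (_ * X)]nE.
  by field; rewrite !gt_eqF.
rewrite expRD expRN lnK ?posrE// le_eqVlt; apply/orP; left; apply/eqP.
by field; rewrite gt_eqF.
Qed.

Lemma LR_good (w : outcome n K) : [forall i, `|bt_score beta w i| <= rate * n%:R] ->
  quad_stat w beta r_gt2 r_le_n * (2 - (1 + 12 * rel_err) * expR (4 * rel_err) - m * rel_err)
  <= LR_stat n K r w <= quad_stat w beta r_gt2 r_le_n / (1 - 16 * rel_err).
Proof.
move=> /forallP good; apply: LR_stat_bounds => //.
exact: dsigm_ge_bt_b.
Qed.

Let g_lt : (1 < n)%N. Proof. exact: ltnW. Qed.
Local Notation A := (block_info K (null_block n r) (Ordinal g_lt) beta).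

Let A_ge : K%:R * n%:R / (2 * b) <= A.
Proof.
have gG : Ordinal g_lt \in null_block n r by rewrite inE /= ltnW.
have b0 : 0 < b := lt_le_trans ltr01 b1.
apply: le_trans (block_info_ge K gG (@dsigm_ge_bt_b _ beta)).
rewrite card_null_block// invfM mulrA ler_pM2r ?invr_gt0// -mulrA ler_pM2l ?ltr0n//.
have : (r.*2)%:R <= n%:R :> R by rewrite ler_nat.
have : (r.-1)%:R <= r%:R :> R by rewrite ler_nat leq_pred.
rewrite -muln2 natrM; lra.
Qed.

Let A0 : 0 < A.
Proof.
have b0 : 0 < b := lt_le_trans ltr01 b1.
by apply: lt_le_trans A_ge; rewrite divr_gt0 ?mulr_gt0// ltr0n.
Qed.

(** [heat_const] written with [r.-1] for the size of the block, so as to be independent of [n],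
    combined with the bounds [3 * K ^+ 2 * rel_err] for [n * x ^+ 3] and [2 * K * rel_err] for
    [x ^+ 2]. *)
Definition laplace_const (j : nat) : R :=
  3 * K%:R ^+ 2 * (cubic_const (j%:R * m) + 2 * (j%:R * m) + 3 * (j%:R * m) ^+ 2
    + 4 * j%:R ^+ 2 * quad_const ((m - 1) / 2) j%:R) + j%:R * (m ^+ 3 * (2 * K%:R)).

Let quad_statE (w : outcome n K) : quad_stat w beta r_gt2 r_le_n =
  \sum_(i in null_block n r) block_dev (null_block n r) beta w i ^+ 2 / A.
Proof. by apply: eq_bigr => i _; rewrite [Ordinal _](_ : _ = Ordinal g_lt)//; exact: val_inj. Qed.

Lemma quad_stat_ge0 (w : outcome n K) : 0 <= quad_stat w beta r_gt2 r_le_n.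
Proof.
by rewrite quad_statE sumr_ge0// => i _; rewrite divr_ge0 ?sqr_ge0// (ltW A0).
Qed.

Lemma quad_stat_laplace_le (j : nat) :
  `|expect (@bt_coord R n K beta) (fun w => expR (- quad_stat w beta r_gt2 r_le_n) ^+ j)
    - expR (- ((r - 2)%:R / 2) * ln (1 + 2 * j%:R))| <= laplace_const j * rel_err.
Proof.
have b0 : 0 < b := lt_le_trans ltr01 b1.
have K0 : 0 < K%:R :> R by rewrite ltr0n.
have gG : Ordinal g_lt \in null_block n r by rewrite inE /= ltnW.
set x : R := K%:R / Num.sqrt A.
have x0 : 0 <= x by rewrite divr_ge0 ?sqrtr_ge0.
have ninv : n%:R^-1 <= rate ^+ 2.
  have -> : n%:R^-1 = (Num.sqrt n%:R)^-1 ^+ 2 :> R by rewrite exprVn sqr_sqrtr// ltW.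
  by rewrite lerXn2r ?nnegrE ?invr_ge0 ?sqrtr_ge0 ?(ltW rate0).
have x2 : x ^+ 2 <= 2 * K%:R * b / n%:R.
  rewrite /x exprMn exprVn sqr_sqrtr ?(ltW A0)// ler_pdivrMr//.
  apply: (@le_trans _ _ (2 * K%:R * b / n%:R * (K%:R * n%:R / (2 * b)))).
    by rewrite le_eqVlt; apply/orP; left; apply/eqP; field; rewrite !gt_eqF.
  by rewrite ler_wpM2l ?A_ge// divr_ge0 ?mulr_ge0// ?(ltW b0) ?(ltW n0).
have b3r : b ^+ 3 * rate ^+ 2 <= rel_err ^+ 2.
  by rewrite [rate ^+ 2]expr2 mulrA -/rel_err expr2 ler_pM2l.
have x2' : x ^+ 2 <= 2 * K%:R * rel_err ^+ 2.
  apply: (le_trans x2); rewrite -!mulrA ler_pM2l// ler_pM2l// (le_trans _ b3r)//.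
  apply: ler_pM => //; first exact: ltW.
  by rewrite exprS ler_peMr ?(ltW b0)// exprn_ege1.
have z1 : rel_err <= 1 by have := rel_small; lra.
have zz : rel_err ^+ 2 <= rel_err by rewrite expr2 ler_piMr// ltW.
have x2'' : x ^+ 2 <= 2 * K%:R * rel_err by apply: (le_trans x2'); rewrite ler_pM2l ?mulr_gt0.
have x1 : x <= 1.
  rewrite -(@ler_pXn2r _ 2) ?nnegrE// expr1n (le_trans x2'')//.
  by have := small; lra.
(* Squared, the left side is at most [8 * K ^+ 3 * b ^+ 3 / n]; then [1 / n <= rate ^+ 2] bounds
   [b ^+ 3 / n] by [rel_err ^+ 2], and [8 * K ^+ 3 <= (3 * K ^+ 2) ^+ 2]. *)
have nx3 : n%:R * x ^+ 3 <= 3 * K%:R ^+ 2 * rel_err.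
  rewrite -(@ler_pXn2r _ 2) ?nnegrE ?mulr_ge0 ?exprn_ge0 ?(ltW rate0) ?(ltW b0) ?(ltW n0) ?(ltW K0)//.
  have -> : (n%:R * x ^+ 3) ^+ 2 = n%:R ^+ 2 * (x ^+ 2) ^+ 3 by ring.
  apply: (@le_trans _ _ (n%:R ^+ 2 * (2 * K%:R * b / n%:R) ^+ 3)).
    rewrite ler_wpM2l ?sqr_ge0// lerXn2r ?nnegrE ?sqr_ge0//.
    by rewrite divr_ge0 ?mulr_ge0// ?(ltW b0) ?(ltW n0).
  have -> : n%:R ^+ 2 * (2 * K%:R * b / n%:R) ^+ 3 = 8 * K%:R ^+ 3 * (b ^+ 3 / n%:R).
    by field; rewrite gt_eqF.
  have -> : (3 * K%:R ^+ 2 * rel_err) ^+ 2 = 9 * K%:R ^+ 4 * rel_err ^+ 2 by ring.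
  have bn : 0 <= b ^+ 3 / n%:R by rewrite divr_ge0 ?exprn_ge0 ?(ltW b0) ?(ltW n0).
  have K3 : 0 <= 8 * K%:R ^+ 3 :> R by rewrite mulr_ge0 ?exprn_ge0.
  apply: ler_pM => //.
    have : K%:R ^+ 3 <= K%:R ^+ 4 :> R by rewrite ler_weXn2l.
    have : 0 <= K%:R ^+ 3 :> R by rewrite exprn_ge0// ltW.
    lra.
  by apply: (le_trans _ b3r); rewrite ler_wpM2l// exprn_ge0// ltW.
have fb : flat (null_block n r) beta by have [] := (theta0P r beta).1 beta0.
have := quad_stat_laplace gG fb A0 x1 (ler0n R j).
rewrite -/x card_null_block//.
have -> : m - 1 = (r - 2)%:R.
  by rewrite -subn1 !natrB ?(ltnW r_gt2)// ?(ltn_trans _ r_gt2)//; ring.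
have EQ : expect (@bt_coord R n K beta) (fun w => expR (- quad_stat w beta r_gt2 r_le_n) ^+ j) =
  expect (bt_coord beta) (fun w : outcome n K => expR (- j%:R *
   \sum_(i in null_block n r) block_dev (null_block n r) beta w i ^+ 2 / A)).
  by apply: eq_expect => w; rewrite -expRM_natr quad_statE; congr expR; ring.
rewrite -EQ => /le_trans; apply.
have HC : heat_const (null_block n r) j%:R = cubic_const (j%:R * m) + 2 * (j%:R * m)
   + 3 * (j%:R * m) ^+ 2 + 4 * j%:R ^+ 2 * quad_const ((m - 1) / 2) j%:R.
  by rewrite /heat_const card_null_block.
have hc0 : 0 <= heat_const (null_block n r) (j%:R : R).
  by apply: heat_const_ge0 => //; apply/card_gt0P; exists (Ordinal g_lt).
have m0 : 0 <= j%:R * m ^+ 3 by rewrite mulr_ge0 ?exprn_ge0.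
have := lerD (ler_wpM2r hc0 nx3) (ler_wpM2l m0 x2'').
by rewrite /laplace_const -HC; move: (heat_const _ _) => h; lra.
Qed.

End Fixed.
End FiniteSample.

(** * Passage to the limit *)

Section Asymptotics.
Variables (R : realType) (K r : nat).
Hypotheses (K_gt0 : (0 < K)%N) (r_gt2 : (2 < r)%N).

Local Notation m := ((r.-1)%:R : R).

(** The expectation of [p.[expR (- X)]] for [X] chi-square with [r - 2] degrees of freedom. *)
Definition laplace_sum (p : {poly R}) : R :=
  \sum_(j < size p) p`_j * expR (- ((r - 2)%:R / 2) * ln (1 + 2 * j%:R)).
Definition poly_err (p : {poly R}) : R := \sum_(j < size p) `|p`_j| * laplace_const R K r j.

Section Transfer.
Variables (n : nat) (beta : 'I_n -> R).
Hypotheses (r_le_n : (r.*2 <= n)%N) (beta0 : Theta0 n r beta).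
Hypotheses (lnn : 1 <= ln (n%:R : R)) (small : K%:R * rel_err K beta <= 100^-1).

Local Notation Q := (fun w : outcome n K => quad_stat w beta r_gt2 r_le_n).
Local Notation good :=
  (fun w : outcome n K => [forall i, `|bt_score beta w i| <= rate R n K * n%:R]).
Local Notation E := (expect (@bt_coord R n K beta)).

Lemma expect_poly_le (p : {poly R}) :
  `|E (fun w => p.[expR (- Q w)]) - laplace_sum p| <= poly_err p * rel_err K beta.
Proof.
have -> : E (fun w => p.[expR (- Q w)]) =
    \sum_(j < size p) p`_j * E (fun w => expR (- Q w) ^+ j).
  under [RHS]eq_bigr => j _ do rewrite -expectZ.
  by rewrite -expect_sum; apply: eq_expect => w; rewrite horner_coef.
rewrite /laplace_sum -sumrB (le_trans (ler_norm_sum _ _ _))// /poly_err mulr_suml.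
apply: ler_sum => j _; rewrite -mulrBr normrM -mulrA ler_wpM2l//.
exact: (quad_stat_laplace_le K_gt0 r_gt2 r_le_n beta0 lnn small).
Qed.

Lemma bad_event_le : E (fun w => (~~ good w)%:R) <= 2 / n%:R.
Proof. by rewrite -bt_probE; exact: (good_event_prob beta K_gt0 r_gt2 r_le_n lnn). Qed.

Lemma prob_le_laplace_sum (p : {poly R}) (x s eps : R) : 0 <= eps ->
  (forall q : R, 0 <= q -> (q <= s)%R%:R - eps <= p.[expR (- q)]) ->
  (forall w, good w -> LR_stat n K r w <= x -> Q w <= s) ->
  bt_prob beta (fun w : outcome n K => LR_stat n K r w <= x)
    <= laplace_sum p + poly_err p * rel_err K beta + eps + 2 / n%:R.
Proof.
move=> eps0 ps QLR; rewrite bt_probE.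
apply: (@le_trans _ _ (E (fun w => p.[expR (- Q w)] + eps + (~~ good w)%:R))).
  apply: expect_le => [e a|w]; first exact: bt_coord_ge0.
  have q0 := quad_stat_ge0 K_gt0 r_gt2 r_le_n beta0 w.
  have := ps _ q0; have := QLR w; case: (good w) => /= H; last first.
    case: (_ <= x); case: (_ <= s) => /=; lra.
  case: (_ <= x) H => /= [/(_ isT isT) ->|_] /=; first lra.
  case: (_ <= s) => /=; lra.
rewrite !expectD expect_cst; last exact: bt_coord_sum1.
have := expect_poly_le p; rewrite ler_distl => /andP[_].
have := bad_event_le; lra.
Qed.

Lemma laplace_sum_le_prob (p : {poly R}) (x t eps : R) : 0 <= eps ->
  (forall q : R, 0 <= q -> p.[expR (- q)] <= (q <= t)%R%:R + eps) ->
  (forall w, good w -> Q w <= t -> LR_stat n K r w <= x) ->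
  laplace_sum p - poly_err p * rel_err K beta - eps - 2 / n%:R
    <= bt_prob beta (fun w : outcome n K => LR_stat n K r w <= x).
Proof.
move=> eps0 pt QLR; rewrite bt_probE.
apply: (@le_trans _ _ (E (fun w => p.[expR (- Q w)] - eps - (~~ good w)%:R))); last first.
  apply: expect_le => [e a|w]; first exact: bt_coord_ge0.
  have q0 := quad_stat_ge0 K_gt0 r_gt2 r_le_n beta0 w.
  have := pt _ q0; have := QLR w; case: (good w) => /= H; last first.
    case: (_ <= x); case: (_ <= t) => /=; lra.
  case: (_ <= t) H => /= [/(_ isT isT) ->|_] /=; first lra.
  case: (_ <= x) => /=; lra.
rewrite !expectB expect_cst; last exact: bt_coord_sum1.
have := expect_poly_le p; rewrite ler_distl => /andP[+ _].
have := bad_event_le; lra.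
Qed.

Lemma rel_err_ge0 : 0 <= rel_err K beta.
Proof.
have b0 : 0 <= bt_b beta by apply: le_trans (bt_b_ge4 r_gt2 r_le_n beta0).
by rewrite mulr_ge0 ?exprn_ge0// /rate !mulr_ge0// ?invr_ge0 ?sqrtr_ge0.
Qed.

Let z := rel_err K beta.
Let z_le : z <= 100^-1.
Proof. by apply: le_trans small; rewrite ler_peMl ?rel_err_ge0// ler1n. Qed.

(** For [z <= 1/100] one has [expR (4 * z) <= 1 + 5 * z] and
    [(1 + 12 * z) * (1 + 5 * z) <= 1 + 18 * z]. *)
Lemma lower_factor_ge : 1 - (18 + m) * z <= 2 - (1 + 12 * z) * expR (4 * z) - m * z.
Proof.
have z0 : 0 <= z := rel_err_ge0; have z1 : z <= 100^-1 := z_le.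
have e0 := expR_gt0 (4 * z).
have He : expR (4 * z) * (1 - 4 * z) <= 1.
  rewrite -[leRHS](expRxMexpNx_1 (4 * z)) ler_wpM2l ?expR_ge0//.
  by have := expR_ge1Dx (- (4 * z)).
move: (expR _) e0 He => e e0; move: z z0 z1 => y y0 y1 He.
have yy : y * y <= 100^-1 * y by rewrite ler_wpM2r.
have e5 : e <= 1 + 5 * y by rewrite -(@ler_pM2r _ (1 - 4 * y)); lra.
have : (1 + 12 * y) * e <= (1 + 12 * y) * (1 + 5 * y) by rewrite ler_wpM2l//; lra.
lra.
Qed.

(** The tolerance makes [x / (1 - h / (2 * (x + h))) <= x + h / 2] for [x >= 0], that is,
    [4 * x * (x + h) <= (2 * x + h) ^+ 2]. *)
Lemma quad_le_of_LR_le (x h : R) (w : outcome n K) : 0 < h ->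
  (18 + m) * z <= h / (2 * (`|x| + h)) -> good w ->
  LR_stat n K r w <= x -> Q w <= x + h / 2.
Proof.
move=> h0 zh gw LRx.
have q0 := quad_stat_ge0 K_gt0 r_gt2 r_le_n beta0 w.
have /andP[+ _] := LR_good K_gt0 r_gt2 r_le_n beta0 lnn small gw.
move=> /le_trans/(_ LRx) LRq.
have {LRq} : quad_stat w beta r_gt2 r_le_n * (1 - h / (2 * (`|x| + h))) <= x.
  apply: le_trans LRq; rewrite ler_wpM2l//.
  by apply: le_trans lower_factor_ge; rewrite lerD2l lerN2.
move: (quad_stat _ _ _ _) q0 => q q0.
have n0 := normr_ge0 x; have xn := ler_norm x.
have d0 : 0 < 2 * (`|x| + h) by lra.
have -> : q * (1 - h / (2 * (`|x| + h))) = q * (2 * `|x| + h) / (2 * (`|x| + h)).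
  by field; rewrite !gt_eqF //; lra.
rewrite ler_pdivrMr// => H.
(* A negative [x] is impossible here, since the lower bound for [LR_stat] is nonnegative. *)
have [x0|x0] := leP 0 x; first by rewrite ger0_norm// in H; nra.
have : q * (2 * `|x| + h) < 0 by apply: le_lt_trans H _; rewrite nmulr_rlt0.
by rewrite ltNge mulr_ge0//; lra.
Qed.

Lemma LR_le_of_quad_le (x h : R) (w : outcome n K) : 0 < h -> 0 < x ->
  (18 + m) * z <= h / (2 * (`|x| + h)) -> good w ->
  Q w <= x - h / 2 -> LR_stat n K r w <= x.
Proof.
move=> h0 x0 zh gw Qx.
have /andP[_] := LR_good K_gt0 r_gt2 r_le_n beta0 lnn small gw.
move=> /le_trans; apply; have z0 : 0 <= z := rel_err_ge0; have z1 : z <= 100^-1 := z_le.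
rewrite -/z ler_pdivrMr; last lra.
apply: (le_trans Qx); rewrite gtr0_norm// in zh.
have : 16 * z <= h / (2 * (x + h)).
  by apply: le_trans zh; rewrite ler_wpM2r//; have := ler0n R r.-1; lra.
rewrite ler_pdivlMr; last lra.
nra.
Qed.

End Transfer.

Variable beta : forall n, 'I_n -> R.
Arguments beta : clear implicits.
Hypothesis beta0 : forall n, Theta0 n r (beta n).
Hypothesis rate_cvg : (fun n : nat => bt_b (beta n) ^+ 11 / bt_c (beta n) ^+ 6
    * (powR (ln (n%:R : R)) (5 / 2) / Num.sqrt (n%:R : R))) @ \oo --> (0 : R).

Let r_le_near : \forall n \near \oo, (r.*2 <= n)%N.
Proof. by exists (r.*2). Qed.

Let ln_ge1_near : \forall n \near \oo, 1 <= ln (n%:R : R).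
Proof.
near=> n; rewrite -ler_expR lnK ?posrE; last by rewrite ltr0n; near: n; exists 1%N.
by near: n; exact: nbhs_infty_ger.
Unshelve. all: by end_near. Qed.

(** With [bt_b >= 1], [ln n >= 1] and [bt_c <= 4], [rel_err] is at most [C] times the quantity in
    the rate hypothesis: [4 * K] comes from [rate], and [4 ^+ 6] from [bt_c ^+ 6]. *)
Lemma rel_err_cvg0 : (fun n => rel_err K (beta n)) @ \oo --> (0 : R).
Proof.
pose C : R := 4 * K%:R * 4 ^+ 6.
apply: (@squeeze_cvgr _ _ _ _ (fun=> 0) (fun n : nat => C * (bt_b (beta n) ^+ 11 / bt_c (beta n) ^+ 6
    * (powR (ln (n%:R : R)) (5 / 2) / Num.sqrt (n%:R : R))))); last 2 first.
- exact: cvg_cst.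
- by rewrite -[X in _ --> X](mulr0 C); apply: cvgMr; exact: rate_cvg.
near=> n.
have rn : (r.*2 <= n)%N by near: n.
have ln1 : 1 <= ln (n%:R : R) by near: n.
rewrite (rel_err_ge0 rn (beta0 n)) /=.
have b1 : 1 <= bt_b (beta n) by apply: le_trans (bt_b_ge4 r_gt2 rn (beta0 n)); lra.
have /andP[c0 c4] := bt_c_itv r_gt2 rn (beta0 n).
have lp : Num.sqrt (ln n%:R) <= powR (ln (n%:R : R)) (5 / 2).
  rewrite -powR12_sqrt ?(le_trans ler01)// ler_powR//; lra.
rewrite /rel_err /rate.
set l := Num.sqrt (ln _) in lp *; set L := powR _ _ in lp *; set q := Num.sqrt _.
have -> : bt_b (beta n) ^+ 3 * (4 * K%:R * (l / q)) = 4 * K%:R * (bt_b (beta n) ^+ 3 * (l / q)).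
  by ring.
rewrite /C -[leRHS]mulrA ler_wpM2l ?mulr_ge0// mulrA.
have l0 : 0 <= l by exact: sqrtr_ge0.
have q0 : 0 <= q^-1 by rewrite invr_ge0 sqrtr_ge0.
have b0 : 0 <= bt_b (beta n) by apply: le_trans b1.
apply: ler_pM; rewrite ?exprn_ge0 ?mulr_ge0//; last by rewrite ler_wpM2r.
apply: (@le_trans _ _ (bt_b (beta n) ^+ 11)); first by rewrite ler_weXn2l.
have -> : 4 ^+ 6 * (bt_b (beta n) ^+ 11 / bt_c (beta n) ^+ 6) =
   bt_b (beta n) ^+ 11 * (4 / bt_c (beta n)) ^+ 6 by rewrite expr_div_n; ring.
rewrite ler_peMr ?exprn_ge0// exprn_ege1// ler_pdivlMr// mul1r//.
Unshelve. all: by end_near. Qed.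

Let rel_err_near (c e : R) : 0 <= c -> 0 < e -> \forall n \near \oo, c * rel_err K (beta n) <= e.
Proof.
move=> c0 e0; have : (fun n => c * rel_err K (beta n)) @ \oo --> (c * 0 : R).
  by apply: cvgMr; exact: rel_err_cvg0.
rewrite mulr0 => /cvgrPdist_le/(_ _ e0); apply: filterS => n.
by rewrite sub0r normrN; apply: le_trans; exact: ler_norm.
Qed.

Let inv_near (e : R) : 0 < e -> \forall n \near \oo, 2 / n%:R <= e.
Proof.
move=> e0; near=> n.
have n0 : 0 < n%:R :> R by rewrite ltr0n; near: n; exists 1%N.
rewrite ler_pdivrMr// mulrC -ler_pdivrMr//.
by near: n; exact: nbhs_infty_ger.
Unshelve. all: by end_near. Qed.

Let k_gt0 : (0 < r - 2)%N. Proof. by rewrite subn_gt0. Qed.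

Let m18 : 0 <= 18 + m. Proof. by rewrite addr_ge0. Qed.

Let small_near : \forall n \near \oo, K%:R * rel_err K (beta n) <= 100^-1.
Proof. by apply: rel_err_near => //; rewrite invr_gt0. Qed.

Lemma prob_le_chi2 (x e : R) : 0 < e -> \forall n \near \oo,
  bt_prob (beta n) (fun w : outcome n K => LR_stat n K r w <= x) <= chi2_cdf (r - 2) x + e.
Proof.
(* Five errors: continuity of [chi2_cdf], its approximation by [p], the Laplace error, the slack in
   the indicator bound, the bad event. *)
move=> e0; pose d := e / 5; have d0 : 0 < d by rewrite divr_gt0.
have [h h0 Fh] := chi2_cdf_right k_gt0 x d0.
(* The first half of the gap from [x] to [x + h] absorbs the passage from [LR_stat] to the quadratic
   statistic, the second half the smoothing of the indicator. *)
have [p pE] : exists p : {poly R}, forall q : R, 0 <= q ->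
    (q <= x + h / 2)%R%:R - d <= p.[expR (- q)] <= (q <= x + h)%R%:R + d.
  by apply: poly_step => //; lra.
have /andP[_ Fp] := chi2_cdf_poly k_gt0 pE; rewrite -/(laplace_sum p) in Fp.
have xh : 0 < h / (2 * (`|x| + h)) by rewrite divr_gt0// mulr_gt0// ltr_wpDl.
near=> n.
have rn : (r.*2 <= n)%N by near: n.
have ln1 : 1 <= ln (n%:R : R) by near: n.
have sm : K%:R * rel_err K (beta n) <= 100^-1 by near: n.
have zh : (18 + m) * rel_err K (beta n) <= h / (2 * (`|x| + h)).
  by near: n; exact: rel_err_near.
have pe : `|poly_err p| * rel_err K (beta n) <= d by near: n; exact: rel_err_near.
have pe' : poly_err p * rel_err K (beta n) <= d.
  by apply: le_trans pe; rewrite ler_wpM2r ?ler_norm// (rel_err_ge0 rn (beta0 n)).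
have nd : 2 / n%:R <= d by near: n; exact: inv_near.
have ps q (q0 : 0 <= q) := (andP (pE q q0)).1.
have QL w gw := @quad_le_of_LR_le _ _ rn (beta0 n) ln1 sm x h w h0 zh gw.
have := prob_le_laplace_sum (beta0 n) ln1 sm (ltW d0) ps QL.
have -> : e = 5 * d by rewrite /d; field.
lra.
Unshelve. all: by end_near. Qed.

Lemma chi2_le_prob (x e : R) : 0 < e -> \forall n \near \oo,
  chi2_cdf (r - 2) x - e <= bt_prob (beta n) (fun w : outcome n K => LR_stat n K r w <= x).
Proof.
(* For [x <= 0] the distribution function is 0; the comparison [LR_le_of_quad_le] is for [x > 0]. *)
move=> e0; have [x0|x0] := leP x 0.
  near=> n; rewrite chi2_cdf_le0// (@le_trans _ _ 0)//; first lra.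
  rewrite bt_probE -[leLHS](expect_cst (bt_coord_sum1 K (beta n)) 0).
  by apply: expect_le => [e' a|w]; [exact: bt_coord_ge0|exact: ler0n].
pose d := e / 5; have d0 : 0 < d by rewrite divr_gt0.
have [h h0 Fh] := chi2_cdf_left k_gt0 x0 d0.
have [p pE] : exists p : {poly R}, forall q : R, 0 <= q ->
    (q <= x - h)%R%:R - d <= p.[expR (- q)] <= (q <= x - h / 2)%R%:R + d.
  by apply: poly_step => //; lra.
have /andP[Fp _] := chi2_cdf_poly k_gt0 pE; rewrite -/(laplace_sum p) in Fp.
have xh : 0 < h / (2 * (`|x| + h)) by rewrite divr_gt0// mulr_gt0// ltr_wpDl.
near=> n.
have rn : (r.*2 <= n)%N by near: n.
have ln1 : 1 <= ln (n%:R : R) by near: n.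
have sm : K%:R * rel_err K (beta n) <= 100^-1 by near: n.
have zh : (18 + m) * rel_err K (beta n) <= h / (2 * (`|x| + h)).
  by near: n; exact: rel_err_near.
have pe : `|poly_err p| * rel_err K (beta n) <= d by near: n; exact: rel_err_near.
have pe' : poly_err p * rel_err K (beta n) <= d.
  by apply: le_trans pe; rewrite ler_wpM2r ?ler_norm// (rel_err_ge0 rn (beta0 n)).
have nd : 2 / n%:R <= d by near: n; exact: inv_near.
have pt q (q0 : 0 <= q) := (andP (pE q q0)).2.
have QL w gw := @LR_le_of_quad_le _ _ rn (beta0 n) ln1 sm x h w h0 x0 zh gw.
have := laplace_sum_le_prob (beta0 n) ln1 sm (ltW d0) pt QL.
have -> : e = 5 * d by rewrite /d; field.
lra.
Unshelve. all: by end_near. Qed.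

End Asymptotics.

Theorem theorem4 (R : realType) (K r : nat) (beta : forall n : nat, 'I_n -> R) :
  (1 <= K)%N -> (2 < r)%N ->
  (forall n, beta n \in Theta0 n r) ->
  (fun n : nat => bt_b (beta n) ^+ 11 / bt_c (beta n) ^+ 6
                  * (powR (ln (n%:R : R)) (5 / 2) / Num.sqrt (n%:R : R)))
    @ \oo --> (0 : R) ->
  forall x : R,
    (fun n : nat => bt_prob (beta n) (fun w : outcome n K => LR_stat n K r w <= x))
      @ \oo --> chi2_cdf (r - 2) x.
Proof.
move=> K_gt0 r_gt2 beta_in rate_cvg x.
have beta0 n : Theta0 n r (beta n) by have := beta_in n; rewrite inE.
apply/cvgrPdist_le => e e0; near=> n; rewrite ler_distlC; apply/andP; split.
  by near: n; exact: chi2_le_prob.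
by near: n; exact: prob_le_chi2.
Unshelve. all: by end_near. Qed.
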